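(* Let $T\ge2$, $\delta\in(0,1)$, $\eta=1+RS$, $\alpha=\frac{3\eta}{2}$, and $$\lambda=\max\left\{\frac{6\eta Rk_\mu S}{g(\tau)},\ \frac{32\alpha dR^2}{7},\ \frac{c_\mu}{g(\tau)}\right\}.$$ Let $P_T:=\sum_{t=1}^{T-1}\|\theta_{t+1}^\star-\theta_t^\star\|_2$. Then, for every $\gamma\in[1/T,1)$, with probability at least $1-\delta$, the algorithm DOMD-GLB (described in the context) run with parameters $\gamma,\lambda,\delta$ has dynamic regret $$\mathrm{Reg}_T=\widetilde{\mathcal O}\left(\frac{k_\mu}{\sqrt{c_\mu}}\,d\sqrt T+\frac{k_\mu}{\sqrt{c_\mu}}\,dT\sqrt{1-\gamma}+\frac{k_\mu^{3/2}}{\sqrt{c_\mu}}\,\frac{P_T}{(1-\gamma)^{3/2}}\right).$$ Moreover, with the choice $$\gamma=1-\min\left\{1-\frac1T,\ \max\left\{\frac1T,\ \sqrt{\frac{\sqrt{k_\mu}\,P_T}{dT}}\right\}\right\},$$ with probability at least $1-\delta$, $$\mathrm{Reg}_T=\begin{cases}\widetilde{\mathcal O}\left(\frac{k_\mu}{\sqrt{c_\mu}}\,d\sqrt T\right),&\text{if }0\le P_T<\frac{d}{\sqrt{k_\mu}\,T},\\[1ex]\widetilde{\mathcal O}\left(\frac{k_\mu^{9/8}}{\sqrt{c_\mu}}\,d^{3/4}P_T^{1/4}T^{3/4}\right),&\text{if }\frac{d}{\sqrt{k_\mu}\,T}\le P_T\le\frac{dT}{\sqrt{k_\mu}}\left(1-\frac1T\right)^2,\\[1ex]\widetilde{\mathcal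 O}\left(\frac{k_\mu^{3/2}}{\sqrt{c_\mu}}\,P_T\right),&\text{if }P_T>\frac{dT}{\sqrt{k_\mu}}\left(1-\frac1T\right)^2.\end{cases}$$
   Context: Notation: $\|x\|_M:=\sqrt{x^\top Mx}$ for positive semidefinite $M$; $I_d$ is the identity. Nonstationary generalized linear bandit. Fix $d\ge1$, $R,S>0$. At each round $t=1,2,\dots$ a learner observes a set $\mathcal X_t\subset\mathbb R^d$, chooses $x_t\in\mathcal X_t$ (based on the past), and receives a reward $r_t$. There is an unknown parameter sequence $(\theta_t^\star)_{t\ge1}$ in $\mathbb R^d$, fixed independently of the reward noise (exogenous). Let $p(r\mid z)=\exp\left(\frac{rz-m(z)}{g(\tau)}+h(r,\tau)\right)$, a probability density in $r$ (with respect to a fixed reference measure) for every $z\in\mathbb R$, where $m:\mathbb R\to\mathbb R$ is convex and three times continuously differentiable and $g(\tau)>0$ is a known constant. Put $\mu:=m'$ (the link function). With $\widetilde{\mathcal F}_t:=\sigma(x_1,r_1,\dots,x_{t-1},r_{t-1},x_t)\vee\sigma(\theta_s^\star:s\ge1)$, the conditional law of $r_t$ given $\widetilde{\mathcal F}_t$ has density $p(\cdot\mid x_t^\top\theta_t^\star)$; in particular its conditional mean is $\mu(x_t^\top\theta_t^\star)$. Assumptions. (Boundedness) for all $t$: $\theta_t^\star\in\Theta:=\{\theta\in\mathbb R^d:\|\theta\|_2\le S\}$, $\|x\|_2\le1$ for all $x\in\mathcal X_t$, and $r_t\in[0,R]$ almost surely. (Bounded link) there are constants $c_\mu,k_\mu>0$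 with $c_\mu\le\mu'(z)\le k_\mu$ for all $z\in[-S,S]$. (Self-concordance, a standing property of the link in this setting) $|\mu''(z)|\le R\,\mu'(z)$ for all $z\in\mathbb R$. Maxima over $\mathcal X_t$ below are taken to be attained. Dynamic regret. $\mathrm{Reg}_T:=\sum_{t=1}^T\left(\mu((x_t^\star)^\top\theta_t^\star)-\mu(x_t^\top\theta_t^\star)\right)$ with $x_t^\star\in\arg\max_{x\in\mathcal X_t}\mu(x^\top\theta_t^\star)$. Algorithm DOMD-GLB (discount $\gamma\in(0,1)$, regularization $\lambda>0$, confidence $\delta$). Loss: $\ell_t(\theta):=\frac{m(x_t^\top\theta)-r_tx_t^\top\theta}{g(\tau)}$. Start from $\theta_1\in\Theta$, $H_1=\lambda I_d$. For $t=1,\dots,T$: set $A_t:=\gamma H_t+(1-\gamma)\lambda I_d$; play $$x_t\in\arg\max_{x\in\mathcal X_t}\left\{x^\top\theta_t+\beta_t(\delta)\|x\|_{H_t^{-1}}\right\}$$ and observe $r_t$; update $$\theta_{t+1}\in\arg\min_{\theta\in\Theta}\left\{\widetilde\ell_t(\theta)+\frac1{2\eta}\|\theta-\theta_t\|_{A_t}^2\right\},\quad \widetilde\ell_t(\theta):=\ell_t(\theta_t)+\langle\nabla\ell_t(\theta_t),\theta-\theta_t\rangle+\tfrac12\|\theta-\theta_t\|^2_{\nabla^2\ell_t(\theta_t)};$$ set $H_{t+1}:=A_t+\nabla^2\ell_t(\theta_{t+1})$. Here $\beta_t(\delta)\ge 0$ is given by $$\beta_t^2(\delta):=4\lambda S^2+2\eta\left(1+\frac{R^2}{g(\tau)k_\mu}\right)\log\left(\frac{\pi^2t^2}{3\delta}\right)+2\eta\left(3\eta+\frac12\right)d\log\left(1+\frac{k_\mu(1-\gamma^{t-1})}{\lambda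 d\,g(\tau)(1-\gamma)}\right).$$ Convention for $\widetilde{\mathcal O}$: $X=\widetilde{\mathcal O}(Y)$ means $X\le C\cdot L\cdot Y$, where $C$ depends only on $R,S,g(\tau),k_\mu$ (not on $d,T,\gamma,\delta,c_\mu$ or the environment) and $L$ is a fixed polynomial in $\log(eT)$, $\log(e/\delta)$, $\log(e/(1-\gamma))$. *)

(* Defs.v *)
(* Mathematical Components + MathComp-Analysis. *)
From HB Require Import structures.
From mathcomp Require Import all_boot all_order all_algebra.
From mathcomp Require Import all_classical all_reals all_analysis.
From mathcomp Require mpoly.

Set Implicit Arguments.
Unset Strict Implicit.
Unset Printing Implicit Defensive.

Import Order.TTheory GRing.Theory Num.Theory.
Import numFieldNormedType.Exports.
Local Open Scope classical_set_scope.
Local Open Scope ring_scope.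

(* Rounds are numbered from 1: a sequence [u : nat -> _] is only used at
   indices [t >= 1], and index 0 is junk. *)

Definition dotv (K : realType) (d : nat) (x y : 'cV[K]_d) : K :=
  (x^T *m y) 0 0.

(* The canonical norm on matrices is the sup norm, hence this definition. *)
Definition l2norm (K : realType) (d : nat) (x : 'cV[K]_d) : K :=
  Num.sqrt (\sum_(i < d) x i 0 ^+ 2).

Definition mxnorm (K : realType) (d : nat) (M : 'M[K]_d) (x : 'cV[K]_d) : K :=
  Num.sqrt ((x^T *m M *m x) 0 0).

Definition l2ball (K : realType) (d : nat) (S : K) : set 'cV[K]_d :=
  [set th | l2norm th <= S].

Definition argmax (K : realType) (E : Type) (A : set E) (f : E -> K) : set E :=
  [set x | A x /\ forall y, A y -> f y <= f x].

Definition argmin (K : realType) (E : Type) (A : set E) (f : E -> K) : set E :=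
  [set x | A x /\ forall y, A y -> f x <= f y].

Definition gradient (K : realType) (d : nat) (f : 'cV[K]_d -> K)
    (th : 'cV[K]_d) : 'cV[K]_d :=
  \col_(i < d) derive f th (delta_mx i 0).

Definition hessian (K : realType) (d : nat) (f : 'cV[K]_d -> K)
    (th : 'cV[K]_d) : 'M[K]_d :=
  \matrix_(i < d, j < d)
    derive (fun u => derive f u (delta_mx j 0)) th (delta_mx i 0).

(* The dispersion [tau] is fixed throughout: [g] stands for the number
   g(tau) and [h] for the function h(., tau). *)
Definition glm_density (K : realType) (m h : K -> K) (g z y : K) : K :=
  expR ((y * z - m z) / g + h y).

Definition link (K : realType) (m : K -> K) : K -> K := derive1 m.

Record glm_model (K : realType) (R S g cmu kmu : K) (m h : K -> K)
    (nu : {measure set (measurableTypeR K) -> \bar K}) : Prop := GlmModel {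
  glm_convex : convex_function [set: K^o] m;
  glm_derivable : forall (k : nat) (z : K),
    (k < 3)%N -> derivable (derive1n k m) z 1;
  glm_continuous : continuous (derive1n 3 m);
  glm_density_measurable : forall z : K,
    measurable_fun setT (glm_density m h g z);
  glm_density_total : forall z : K,
    (\int[nu]_y (glm_density m h g z y)%:E)%E = 1%E;
  glm_bounded_link : forall z : K, - S <= z <= S ->
    cmu <= derive1 (link m) z <= kmu;
  glm_self_concordant : forall z : K,
    `|derive1n 2 (link m) z| <= R * derive1 (link m) z }.

(* sigma(x_1, r_1, ..., x_(t-1), r_(t-1), x_t) joined with
   sigma(theta*_s : s >= 1).  A random vector is handled through its
   coordinates, which generate the same sigma-algebra. *)
Definition history (K : realType) (d : nat) (disp : measure_display)
    (Omega : measurableType disp) (x thstar : nat -> Omega -> 'cV[K]_d)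
    (r : nat -> Omega -> K) (t : nat) : set (set Omega) :=
  <<s \bigcup_(s in [set s | (1 <= s <= t)%N]) \bigcup_(i in [set: 'I_d])
        preimage_set_system setT (fun w => x s w i 0) measurable
      `|` \bigcup_(s in [set s | (1 <= s < t)%N])
        preimage_set_system setT (r s) measurable
      `|` \bigcup_(s in [set s | (1 <= s)%N]) \bigcup_(i in [set: 'I_d])
        preimage_set_system setT (fun w => thstar s w i 0) measurable >>.

(* The interaction over rounds 1, ..., T.  The action sets may be random and
   need not be measurable in any sense.  [thstar] may be random as well;
   exogeneity is expressed by [bandit_law], where the whole sequence [thstar]
   belongs to the conditioning sigma-algebra.  [bandit_law] says that a regular
   conditional distribution of r_t given [history t] is the law of density
   p(. | x_t^T theta*_t) with respect to [nu]. *)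
Record glm_bandit (K : realType) (d : nat) (R S g : K) (m h : K -> K)
    (nu : {measure set (measurableTypeR K) -> \bar K}) (T : nat)
    (disp : measure_display) (Omega : measurableType disp)
    (P : probability Omega K) (thstar : nat -> Omega -> 'cV[K]_d)
    (X : nat -> Omega -> set 'cV[K]_d) (x : nat -> Omega -> 'cV[K]_d)
    (r : nat -> Omega -> K) : Prop := GlmBandit {
  bandit_thstar_measurable : forall t (i : 'I_d), (1 <= t)%N ->
    measurable_fun setT (fun w => thstar t w i 0);
  bandit_x_measurable : forall t (i : 'I_d), (1 <= t <= T)%N ->
    measurable_fun setT (fun w => x t w i 0);
  bandit_r_measurable : forall t, (1 <= t <= T)%N -> measurable_fun setT (r t);
  bandit_thstar_bounded : forall t w, (1 <= t)%N -> l2ball S (thstar t w);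
  bandit_X_bounded : forall t w, (1 <= t <= T)%N -> X t w `<=` l2ball 1;
  bandit_x_in : forall t w, (1 <= t <= T)%N -> X t w (x t w);
  bandit_r_bounded : forall t, (1 <= t <= T)%N ->
    {ae P, forall w, 0 <= r t w <= R};
  bandit_law : forall t (A : set Omega) (B : set (measurableTypeR K)),
    (1 <= t <= T)%N -> history x thstar r t A -> measurable B ->
    P (A `&` r t @^-1` B) =
      (\int[P]_(w in A) \int[nu]_(y in B)
         (glm_density m h g (dotv (x t w) (thstar t w)) y)%:E)%E }.

Definition glb_loss (K : realType) (d : nat) (m : K -> K) (g : K)
    (x : 'cV[K]_d) (r : K) (th : 'cV[K]_d) : K :=
  (m (dotv x th) - r * dotv x th) / g.

Definition quad_approx (K : realType) (d : nat) (f : 'cV[K]_d -> K)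
    (th0 th : 'cV[K]_d) : K :=
  f th0 + dotv (gradient f th0) (th - th0)
    + 2^-1 * mxnorm (hessian f th0) (th - th0) ^+ 2.

Definition beta (K : realType) (d : nat) (R S g kmu gamma lambda delta eta : K)
    (t : nat) : K :=
  Num.sqrt (4 * lambda * S ^+ 2
    + 2 * eta * (1 + R ^+ 2 / (g * kmu))
        * ln (pi ^+ 2 * t%:R ^+ 2 / (3 * delta))
    + 2 * eta * (3 * eta + 2^-1) * d%:R
        * ln (1 + kmu * (1 - gamma ^+ t.-1)
                  / (lambda * d%:R * g * (1 - gamma)))).

(* One trajectory of DOMD-GLB: [X], [x], [r] are the action sets, actions and
   rewards of that trajectory, [th] and [H] the iterates. *)
Record domd_glb (K : realType) (d : nat) (m : K -> K)
    (R S g kmu gamma lambda delta eta : K) (T : nat) (th1 : 'cV[K]_d)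
    (X : nat -> set 'cV[K]_d) (x : nat -> 'cV[K]_d) (r : nat -> K)
    (th : nat -> 'cV[K]_d) (H : nat -> 'M[K]_d) : Prop := DomdGlb {
  domd_th_init : th 1%N = th1;
  domd_H_init : H 1%N = lambda%:M;
  domd_play : forall t, (1 <= t <= T)%N ->
    argmax (X t)
      (fun y => dotv y (th t)
         + beta d R S g kmu gamma lambda delta eta t
             * mxnorm (invmx (H t)) y)
      (x t);
  domd_th_update : forall t, (1 <= t <= T)%N ->
    argmin (l2ball S)
      (fun u => quad_approx (glb_loss m g (x t) (r t)) (th t) u
         + (2 * eta)^-1
           * mxnorm (gamma *: H t + ((1 - gamma) * lambda)%:M) (u - th t) ^+ 2)
      (th t.+1);
  domd_H_update : forall t, (1 <= t <= T)%N ->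
    H t.+1 = gamma *: H t + ((1 - gamma) * lambda)%:M
      + hessian (glb_loss m g (x t) (r t)) (th t.+1) }.

Definition dyn_regret (K : realType) (d : nat) (m : K -> K) (T : nat)
    (thstar xstar x : nat -> 'cV[K]_d) : K :=
  \sum_(1 <= t < T.+1) (link m (dotv (xstar t) (thstar t))
                        - link m (dotv (x t) (thstar t))).

Definition path_length (K : realType) (d : nat) (T : nat)
    (thstar : nat -> 'cV[K]_d) : K :=
  \sum_(1 <= t < T) l2norm (thstar t.+1 - thstar t).

Definition lambda_glb (K : realType) (d : nat) (R S g cmu kmu eta alpha : K) :
    K :=
  Num.max (6 * eta * R * kmu * S / g)
    (Num.max (32 * alpha * d%:R * R ^+ 2 / 7) (cmu / g)).

Definition gamma_opt (K : realType) (d T : nat) (kmu PT : K) : K :=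
  1 - Num.min (1 - T%:R^-1)
        (Num.max T%:R^-1 (Num.sqrt (Num.sqrt kmu * PT / (d%:R * T%:R)))).

(* [a] is at most [C * L * b], with [L] a polynomial in
   log(eT), log(e/delta), log(e/(1-gamma)). *)
Definition soft_le (K : realType) (L : mpoly.mpoly 3 K) (C : K) (T : nat)
    (delta gamma a b : K) : Prop :=
  a <= C * mpoly.meval
             (tnth [tuple ln (expR 1 * T%:R); ln (expR 1 / delta);
                          ln (expR 1 / (1 - gamma))]) L * b.

(* [Q] holds with probability at least [p]; no measurability of [Q] is
   presupposed (maxima over arbitrary action sets need not be measurable). *)
Definition with_prob_ge (K : realType) (disp : measure_display)
    (Omega : measurableType disp) (P : probability Omega K) (p : K)
    (Q : Omega -> Prop) : Prop :=
  exists2 E : set Omega, measurable E /\ (p%:E <= P E)%E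
                       & forall w, E w -> Q w.

(* Main.v *)
Require Import Defs.
From HB Require Import structures.
From mathcomp Require Import all_boot all_order all_algebra.
From mathcomp Require Import all_classical all_reals all_analysis.
From mathcomp Require Import finmap measurable_realfun.
From mathcomp Require mpoly.
From mathcomp Require Import ring lra.

Set Implicit Arguments.
Unset Strict Implicit.
Unset Printing Implicit Defensive.

Import Order.TTheory GRing.Theory Num.Theory.
Import numFieldNormedType.Exports.
Local Open Scope classical_set_scope.
Local Open Scope ring_scope.

(** For every target round t, the rewards are tested by a product over s < t of
    convex combinations, with weights gamma^(t-1-s), of 1 and of two likelihood
    ratios: a Gaussian mixture centred at the current prediction x_s.theta_s, and a
    single alternative shifted against the drift theta*_t - theta*_s.  Each factor is
    adapted to the history, so each product has mean at most 1, and Markov's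
    inequality bounds all of them simultaneously.  By convexity of exp, the bounds
    control the discounted sum of the losses of theta*_s relative to those of the
    next iterate; the mixture contributes the squared step of mirror descent, which
    the update pays for, and a logarithmic term 3 eta ln(1 + u_s) in the leverage
    u_s of round s; the shifted alternative turns the drift into a second-order
    error.  Hence theta*_t lies in the ellipsoid of radius beta_t enlarged by a bias
    governed by the discounted path length.  Concavity of ln det bounds the
    discounted leverage terms and, telescoped, the whole sum of squared exploration
    bonuses; optimism and Cauchy-Schwarz conclude.  When the path is so long that
    the tuned discount factor hits its lower limit, the trivial bound suffices. *)

(** The discount weights and the comparator [theta*_t] both change with the target round t, so no
    single supermartingale serves all rounds; each t has its own product, with a failure probability
    of order [1 / t^2]. Using the future parameter [theta*_t], or a discount factor tuned to the
    path length, is legitimate because the whole parameter sequence lies in the conditioning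
    sigma-algebra. The parameters of the algorithm fit the argument. With [eta = 1 + R * S],
    [2 * eta] Bregman divergences of the loss dominate the curvature added to [H]. With
    [alpha = 3 * eta / 2], the cost of recentring the mixture is covered by two thirds of the
    squared step. The three terms of [lambda] absorb the error of the quadratic surrogate, keep the
    mixture narrow on the scale [1 / R] of self-concordance, and turn [1 / sqrt lambda] into
    [sqrt (g / cmu)]. The last is needed because the bias due to drift is absent from the bonus and
    can only be charged at the rate [1 / sqrt lambda]. The iterates are known only as minimizers
    along each trajectory, so their measurability must be proved before any mean is taken. *)

Section Calculus.
Context {K : realType}.
Implicit Types (f g : K -> K) (x : K).

Lemma der_eq f x (d1 d2 : K) : is_derive x 1 f d1 -> d1 = d2 ->
  is_derive x 1 f d2.
Proof. by move=> + <-. Qed.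

Lemma derD f g x df dg : is_derive x 1 f df -> is_derive x 1 g dg ->
  is_derive x 1 (fun t : K => f t + g t) (df + dg).
Proof. exact: is_deriveD. Qed.

Lemma derB f g x df dg : is_derive x 1 f df -> is_derive x 1 g dg ->
  is_derive x 1 (fun t : K => f t - g t) (df - dg).
Proof. exact: is_deriveB. Qed.

Lemma derM f g x df dg : is_derive x 1 f df -> is_derive x 1 g dg ->
  is_derive x 1 (fun t : K => f t * g t) (f x * dg + g x * df).
Proof. exact: is_deriveM. Qed.

Lemma derC x (a : K) : is_derive x 1 (fun=> a : K) 0.
Proof. exact: is_derive_cst. Qed.

Lemma derX x : is_derive x 1 (fun t : K => t) 1.
Proof. exact: is_derive_id. Qed.

Lemma der_comp f g x df dg : is_derive (g x) 1 f df -> is_derive x 1 g dg ->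
  is_derive x 1 (fun t : K => f (g t)) (dg * df).
Proof. by move=> hf hg; rewrite mulrC; exact: (is_derive1_comp hf hg). Qed.

Lemma der_line f (df : K -> K) (a D x : K) : (forall z : K, is_derive z 1 f (df z)) ->
  is_derive x 1 (fun t : K => f (a + t * D)) (D * df (a + x * D)).
Proof.
move=> hf; apply: der_comp => //.
apply: der_eq (derD (derC x a) (derM (derX x) (derC x D))) _.
by ring.
Qed.

Lemma der_expM (c x : K) :
  is_derive x 1 (fun t : K => expR (c * t)) (c * expR (c * x)).
Proof.
have dl : is_derive x 1 (fun t : K => c * t) c.
  by apply: der_eq (derM (derC x c) (derX x)) _; ring.
exact: (der_comp (is_derive_expR (c * x)) dl).
Qed.

Lemma is_derive_ge0 f (df : K -> K) (D : K) : (forall z : K, is_derive z 1 f (df z)) ->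
  f 0 = 0 -> 0 <= D -> (forall z, 0 <= z <= D -> 0 <= df z) -> 0 <= f D.
Proof.
move=> dff f0 D0 df0.
have cf : {within `[0, D], continuous f}.
  apply: continuous_subspaceT => z.
  by apply: differentiable_continuous; apply/derivable1_diffP; case: (dff z).
have [c] := MVT_segment D0 (fun z _ => dff z) cf.
rewrite f0 !subr0 in_itv/= => cD ->.
by rewrite mulr_ge0// df0.
Qed.

(** The minorant [h2] of the second derivative along the segment is left free because
    self-concordance supplies an exponential one rather than a constant. The mean value theorem is
    applied twice to integrate it. *)
Lemma taylor2_ge (f f1 f2 h h1 h2 : K -> K) (a D : K) :
  (forall z : K, is_derive z 1 f (f1 z)) -> (forall z : K, is_derive z 1 f1 (f2 z)) ->
  (forall z : K, is_derive z 1 h (h1 z)) -> (forall z : K, is_derive z 1 h1 (h2 z)) ->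
  h 0 = 0 -> h1 0 = 0 ->
  (forall t, 0 <= t <= 1 -> h2 t <= f2 (a + t * D) * D ^+ 2) ->
  h 1 <= f (a + D) - f a - f1 a * D.
Proof.
move=> df df1 dh dh1 h0 h10 H.
rewrite -subr_ge0.
pose G t := (f (a + t * D) - f a) - (f1 a * D) * t - h t.
pose G1 t := D * f1 (a + t * D) - f1 a * D - h1 t.
have -> : f (a + D) - f a - f1 a * D - h 1 = G 1 by rewrite /G mul1r mulr1.
have dG (z : K) : is_derive z 1 G (G1 z).
  apply: der_eq ((derB (derB (derB (der_line a D z df) (derC z (f a)))
      (derM (derC z (f1 a * D)) (derX z))) (dh z))) _.
  by rewrite /G1; ring.
have dG1 (z : K) : is_derive z 1 G1 (D * (D * f2 (a + z * D)) - h2 z).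
  apply: der_eq ((derB (derB (derM (derC z D) (der_line a D z df1))
      (derC z (f1 a * D))) (dh1 z))) _.
  by ring.
apply: (is_derive_ge0 dG) => //.
  by rewrite /G mul0r addr0 h0; ring.
move=> z /andP[z0 z1]; apply: (is_derive_ge0 dG1) => //.
  by rewrite /G1 mul0r addr0 h10; ring.
move=> t /andP[t0 tz]; have := H t; rewrite t0 (le_trans tz)//= => /(_ isT).
by move=> le2; rewrite subr_ge0 (le_trans le2)// mulrA -expr2 mulrC.
Qed.

Lemma taylor2_itv (f f1 f2 : K -> K) (a D lo hi : K) :
  (forall z : K, is_derive z 1 f (f1 z)) -> (forall z : K, is_derive z 1 f1 (f2 z)) ->
  (forall t, 0 <= t <= 1 -> lo <= f2 (a + t * D) <= hi) ->
  lo * D ^+ 2 / 2 <= f (a + D) - f a - f1 a * D <= hi * D ^+ 2 / 2.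
Proof.
move=> df df1 H.
have dq (c z : K) : is_derive z 1 (fun t : K => c / 2 * (t * t)) (c * z).
  apply: der_eq ((derM (derC z (c / 2)) (derM (derX z) (derX z)))) _.
  by field.
have dl (c z : K) : is_derive z 1 (fun t : K => c * t) c.
  by apply: der_eq ((derM (derC z c) (derX z))) _; ring.
apply/andP; split.
  have := @taylor2_ge f f1 f2 (fun t : K => lo * D ^+ 2 / 2 * (t * t))
    (fun t : K => lo * D ^+ 2 * t) (fun=> lo * D ^+ 2) a D df df1 (dq _) (dl _).
  rewrite !mulr0 !mulr1; apply => // t /H /andP[lof _].
  by rewrite ler_wpM2r// sqr_ge0.
have dN (g g1 : K -> K) : (forall z : K, is_derive z 1 g (g1 z)) ->
    forall z : K, is_derive z 1 (fun t : K => 0 - g t) (0 - g1 z).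
  by move=> dg z; exact: derB (derC z 0) (dg z).
have := @taylor2_ge (fun t : K => 0 - f t) (fun t : K => 0 - f1 t) (fun t : K => 0 - f2 t)
    (fun t : K => (- hi * D ^+ 2) / 2 * (t * t))
    (fun t : K => - hi * D ^+ 2 * t) (fun=> - hi * D ^+ 2) a D
    (dN _ _ df) (dN _ _ df1) (dq _) (dl _).
rewrite !mulr0 !mulr1 => /(_ erefl erefl) hi_le.
have {}hi_le : - hi * D ^+ 2 / 2 <= 0 - f (a + D) - (0 - f a) - (0 - f1 a) * D.
  apply: hi_le => t /H /andP[_ fhi].
  by rewrite ler_wpM2r ?sqr_ge0// sub0r lerN2.
lra.
Qed.

Lemma ge_derive_mono f (df : K -> K) (u v : K) : (forall z : K, is_derive z 1 f (df z)) ->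
  (forall z, 0 <= df z) -> u <= v -> f u <= f v.
Proof.
move=> dff df0 uv; rewrite -subr_ge0.
have dg (z : K) : is_derive z 1 (fun t : K => f (u + t * 1) - f u) (1 * df (u + z * 1)).
  apply: der_eq (derB (der_line u 1 z dff) (derC z (f u))) _.
  by rewrite subr0.
have := @is_derive_ge0 _ _ (v - u) dg.
rewrite (_ : u + (v - u) * 1 = v); last by ring.
apply.
- by rewrite mul0r addr0 subrr.
- by rewrite subr_ge0.
- by move=> z _; rewrite mul1r df0.
Qed.

(** A Gronwall argument: [f t * expR (R * t)] is nondecreasing and [f t * expR (- R * t)]
    nonincreasing. The two signs of [D] exchange the roles of these facts. *)
Lemma self_concordant_bounds (f f1 : K -> K) (R a D : K) :
  (forall z : K, is_derive z 1 f (f1 z)) -> (forall z, `|f1 z| <= R * f z) ->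
  f a * expR (- (R * `|D|)) <= f (a + D) <= f a * expR (R * `|D|).
Proof.
move=> df hf.
have dP (c z : K) : is_derive z 1 (fun t : K => f t * expR (c * t))
    ((f1 z + c * f z) * expR (c * z) : K).
  by apply: der_eq (derM (df z) (der_expM c z)) _; ring.
have mono u v : u <= v -> f u * expR (R * u) <= f v * expR (R * v).
  apply: ge_derive_mono (dP R) _ => z; rewrite mulr_ge0 ?expR_ge0//.
  have := hf z; rewrite ler_norml => /andP[].
  by clear; move: (f1 z) (R * f z) => p q ? ?; lra.
have dQ (z : K) : is_derive z 1 (fun t : K => 0 - f t * expR (- R * t))
    (0 - (f1 z + (- R) * f z) * expR (- R * z) : K).
  exact: derB (derC z 0) (dP (- R) z).
have anti u v : u <= v -> f v * expR (- R * v) <= f u * expR (- R * u).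
  move=> uv; have := ge_derive_mono dQ _ uv.
  rewrite !sub0r lerN2; apply => z.
  rewrite sub0r -mulNr mulr_ge0 ?expR_ge0//.
  have := hf z; rewrite ler_norml => /andP[]; rewrite mulNr.
  by clear; move: (f1 z) (R * f z) => p q ? ?; lra.
have E (u v : K) : f u * expR (R * u) <= f v * expR (R * v) ->
    f u * expR (R * (u - v)) <= f v.
  move=> h; rewrite -(ler_pM2r (expR_gt0 (R * v))) -mulrA -expRD.
  by rewrite mulrBr subrK.
have E' (u v : K) : f v * expR (- R * v) <= f u * expR (- R * u) ->
    f v <= f u * expR (R * (v - u)).
  move=> h; rewrite -(ler_pM2r (expR_gt0 (- R * v))) -mulrA -expRD.
  by have -> : R * (v - u) + - R * v = - R * u by ring.
have [D0|D0] := leP 0 D.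
  have aD : a <= a + D by rewrite lerDl.
  rewrite ger0_norm// -mulrN; apply/andP; split.
    by have := E _ _ (mono _ _ aD); rewrite opprD addrA subrr sub0r.
  by have := E' _ _ (anti _ _ aD); rewrite (addrC a) addrK.
have aD : a + D <= a by rewrite gerDl ltW.
have cancel_exp (u v w : K) : u <= v * expR w -> u * expR (- w) <= v.
  by move=> uv; rewrite expRN ler_pdivrMr ?expR_gt0.
rewrite ltr0_norm// mulrN opprK; apply/andP; split.
  have := E' _ _ (anti _ _ aD); rewrite opprD addrA subrr sub0r mulrN => h.
  by have := cancel_exp _ _ _ h; rewrite opprK.
have := E _ _ (mono _ _ aD); rewrite (addrC a) addrK expRN.
by rewrite -ler_pdivlMr ?expR_gt0// .
Qed.

(** Integrating [expR (- x * t)] twice over the unit interval gives [(expR (- x) - 1 + x) / x ^+ 2],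
    and the claim bounds this below by [1 / (x + 2)]. For [x <= 2 * R * S] this is the origin of the
    constant [1 + R * S]. *)
Lemma expRN_quad_ge (x : K) : 0 <= x -> x ^+ 2 <= (x + 2) * (expR (- x) - 1 + x).
Proof.
move=> x0.
have dk (z : K) : is_derive z 1 (fun t : K => (t + 2) * expR (-1 * t) - 2 + t)
    (1 - (1 + z) * expR (-1 * z)).
  apply: der_eq ((derD (derB (derM (derD (derX z) (derC z 2)) (der_expM (-1) z)) (derC z 2)) (derX z))) _.
  by ring.
have -> : (x + 2) * (expR (- x) - 1 + x) = (x + 2) * expR (-1 * x) - 2 + x + x ^+ 2.
  by rewrite mulN1r; ring.
rewrite lerDr; apply: (is_derive_ge0 dk) => //.
  by rewrite mulr0 expR0; ring.
move=> z _; rewrite subr_ge0 mulN1r expRN ler_pdivrMr ?expR_gt0// mul1r.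
exact: expR_ge1Dx.
Qed.

End Calculus.

(** * Self-concordant links *)

Section SelfConcordance.
Context {K : realType} (m m1 m2 m3 : K -> K) (R : K).
Hypothesis (R0 : 0 < R).
Hypothesis (dm : forall z : K, is_derive z 1 m (m1 z)).
Hypothesis (dm1 : forall z : K, is_derive z 1 m1 (m2 z)).
Hypothesis (dm2 : forall z : K, is_derive z 1 m2 (m3 z)).
Hypothesis (sc : forall z, `|m3 z| <= R * m2 z).

Lemma sc_ge0 z : 0 <= m2 z.
Proof. by rewrite -(pmulr_rge0 _ R0) (le_trans _ (sc z)). Qed.

Lemma bregman_le b D :
  m (b + D) - m b - m1 b * D <= m2 b / 2 * (D ^+ 2 * expR (R * `|D|)).
Proof.
have /andP[_] : 0 * D ^+ 2 / 2 <= m (b + D) - m b - m1 b * D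
    <= (m2 b * expR (R * `|D|)) * D ^+ 2 / 2.
  apply: taylor2_itv dm dm1 _ => t /andP[t0 t1]; rewrite sc_ge0/=.
  have /andP[_ le1] := self_concordant_bounds b (t * D) dm2 sc.
  apply: le_trans le1 _; rewrite ler_wpM2l ?sc_ge0// ler_expR.
  rewrite ler_wpM2l ?(ltW R0)// normrM ger0_norm// ler_piMl//.
move=> /le_trans; apply.
by rewrite le_eqVlt; apply/orP; left; apply/eqP; ring.
Qed.

(** The curvature is taken at the base point [b] itself and the loss is linear, not exponential, in
    [R * S]. The same [m2 b] is the weight of the rank-one update of [H], so the two can cancel. *)
Lemma bregman_ge (S b D : K) : 0 <= S -> `|D| <= 2 * S ->
  m2 b * D ^+ 2 / (2 * (1 + R * S)) <= m (b + D) - m b - m1 b * D.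
Proof.
move=> S0 DS; pose x := R * `|D|.
have x0 : 0 <= x by rewrite mulr_ge0// ltW.
pose h (t : K) : K := m2 b / R ^+ 2 * (expR (- x * t) - 1 + x * t).
pose h1 (t : K) : K := m2 b / R ^+ 2 * (- x * expR (- x * t) + x).
pose h2 (t : K) : K := m2 b / R ^+ 2 * (x ^+ 2 * expR (- x * t)).
have dl (z : K) : is_derive z 1 (fun t : K => x * t) x.
  by apply: der_eq (derM (derC z x) (derX z)) _; ring.
have dh (z : K) : is_derive z 1 h (h1 z).
  apply: der_eq (derM (derC z (m2 b / R ^+ 2))
    (derD (derB (der_expM (- x) z) (derC z 1)) (dl z))) _.
  by rewrite /h1; ring.
have dh1 (z : K) : is_derive z 1 h1 (h2 z).
  apply: der_eq (derM (derC z (m2 b / R ^+ 2))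
    (derD (derM (derC z (- x)) (der_expM (- x) z)) (derC z x))) _.
  by rewrite /h2; ring.
have h1le : h 1 <= m (b + D) - m b - m1 b * D.
  apply: (taylor2_ge dm dm1 dh dh1).
  - by rewrite /h mulr0 expR0; ring.
  - by rewrite /h1 mulr0 expR0; ring.
  - move=> t /andP[t0 t1].
    have /andP[le1 _] := self_concordant_bounds b (t * D) dm2 sc.
    rewrite (_ : h2 t = m2 b * expR (- x * t) * D ^+ 2).
      rewrite ler_wpM2r ?sqr_ge0//; apply: le_trans le1.
      rewrite ler_wpM2l ?sc_ge0// ler_expR normrM (ger0_norm t0) /x.
      by rewrite le_eqVlt; apply/orP; left; apply/eqP; ring.
    rewrite /h2 /x exprMn real_normK ?num_real//; field.
    by rewrite gt_eqF.
apply: le_trans h1le; rewrite /h !mulr1.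
have := expRN_quad_ge x0; set e := expR (- x) - 1 + x => xe.
have e0 : 0 <= e by rewrite /e; have := expR_ge1Dx (- x); lra.
have RS0 : 0 < 2 * (1 + R * S) by have := mulr_ge0 (ltW R0) S0; lra.
rewrite ler_pdivrMr//.
have Dx : D ^+ 2 = x ^+ 2 / R ^+ 2.
  rewrite /x exprMn real_normK ?num_real//; field.
  by rewrite gt_eqF.
have -> : m2 b / R ^+ 2 * e * (2 * (1 + R * S)) =
    m2 b / R ^+ 2 * (2 * (1 + R * S) * e) by ring.
have -> : m2 b * D ^+ 2 = m2 b / R ^+ 2 * x ^+ 2 by rewrite Dx; ring.
apply: ler_wpM2l; first by rewrite divr_ge0 ?sc_ge0// sqr_ge0.
apply: le_trans xe _; apply: ler_wpM2r => //.
have : x <= R * (2 * S) by rewrite /x ler_wpM2l// ltW.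
lra.
Qed.

Lemma link_taylor_le (S k a b : K) : (forall z, - S <= z <= S -> m2 z <= k) ->
  - S <= a <= S -> - S <= b <= S ->
  `|m1 b - m1 a - m2 a * (b - a)| <= R * k * (b - a) ^+ 2 / 2.
Proof.
move=> hk aS bS.
have /andP[lo hi] : - (R * k) * (b - a) ^+ 2 / 2 <=
    m1 (a + (b - a)) - m1 a - m2 a * (b - a) <= (R * k) * (b - a) ^+ 2 / 2.
  apply: taylor2_itv dm1 dm2 _ => t /andP[t0 t1].
  rewrite -ler_norml; apply: le_trans (sc _) _; rewrite ler_wpM2l ?(ltW R0)//.
  apply: hk; move: aS bS => /andP[? ?] /andP[? ?].
  have -> : a + t * (b - a) = (1 - t) * a + t * b by ring.
  have t1' : 0 <= 1 - t by rewrite subr_ge0.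
  apply/andP; split.
    rewrite (_ : - S = (1 - t) * (- S) + t * (- S)); last by ring.
    by rewrite lerD// ler_wpM2l.
  rewrite [leRHS](_ : S = (1 - t) * S + t * S); last by ring.
  by rewrite lerD// ler_wpM2l.
move: lo hi; rewrite (_ : a + (b - a) = b); last by ring.
by move=> lo hi; rewrite ler_norml hi andbT (le_trans _ lo)// !mulNr.
Qed.

End SelfConcordance.

(** * Gaussian mixtures of likelihoods *)

Section GaussianMixture.
Context {K : realType}.
Local Notation leb := (@lebesgue_measure K).

(** Indexed by the inverse standard deviation and left unnormalized: comparing such weights only
    compares quadratic coefficients, and integrals are proportional to [1 / t]. *)
Let gauss (t y : K) : K := expR (- (t * y) ^+ 2 / 2).

Lemma measurable_gauss t : measurable_fun setT (gauss t).
Proof.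
apply: measurableT_comp => //; apply: measurable_funM => //.
by apply: measurableT_comp => //; apply: measurable_funX => //.
Qed.

Lemma integral_gauss (t : K) : 0 < t ->
  (\int[leb]_y (gauss t y)%:E = (Num.sqrt (2 * pi) / t)%:E)%E.
Proof.
move=> t0; have ti0 : t^-1 != 0 by rewrite invr_eq0 gt_eqF.
have := @integral_normal_pdf K 0 t^-1.
rewrite normal_pdfE// /normal_peak /normal_fun.
have c0 : 0 < Num.sqrt (2 * pi) / t :> K.
  by rewrite divr_gt0// sqrtr_gt0 mulr_gt0// pi_gt0.
have -> : (Num.sqrt (t^-1 ^+ 2 * pi *+ 2))^-1 = (Num.sqrt (2 * pi) / t)^-1 :> K.
  congr (_^-1); rewrite -mulr_natr -mulrA (mulrC pi) sqrtrM ?sqr_ge0//.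
  by rewrite sqrtr_sqr ger0_norm ?invr_ge0 ?(ltW t0)// (mulrC t^-1).
set c := Num.sqrt (2 * pi) / t in c0 *.
under eq_integral do rewrite EFinM.
rewrite ge0_integralZl//=; last 2 first.
- by apply/measurable_EFinP; exact: (measurable_normal_fun 0 t^-1).
- by rewrite lee_fin invr_ge0 ltW.
move=> h; rewrite -[LHS]mul1e -(@divff _ c) ?gt_eqF// EFinM -muleA.
rewrite (_ : \int[leb]_y (gauss t y)%:E =
    \int[leb]_x (expR (- (x - 0) ^+ 2 / (t^-1 ^+ 2 *+ 2)))%:E)%E; last first.
  apply: eq_integral => y _; congr ((expR _)%:E).
  by rewrite subr0 exprMn; field; rewrite gt_eqF.
by rewrite h mule1.
Qed.

Lemma integral_shift (f : K -> K) (e : K) : continuous f ->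
  (forall x, 0 <= f x) ->
  (\int[leb]_x (f x)%:E = \int[leb]_x (f (x + e))%:E)%E.
Proof.
move=> cf f0.
have dF : derive1 (fun x : K => x + e) = cst 1.
  apply/funext => x; rewrite derive1E.
  by have [_ ->] := derD (derX x) (derC x e); rewrite addr0.
rewrite (@increasing_ge0_integration_by_substitutionT _ (fun x => x + e) f)//.
- by apply: eq_integral => x _; rewrite dF /= fctE mulr1.
- by move=> x y xy; rewrite ltrD2r.
- by rewrite dF => x; exact: cvg_cst.
- by rewrite dF; exact: is_cvg_cst.
- by rewrite dF; exact: is_cvg_cst.
- exact: cvg_addrr_Ny.
- exact: cvg_addrr.
Qed.

Lemma integral_reflect (f : K -> K) : measurable_fun setT f ->
  (forall x, 0 <= f x) ->
  (\int[leb]_x (f x)%:E = \int[leb]_x (f (- x))%:E)%E.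
Proof.
move=> mf f0.
have := @ge0_integral_pushforward _ _ _ _ K
  (-%R : measurableTypeR K -> measurableTypeR K) (@oppr_measurable K setT)
  leb setT (EFin \o f) measurableT.
rewrite preimage_setT => <-.
- by apply: eq_measure_integral => A mA _; exact/esym/lebesgue_measureN.
- exact/measurable_EFinP.
- by move=> x _; rewrite lee_fin.
Qed.

(** Jensen's inequality in pointwise form: [expR (- rho)] is minorized by its tangent at [y0], and
    the exponentially growing [rho] is majorized by a difference of two Gaussian weights, so
    everything integrates in closed form. The standard Gaussian is first narrowed to variance
    [1 / V]. The lost mass costs [ln V / 2], but the mean of [rho] becomes of order [W / V], which
    is controlled by [ln V]. *)
Lemma gaussian_mixture_pointwise (s W c y V y0 B a1 a2 E p r : K) :
  0 <= W -> V = 1 + W -> 0 < a1 -> 0 < a2 ->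
  p ^+ 2 = 1 - 2 * a2 -> r ^+ 2 = 1 - 2 * (a1 + a2) ->
  expR (s ^+ 2 / (4 * a2)) <= E -> B = expR y0 * (W / 2 * (E / (a1 * V))) ->
  expR y0 * (1 - y0) * gauss (Num.sqrt V) y + B * gauss (p * Num.sqrt V) y <=
  (expR (- c * y) + expR (c * y)) / 2
     * expR (- (W / 2 * (y ^+ 2 * expR (s * `|y|)))) * expR (- y ^+ 2 / 2)
  + B * gauss (r * Num.sqrt V) y.
Proof.
move=> W0 VE a10 a20 pE rE EE BE.
have V1 : 1 <= V by rewrite VE lerDl.
have V0 : 0 < V by lra.
have a1V : 0 < a1 * V by rewrite mulr_gt0.
have E0 : 0 <= E by apply: le_trans EE; rewrite expR_ge0.
pose rho := W / 2 * (y ^+ 2 * expR (s * `|y|)).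
pose q := V * y ^+ 2.
have yq' : y ^+ 2 <= q by rewrite /q ler_peMl// sqr_ge0.
have gE t : gauss (t * Num.sqrt V) y = expR (- (t ^+ 2 / 2 * q)).
  by rewrite /gauss -mulrA exprMn exprMn sqr_sqrtr ?(ltW V0)// /q; congr expR; field.
have g1 : gauss (Num.sqrt V) y = expR (- (q / 2)).
  by rewrite -[Num.sqrt V]mul1r gE; congr expR; field.
rewrite g1 !gE pE rE.
(* the quadratic weight is absorbed through [a x <= exp(a x) - 1] *)
have y2le : y ^+ 2 <= (a1 * V)^-1 * (expR (a1 * q) - 1).
  rewrite ler_pdivlMl// -mulrA -/q.
  by have := expR_ge1Dx (a1 * q); lra.
have sy : expR (s * `|y|) <= E * expR (a2 * q).
  apply: (@le_trans _ _ (expR (s ^+ 2 / (4 * a2)) * expR (a2 * q))); last first.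
    by rewrite ler_wpM2r ?expR_ge0.
  rewrite -expRD ler_expR.
  have Yq : a2 * `|y| ^+ 2 <= a2 * q.
    by rewrite real_normK ?num_real// ler_wpM2l// ltW.
  apply: (@le_trans _ _ (s ^+ 2 / (4 * a2) + a2 * `|y| ^+ 2)); last by rewrite lerD2l.
  rewrite -subr_ge0 (_ : _ - _ = (s - 2 * a2 * `|y|) ^+ 2 / (4 * a2)).
    by rewrite divr_ge0 ?sqr_ge0// ltW// mulr_gt0.
  by field; rewrite gt_eqF.
have rhole : rho <= W / 2 * (E / (a1 * V)) * (expR ((a1 + a2) * q) - expR (a2 * q)).
  rewrite /rho -[leRHS]mulrA ler_wpM2l ?divr_ge0//.
  have -> : E / (a1 * V) * (expR ((a1 + a2) * q) - expR (a2 * q)) =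
      ((a1 * V)^-1 * (expR (a1 * q) - 1)) * (E * expR (a2 * q)).
    by rewrite mulrDl expRD; ring.
  by apply: ler_pM; rewrite ?sqr_ge0 ?expR_ge0.
have cosh1 : 1 <= (expR (- c * y) + expR (c * y)) / 2.
  by rewrite mulNr; have := expR_ge1Dx (- (c * y)); have := expR_ge1Dx (c * y); lra.
have yq : expR (- (q / 2)) <= expR (- y ^+ 2 / 2).
  by rewrite ler_expR mulNr lerN2 ler_wpM2r.
have low : expR y0 * (1 - y0 - rho) <= expR (- rho).
  have -> : - rho = y0 + (- rho - y0) by ring.
  by rewrite expRD ler_wpM2l ?expR_ge0//; have := expR_ge1Dx (- rho - y0); lra.
have step : expR y0 * (1 - y0 - rho) * expR (- (q / 2)) <=
    (expR (- c * y) + expR (c * y)) / 2 * expR (- rho) * expR (- y ^+ 2 / 2).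
  apply: (@le_trans _ _ (expR (- rho) * expR (- (q / 2)))).
    by rewrite ler_wpM2r ?expR_ge0.
  apply: ler_pM; rewrite ?expR_ge0//.
  by rewrite ler_peMl ?expR_ge0.
rewrite -lerBlDr; apply: le_trans step.
have eq1 : expR (- ((1 - 2 * a2) / 2 * q)) = expR (a2 * q) * expR (- (q / 2)).
  by rewrite -expRD; congr expR; field.
have eq2 : expR (- ((1 - 2 * (a1 + a2)) / 2 * q)) =
    expR ((a1 + a2) * q) * expR (- (q / 2)).
  by rewrite -expRD; congr expR; field.
rewrite eq1 eq2.
set e := expR (- (q / 2)).
rewrite (_ : _ - _ = (expR y0 * (1 - y0) -
  B * (expR ((a1 + a2) * q) - expR (a2 * q))) * e); last by ring.
apply: ler_wpM2r; first exact: expR_ge0.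
rewrite [leRHS]mulrBr lerB// BE -[leRHS]mulrA.
by apply: ler_wpM2l rhole; exact: expR_ge0.
Qed.

Lemma der_continuous (f df : K -> K) :
  (forall z : K, is_derive z 1 f (df z)) -> continuous f.
Proof.
move=> h z; apply: differentiable_continuous; apply/derivable1_diffP.
by case: (h z).
Qed.

Lemma integral_gauss2 (al be t u : K) : 0 <= al -> 0 <= be -> 0 < t -> 0 < u ->
  (\int[leb]_y (al * gauss t y + be * gauss u y)%:E =
   (al * (Num.sqrt (2 * pi) / t) + be * (Num.sqrt (2 * pi) / u))%:E)%E.
Proof.
move=> al0 be0 t0 u0; under eq_integral do rewrite EFinD.
have mg (c v : K) : measurable_fun setT (fun y : measurableTypeR K => (c * gauss v y)%:E).
  apply/measurable_EFinP; apply: measurable_funM => //.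
  exact: measurable_gauss.
have scale (c v : K) : 0 <= c -> 0 < v ->
    (\int[leb]_y (c * gauss v y)%:E = (c * (Num.sqrt (2 * pi) / v))%:E)%E.
  move=> c0 v0; under eq_integral do rewrite EFinM.
  rewrite ge0_integralZl//=; last 2 first.
  - by apply/measurable_EFinP; exact: measurable_gauss.
  - by move=> x _; rewrite lee_fin expR_ge0.
  by rewrite integral_gauss.
rewrite ge0_integralD//; last 2 first.
- by move=> x _; rewrite lee_fin mulr_ge0 ?expR_ge0.
- by move=> x _; rewrite lee_fin mulr_ge0 ?expR_ge0.
by rewrite !scale.
Qed.

(** The Gaussian to be subtracted stays on the right-hand side so that all integrands are
    nonnegative; the subtraction is done at the end, once the integral of [f] is either real or
    infinite. Shifts and reflections preserve that integral, hence the division by 2. *)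
Lemma integral_ge_symmetrized (f : K -> K) (e a b c t u v : K) :
  continuous f -> (forall x, 0 <= f x) ->
  0 <= a -> 0 <= b -> 0 <= c -> 0 < t -> 0 < u -> 0 < v ->
  (forall y, a * gauss t y + b * gauss u y <=
     f (y + e) + f (- y + e) + c * gauss v y) ->
  (((a / t + b / u - c / v) * Num.sqrt (2 * pi) / 2)%:E <=
    \int[leb]_x (f x)%:E)%E.
Proof.
move=> cf f0 a0 b0 c0 t0 u0 v0 pw.
have mf : measurable_fun setT f by exact: continuous_measurable_fun.
set I := (\int[leb]_x (f x)%:E)%E.
have IE1 : (\int[leb]_x (f (x + e))%:E = I)%E by rewrite -integral_shift.
have mfe : measurable_fun setT (fun x : K => f (x + e)).
  by apply: (measurableT_comp mf); apply: measurable_funD.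
have IE2 : (\int[leb]_x (f (- x + e))%:E = I)%E.
  by rewrite -(@integral_reflect (fun x : K => f (x + e))).
have mfe2 : measurable_fun setT (fun x : K => f (- x + e)).
  by apply: (measurableT_comp mf); apply: measurable_funD => //; exact: measurableT_comp.
have Ev : (\int[leb]_y (c * gauss v y)%:E = (c * (Num.sqrt (2 * pi) / v))%:E)%E.
  have := integral_gauss2 c0 (lexx 0) v0 ltr01.
  rewrite mul0r addr0 => <-.
  by apply: eq_integral => y _; rewrite mul0r addr0.
have mE (h : K -> K) : measurable_fun setT h ->
    measurable_fun setT (fun y : measurableTypeR K => (h y)%:E).
  by move=> mh; apply/measurable_EFinP.
have mg w : measurable_fun setT (gauss w) by exact: measurable_gauss.
have mgs (k w : K) : measurable_fun setT (fun y => k * gauss w y).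
  exact: measurable_funM.
have g0 (k w y : K) : 0 <= k -> 0 <= k * gauss w y.
  by move=> k0; rewrite mulr_ge0 ?expR_ge0.
have key : ((a * (Num.sqrt (2 * pi) / t) + b * (Num.sqrt (2 * pi) / u))%:E
    <= I + I + (c * (Num.sqrt (2 * pi) / v))%:E)%E.
  rewrite -integral_gauss2// -Ev -{1}IE1 -IE2 -ge0_integralD//; last 4 first.
  - by move=> x _; rewrite lee_fin.
  - exact: mE.
  - by move=> x _; rewrite lee_fin.
  - exact: mE.
  rewrite -ge0_integralD//; last 4 first.
  - by move=> x _; rewrite adde_ge0// lee_fin.
  - by apply: emeasurable_funD; exact: mE.
  - by move=> x _; rewrite lee_fin g0.
  - exact: mE.
  apply: ge0_le_integral => //.
  - by move=> x _; rewrite lee_fin addr_ge0// g0.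
  - by apply: mE; exact: measurable_funD.
  - by apply: emeasurable_funD; [apply: emeasurable_funD|]; exact: mE.
  - by move=> x _; rewrite -!EFinD lee_fin.
have : (0 <= I)%E by apply: integral_ge0 => x _; rewrite lee_fin.
case: I key {IE1 IE2} => [i| |] //; last by move=> _ _; rewrite leey.
rewrite -!EFinD !lee_fin => key _.
set k := Num.sqrt (2 * pi) in key *.
suff : (a / t + b / u - c / v) * k <= i + i by move=> ?; lra.
by rewrite (_ : _ * k = a * (k / t) + b * (k / u) - c * (k / v)); [rewrite lerBlDr|ring].
Qed.

(* Recentring the mixture at [a + sg * e] costs [e ^+ 2 / 2]; symmetrizing the
   integrand around the new centre then cancels its first-order term. *)
Lemma gaussian_mixture_ge_gen (m m1 m2 m3 : K -> K)
    (R g r a sg e W a1 a2 E p q : K) :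
  0 < a1 -> 0 < a2 -> 0 < p -> 0 < q ->
  p ^+ 2 = 1 - 2 * a2 -> q ^+ 2 = 1 - 2 * (a1 + a2) ->
  expR ((R * sg) ^+ 2 / (4 * a2)) <= E -> E / a1 * (q^-1 - p^-1) <= 3 ->
  0 < R -> 0 < g -> 0 <= sg ->
  (forall z : K, is_derive z 1 m (m1 z)) ->
  (forall z : K, is_derive z 1 m1 (m2 z)) ->
  (forall z : K, is_derive z 1 m2 (m3 z)) ->
  (forall z, `|m3 z| <= R * m2 z) ->
  W = m2 (a + sg * e) * sg ^+ 2 / g ->
  ((expR (- (m (a + sg * e) - r * (a + sg * e)) / g - e ^+ 2 / 2
          - 2 * ln (1 + W)))%:E <=
   \int[leb]_x (expR (- (m (a + sg * x) - r * (a + sg * x)) / g)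
                  * normal_pdf 0 1 x)%:E)%E.
Proof.
move=> a10 a20 p0 q0 pE qE EE E3 R0 g0 sg0 dm dm1 dm2 sc WE.
have E0 : 0 <= E by apply: le_trans EE; rewrite expR_ge0.
set b := a + sg * e in WE *.
pose l z := (m z - r * z) / g.
pose f x := expR (- (m (a + sg * x) - r * (a + sg * x)) / g) * normal_pdf 0 1 x.
have W0 : 0 <= W by rewrite WE divr_ge0 ?(ltW g0)// mulr_ge0 ?sqr_ge0// (sc_ge0 R0 sc).
have n10 : (1 : K) != 0 by rewrite oner_eq0.
have pk : normal_peak 1 = (Num.sqrt (2 * pi))^-1 :> K.
  by rewrite /normal_peak expr1n mul1r -mulr_natl.
have pdfE x : normal_pdf 0 1 x = (Num.sqrt (2 * pi))^-1 * expR (- x ^+ 2 / 2) :> K.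
  by rewrite normal_pdfE// pk /normal_fun subr0 expr1n.
pose l1 := (m1 b - r) / g.
have lder (x : K) : is_derive x 1 (fun t : K => a + sg * t) sg.
  by apply: der_eq (derD (derC x a) (derM (derC x sg) (derX x))) _; ring.
have cf : continuous f.
  have ch : continuous (fun x : K => - (m (a + sg * x) - r * (a + sg * x)) / g).
    exact: der_continuous.
  move=> x; apply: cvgM; last exact: continuous_normal_pdf.
  by apply: (cvg_comp _ expR); [exact: ch|exact: continuous_expR].
have f0 x : 0 <= f x by rewrite mulr_ge0 ?expR_ge0 ?normal_pdf_ge0.
have mf : measurable_fun setT f by exact: continuous_measurable_fun.
pose kap : K := Num.sqrt (2 * pi).
have kap0 : 0 < kap by rewrite sqrtr_gt0 mulr_gt0// pi_gt0.
pose C := kap^-1 * expR (- l b - e ^+ 2 / 2).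
have C0 : 0 <= C by rewrite mulr_ge0 ?expR_ge0// invr_ge0 ltW.
pose c := l1 * sg + e.
pose rho y := W / 2 * (y ^+ 2 * expR (R * sg * `|y|)).
have fge z : C * (expR (- c * z) * expR (- rho z) * expR (- z ^+ 2 / 2)) <= f (z + e).
  rewrite /f pdfE [leRHS]mulrCA -!expRD /C -mulrA -expRD -/kap.
  rewrite ler_wpM2l ?invr_ge0 ?(ltW kap0)// ler_expR.
  have -> : a + sg * (z + e) = b + sg * z by rewrite /b; ring.
  have := bregman_le R0 dm dm1 dm2 sc b (sg * z); set D := sg * z => br.
  have {}br : l (b + D) - l b - l1 * D <= rho z.
    rewrite (_ : l (b + D) - _ - _ = (m (b + D) - m b - m1 b * D) / g).
      rewrite ler_pdivrMr//; apply: le_trans br _.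
      rewrite /rho WE normrM (ger0_norm sg0) !mulrA le_eqVlt; apply/orP; left.
      by apply/eqP; rewrite /D; field; rewrite gt_eqF.
    by rewrite /l /l1; field; rewrite gt_eqF.
  have -> : - (m (b + D) - r * (b + D)) / g = - l (b + D) by rewrite /l; ring.
  have -> : - c * z = - (l1 * D) - e * z by rewrite /c /D; ring.
  have -> : - (z + e) ^+ 2 / 2 = - z ^+ 2 / 2 - e * z - e ^+ 2 / 2 by field.
  move: br; move: (l _) (l _) (rho z) (l1 * D) (z ^+ 2 / 2) => *; lra.
pose V := 1 + W.
have V0 : 0 < V by rewrite /V; lra.
have sV0 : 0 < Num.sqrt V by rewrite sqrtr_gt0.
(* Minus an upper bound for the mean of [rho] under the Gaussian of variance [1 / V]; 3 / 2 is half
   of the constant 3 in the hypothesis on [E]. *)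
pose y0 := - (3 / 2 * (W / V)).
pose A1 := expR y0 * (1 - y0).
have y0le : y0 <= 0.
  by rewrite /y0 oppr_le0 mulr_ge0 ?divr_ge0// ltW.
have A10 : 0 <= A1 by rewrite mulr_ge0 ?expR_ge0//; lra.
pose B := expR y0 * (W / 2 * (E / (a1 * V))).
have a1V : 0 < a1 * V by rewrite mulr_gt0.
have B0 : 0 <= B by rewrite !mulr_ge0 ?expR_ge0 ?invr_ge0 ?(ltW a1V)//.
have pw y : 2 * C * A1 * gauss (Num.sqrt V) y + 2 * C * B * gauss (p * Num.sqrt V) y
   <= f (y + e) + f (- y + e) + (2 * C * B) * gauss (q * Num.sqrt V) y.
  have := @gaussian_mixture_pointwise (R * sg) W c y V y0 B a1 a2 E p q
    W0 erefl a10 a20 pE qE EE erefl.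
  have h1 := fge y; have := fge (- y); rewrite /rho sqrrN normrN mulrNN.
  rewrite -/(rho y) => h2 h.
  have C20 : 0 <= 2 * C by rewrite mulr_ge0.
  have := ler_wpM2l C20 h; rewrite -/A1 -/(rho y) !mulrDr.
  move: h1 h2; rewrite mulNr.
  move: (expR (- (c * y))) (expR (c * y)) (expR (- rho y)) (expR (- y ^+ 2 / 2)).
  move: (f _) (f _) (gauss _ _) (gauss _ _) (gauss _ _) => *.
  lra.
have pV0 : 0 < p * Num.sqrt V by rewrite mulr_gt0.
have qV0 : 0 < q * Num.sqrt V by rewrite mulr_gt0.
have C20 : 0 <= 2 * C by rewrite mulr_ge0.
have := integral_ge_symmetrized cf f0 (mulr_ge0 C20 A10) (mulr_ge0 C20 B0)
  (mulr_ge0 C20 B0) sV0 pV0 qV0 pw.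
apply: le_trans; rewrite lee_fin -/kap.
have -> : (2 * C * A1 / Num.sqrt V + 2 * C * B / (p * Num.sqrt V) -
    2 * C * B / (q * Num.sqrt V)) * kap / 2 =
    (C * kap) * ((A1 - B * (q^-1 - p^-1)) * (Num.sqrt V)^-1).
  by field; rewrite !gt_eqF.
have -> : C * kap = expR (- l b - e ^+ 2 / 2).
  by rewrite /C mulrAC mulVf ?mul1r// gt_eqF.
have -> : - (m b - r * b) / g = - l b by rewrite mulNr.
rewrite expRD ler_wpM2l ?expR_ge0//.
have AB : expR y0 <= A1 - B * (q^-1 - p^-1).
  rewrite /A1 /B -mulrA -mulrBr ler_peMr ?expR_ge0//.
  rewrite -addrA lerDl /y0 -opprD oppr_ge0.
  have -> : - (3 / 2 * (W / V)) + W / 2 * (E / (a1 * V)) * (q^-1 - p^-1) =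
      (W / V) / 2 * (E / a1 * (q^-1 - p^-1) - 3).
    by field; rewrite !gt_eqF.
  rewrite mulr_ge0_le0 ?subr_le0//.
  by rewrite !divr_ge0// ltW.
apply: (@le_trans _ _ (expR y0 * (Num.sqrt V)^-1)); last first.
  by rewrite ler_wpM2r// invr_ge0 ltW.
have -> : (Num.sqrt V)^-1 = expR (- (ln V / 2)).
  rewrite expRN; congr (_^-1).
  rewrite -powR12_sqrt ?(ltW V0)// /powR gt_eqF// mulrC.
  by congr expR; rewrite mulrC.
rewrite -expRD ler_expR /y0.
(* With this inequality the two losses [3 / 2 * (W / V)] and [ln V / 2] add up to at most
   [2 * ln V], the factor 2 of the statement. *)
have : W / V <= ln V.
  have := @le_ln1Dx K (V^-1 - 1).
  rewrite (_ : 1 + (V^-1 - 1) = V^-1); last by ring.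
  rewrite lnV ?posrE// => lnV1; have {}lnV1 : - ln V <= V^-1 - 1.
    by apply: lnV1; rewrite ltrBrDr addNr invr_gt0.
  have -> : W / V = 1 - V^-1 by rewrite /V; field; rewrite gt_eqF.
  lra.
rewrite -/V; lra.
Qed.

(** Here [a1] and [a2] are chosen so that [1 - 2 * a2] and [1 - 2 * (a1 + a2)] are the squares of 4
    / 5 and 3 / 4, which makes all square roots rational. The requirement with constant 3 then holds
    narrowly, the left side being about 2.99. The bound 7 / 32 is the inverse of the 32 / 7 in
    [lambda]. *)
Lemma gaussian_mixture_ge (m m1 m2 m3 : K -> K) (R g r a sg e W : K) :
  0 < R -> 0 < g -> 0 <= sg ->
  (forall z : K, is_derive z 1 m (m1 z)) ->
  (forall z : K, is_derive z 1 m1 (m2 z)) ->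
  (forall z : K, is_derive z 1 m2 (m3 z)) ->
  (forall z, `|m3 z| <= R * m2 z) ->
  (R * sg) ^+ 2 <= 7 / 32 ->
  W = m2 (a + sg * e) * sg ^+ 2 / g ->
  ((expR (- (m (a + sg * e) - r * (a + sg * e)) / g - e ^+ 2 / 2
          - 2 * ln (1 + W)))%:E <=
   \int[leb]_x (expR (- (m (a + sg * x) - r * (a + sg * x)) / g)
                  * normal_pdf 0 1 x)%:E)%E.
Proof.
move=> R0 g0 sg0 dm dm1 dm2 sc Rsg WE.
have a10 : 0 < 31 / 800 :> K by lra.
have a20 : 0 < 9 / 50 :> K by lra.
have p0 : 0 < 4 / 5 :> K by lra.
have q0 : 0 < 3 / 4 :> K by lra.
have pE : (4 / 5) ^+ 2 = 1 - 2 * (9 / 50) :> K by field.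
have qE : (3 / 4) ^+ 2 = 1 - 2 * (31 / 800 + 9 / 50) :> K by field.
have E3 : (1391 / 1000) / (31 / 800) * ((3 / 4)^-1 - (4 / 5)^-1) <= 3 :> K.
  have -> : (3 / 4)^-1 = 4 / 3 :> K by field.
  have -> : (4 / 5)^-1 = 5 / 4 :> K by field.
  have -> : (31 / 800)^-1 = 800 / 31 :> K by field.
  lra.
have EE : expR ((R * sg) ^+ 2 / (4 * (9 / 50))) <= 1391 / 1000.
  (* [h] is half of the exact exponent. Bounding each half by [1 / (1 - h)] gives about 1.390;
     without the split the bound would be about 1.44, too large for the constant 3. *)
  have [h hE] : {h : K | h = 175 / 1152} by exists (175 / 1152).
  have hle : (R * sg) ^+ 2 / (4 * (9 / 50)) <= h + h.
    by rewrite ler_pdivrMr ?hE; lra.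
  apply: (@le_trans _ _ (expR (h + h))); first by rewrite ler_expR.
  have h1 : 0 < 1 - h by rewrite hE; lra.
  have e1 : expR h <= (1 - h)^-1.
    rewrite -[leLHS]invrK lef_pV2 ?posrE ?invr_gt0 ?expR_gt0//.
    by rewrite -expRN; have := expR_ge1Dx (- h).
  rewrite expRD; apply: (@le_trans _ _ ((1 - h)^-1 * (1 - h)^-1)).
    by apply: ler_pM; rewrite ?expR_ge0.
  have -> : (1 - h)^-1 = 1152 / 977 by rewrite hE; field.
  lra.
exact: (gaussian_mixture_ge_gen r a10 a20 p0 q0 pE qE EE E3 R0 g0 sg0 dm dm1 dm2 sc WE).
Qed.

End GaussianMixture.

(** * Integration against a sub-sigma-algebra *)

Section NonnegInduction.
Context {d : measure_display} {T : measurableType d} {K : realType}.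
Local Open Scope ereal_scope.
Import HBNNSimple.

(** The passage from indicators to nonnegative functions, isolated because it serves on two spaces:
    the sub-sigma-algebra of the past and the line of rewards. *)
Lemma nonneg_measurable_ind (Q : (T -> \bar K) -> Prop) :
  (forall A, measurable A -> Q (fun x => (\1_A x)%:E)) ->
  (forall (c : K) f, (0 <= c)%R -> measurable_fun setT f -> (forall x, 0 <= f x) ->
     Q f -> Q (fun x => c%:E * f x)) ->
  (forall f g, measurable_fun setT f -> measurable_fun setT g ->
     (forall x, 0 <= f x) -> (forall x, 0 <= g x) ->
     Q f -> Q g -> Q (fun x => f x + g x)) ->
  (forall f_ : nat -> T -> \bar K, (forall n, measurable_fun setT (f_ n)) ->
     (forall n x, 0 <= f_ n x) ->
     (forall x, nondecreasing_seq (f_ ^~ x)) ->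
     (forall n, Q (f_ n)) -> Q (fun x => limn (f_ ^~ x))) ->
  forall f, measurable_fun setT f -> (forall x, 0 <= f x) -> Q f.
Proof.
move=> Qi Qc Qa Ql f mf f0.
pose f_ := nnsfun_approx measurableT mf.
have -> : f = fun x => limn (fun n => (f_ n x)%:E).
  by apply/funext => x; apply/esym/cvg_lim => //; exact: cvg_nnsfun_approx.
apply: (Ql (fun n x => (f_ n x)%:E)) => [n|n x|x a b ab|n].
- exact/measurable_EFinP.
- by rewrite lee_fin.
- by rewrite lee_fin; exact/lefP/nd_nnsfun_approx.
set g := f_ n.
have -> : (fun x => (g x)%:E) =
    fun x => \sum_(y <- (fset_set (range g) : seq K)) y%:E * (\1_(g @^-1` [set y]) x)%:E.
  apply/funext => x; rewrite fimfunE fsbig_finite//= -sumEFin.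
  by apply: eq_bigr => y _; rewrite EFinM.
have : forall y, y \in (fset_set (range g) : seq K) -> (0 <= y)%R.
  by move=> y; rewrite in_fset_set// in_setE => -[x _ <-].
elim: (fset_set _ : seq K) => [|y s IH] ys.
  have -> : (fun x : T => \sum_(y <- [::]) y%:E * (\1_(g @^-1` [set y]) x)%:E) =
     fun x => 0%:E * (\1_setT x)%:E.
    by apply/funext => x; rewrite big_nil mul0e.
  apply: Qc => //; last exact: Qi.
  exact/measurable_EFinP.
have y0 : (0 <= y)%R by rewrite ys// mem_head.
have ys' z : z \in s -> (0 <= z)%R by move=> zs; rewrite ys// in_cons zs orbT.
have mi (z : K) : measurable_fun setT (fun x => (\1_(g @^-1` [set z]) x)%:E).
  by apply/measurable_EFinP; exact: measurable_indic.
have -> : (fun x => \sum_(z <- y :: s) z%:E * (\1_(g @^-1` [set z]) x)%:E) =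
  fun x => y%:E * (\1_(g @^-1` [set y]) x)%:E +
     \sum_(z <- s) z%:E * (\1_(g @^-1` [set z]) x)%:E.
  by apply/funext => x; rewrite big_cons.
apply: Qa.
- exact: measurable_funeM.
- by apply: emeasurable_sum => z; exact: measurable_funeM.
- by move=> x; rewrite mule_ge0 ?lee_fin.
- move=> x; rewrite big_seq sume_ge0// => z zs.
  by apply: mule_ge0; rewrite lee_fin; [exact: ys'|].
- by apply: Qc => //; exact: Qi.
- exact: IH.
Qed.

End NonnegInduction.

Section SubSigma.
Context {d : measure_display} {T : measurableType d} {K : realType}.
Context (X : set (set T)) (XT : X `<=` measurable).
Local Notation TX := (g_sigma_algebraType X).

Lemma sub_measurable (A : set T) : <<s X >> A -> measurable A.
Proof. by apply: smallest_sub => //; exact: sigma_algebra_measurable. Qed.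

Lemma sub_measurable_fun d' (Y : measurableType d') (f : T -> Y) :
  measurable_fun setT (f : TX -> Y) -> measurable_fun setT f.
Proof. by move=> mf _ B mB; apply: sub_measurable; exact: mf. Qed.

Local Open Scope ereal_scope.

(** Conditional expectations are never formed: agreement of two integrals on every event of the past
    is extended to nonnegative weights known from the past. *)
Lemma sub_sigma_integral (P : {measure set T -> \bar K}) (f g : T -> K) :
  measurable_fun setT f -> measurable_fun setT g ->
  (forall x, 0 <= f x)%R -> (forall x, 0 <= g x)%R ->
  (forall A, <<s X >> A ->
    \int[P]_(x in A) (f x)%:E = \int[P]_(x in A) (g x)%:E) ->
  forall U, measurable_fun setT (U : TX -> \bar K) -> (forall x, 0 <= U x) ->
  \int[P]_x (U x * (f x)%:E) = \int[P]_x (U x * (g x)%:E).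
Proof.
move=> mf mg f0 g0 fg.
have mfE (h : T -> K) : measurable_fun setT h -> measurable_fun setT (EFin \o h).
  by move=> mh; exact/measurable_EFinP.
apply: (@nonneg_measurable_ind _ TX K
  (fun U : T -> \bar K => \int[P]_x (U x * (f x)%:E) = \int[P]_x (U x * (g x)%:E))).
- move=> A mA.
  have mA' : d.-measurable (A : set T) by exact: sub_measurable.
  have indicM (h : T -> K) :
      \int[P]_x ((\1_A x)%:E * (h x)%:E) = \int[P]_(x in A) (h x)%:E.
    rewrite [RHS]integral_mkcond; apply: eq_integral => x _.
    by rewrite patchE indicE; case: ifPn => xA; rewrite ?mul1e ?mul0e.
  by rewrite !indicM; exact: fg.
- move=> c U c0 mU U0 IH.
  have mU' : measurable_fun setT (U : T -> \bar K) by exact: sub_measurable_fun.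
  have sc (h : T -> K) : measurable_fun setT h -> (forall x, 0 <= h x)%R ->
     \int[P]_x (c%:E * U x * (h x)%:E) = c%:E * \int[P]_x (U x * (h x)%:E).
    move=> mh h0; rewrite -ge0_integralZl//.
    - by apply: eq_integral => x _; rewrite muleA.
    - by apply: emeasurable_funM => //; exact: mfE.
    - by move=> x _; rewrite mule_ge0// lee_fin.
  by rewrite !sc// IH.
- move=> U V mU mV U0 V0 IHU IHV.
  have mU' : measurable_fun setT (U : T -> \bar K) by exact: sub_measurable_fun.
  have mV' : measurable_fun setT (V : T -> \bar K) by exact: sub_measurable_fun.
  have ad (h : T -> K) : measurable_fun setT h -> (forall x, 0 <= h x)%R ->
     \int[P]_x ((U x + V x) * (h x)%:E) =
     \int[P]_x (U x * (h x)%:E) + \int[P]_x (V x * (h x)%:E).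
    move=> mh h0; rewrite -ge0_integralD//.
    - by apply: eq_integral => x _; rewrite ge0_muleDl.
    - by move=> x _; rewrite mule_ge0// lee_fin.
    - by apply: emeasurable_funM => //; exact: mfE.
    - by move=> x _; rewrite mule_ge0// lee_fin.
    - by apply: emeasurable_funM => //; exact: mfE.
  by rewrite !ad// IHU IHV.
- move=> U_ mU_ U0 ndU IH.
  have mU' n : measurable_fun setT (U_ n : T -> \bar K) by exact: sub_measurable_fun.
  have cU x : cvgn (U_ ^~ x) by apply: ereal_nondecreasing_is_cvgn; exact: ndU.
  have li (h : T -> K) : measurable_fun setT h -> (forall x, 0 <= h x)%R ->
     \int[P]_x (limn (U_ ^~ x) * (h x)%:E) =
     limn (fun n => \int[P]_x (U_ n x * (h x)%:E)).
    move=> mh h0; rewrite -monotone_convergence//.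
    - apply: eq_integral => x _; rewrite muleC -limeMl//.
      by congr (limn _); apply/funext => n; rewrite muleC.
    - by move=> n; apply: emeasurable_funM => //; exact: mfE.
    - by move=> n x _; rewrite mule_ge0// lee_fin.
    - by move=> x _ a b ab; rewrite lee_wpmul2r// ?lee_fin// ndU.
  rewrite (li _ mf f0) (li _ mg g0).
  by congr (limn _); apply/funext => n; exact: IH.
Qed.

End SubSigma.

(** * The conditional law of the rewards *)

Section BanditLaw.
Context {K : realType} {d : measure_display} {T : measurableType d}.
Context (P : probability T K) (X : set (set T)) (XT : X `<=` measurable).
Local Notation TX := (g_sigma_algebraType X).
Context (m h : K -> K) (g : K) (nu : {measure set (measurableTypeR K) -> \bar K}).
Context (r z : T -> K).
Hypothesis g0 : 0 < g.
Hypothesis cm : continuous m.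
Hypothesis mp : forall x : K, measurable_fun setT (glm_density m h g x).
Hypothesis p1 : forall x : K, (\int[nu]_y (glm_density m h g x y)%:E)%E = 1%E.
Hypothesis mr : measurable_fun setT r.
Hypothesis mz : measurable_fun setT (z : TX -> K).
Hypothesis law : forall (A : set T) (B : set (measurableTypeR K)),
  <<s X >> A -> measurable B ->
  P (A `&` r @^-1` B) =
  (\int[P]_(w in A) \int[nu]_(y in B) (glm_density m h g (z w) y)%:E)%E.

Local Notation p := (glm_density m h g).

Lemma glm_density_ge0 x y : 0 <= p x y. Proof. exact: expR_ge0. Qed.

(** Exponential tilting moves the natural parameter of the family by [c]; every likelihood ratio
    below has mean 1 for this reason. *)
Lemma glm_density_shift (x c y : K) :
  expR (y * c / g) * p x y = expR ((m (x + c) - m x) / g) * p (x + c) y.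
Proof.
by rewrite /glm_density -!expRD; congr expR; field; rewrite gt_eqF.
Qed.

Lemma integral_glm_density_exp (x c : K) :
  (\int[nu]_y ((expR (y * c / g))%:E * (p x y)%:E) =
   (expR ((m (x + c) - m x) / g))%:E)%E.
Proof.
under eq_integral do rewrite -EFinM glm_density_shift EFinM.
rewrite ge0_integralZl//=; last 2 first.
- by apply/measurable_EFinP; exact: mp.
- by move=> y _; rewrite lee_fin glm_density_ge0.
by rewrite p1 mule1.
Qed.

(** The type of [nu] carries no sigma-finiteness, so measurability in the parameter is not taken
    from Tonelli's theorem. Multiplying by [expR (m x / g)] leaves integrands whose exponent is
    affine in the parameter, and dominated convergence makes their integral continuous. *)
Lemma measurable_integral_glm_density (B : set (measurableTypeR K)) :
  measurable B ->
  measurable_fun setT (fun x : K => \int[nu]_(y in B) (p x y)%:E)%E.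
Proof.
move=> mB.
pose f (x y : K) := expR (m x / g) * p x y.
have fE x y : f x y = expR (y * x / g + h y).
  by rewrite /f /glm_density -expRD; congr expR; field; rewrite gt_eqF.
have intp x : nu.-integrable setT (EFin \o p x).
  apply/integrableP; split; first by apply/measurable_EFinP; exact: mp.
  under eq_integral do rewrite /= ger0_norm ?glm_density_ge0//.
  by rewrite p1 ltry.
have intf x : nu.-integrable setT (EFin \o f x).
  rewrite (_ : EFin \o f x = fun y => ((expR (m x / g))%:E * (p x y)%:E)%E); last first.
    by apply/funext => y; rewrite /= EFinM.
  by apply: integrableZl => //; exact: intp.
have intfB x : nu.-integrable B (EFin \o f x).
  by apply: (integrableS measurableT) => //; exact: intf.
pose F x := (\int[nu]_(y in B) f x y)%R.
have cF : continuous F.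
  move=> x.
  have := @continuity_under_integral K _ _ nu f B mB (x - 1) (x + 1)
    (fun x _ => intfB x) _ (fun y => f (x - 1) y + f (x + 1) y).
  move=> /(_ _ _ _ x); apply.
  - apply/aeW => y _ t _.
    rewrite (_ : f^~ y = fun x => expR (y * x / g + h y)); last first.
      by apply/funext => u; rewrite fE.
    have dl (u : K) : is_derive u 1 (fun x : K => y * x / g + h y) (y / g).
      apply: der_eq (derD (derM (derM (derC u y) (derX u)) (derC u g^-1)) (derC u (h y))) _.
      by ring.
    apply: (cvg_comp _ expR); last exact: continuous_expR.
    exact: (der_continuous dl).
  - exact: (integrableD mB (intfB (x - 1)) (intfB (x + 1))).
  (* Between [x - 1] and [x + 1] the exponential of an affine function is at most the larger of its
     end values, hence at most their sum. *)
  - move=> t; rewrite /= in_itv/= => /andP[xt tx]; apply/aeW => y _.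
    rewrite !fE ger0_norm ?expR_ge0//.
    have [y0|y0] := leP 0 y.
      rewrite -[leLHS]add0r lerD ?expR_ge0// ler_expR lerD2r ler_wpM2r ?invr_ge0 ?(ltW g0)//.
      by rewrite ler_wpM2l// ltW.
    rewrite -[leLHS]addr0 lerD ?expR_ge0// ler_expR lerD2r ler_wpM2r ?invr_ge0 ?(ltW g0)//.
    by rewrite ler_wnM2l// ltW.
  - by rewrite in_setE /= in_itv/= ltrBlDr ltrDl ltr01.
have -> : (fun x : K => \int[nu]_(y in B) (p x y)%:E)%E =
    (fun x => (expR (- m x / g) * F x)%:E)%E.
  apply/funext => x; rewrite EFinM /F fineK; last by apply: integrable_fin_num => //; exact: intfB.
  rewrite -ge0_integralZl//=.
  - apply: eq_integral => y _; rewrite -EFinM; congr (_%:E).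
    by rewrite /f mulrA -expRD mulNr addNr expR0 mul1r.
  - exact: (measurable_int _ (intfB x)).
  - by move=> y _; rewrite lee_fin mulr_ge0 ?expR_ge0.
apply/measurable_EFinP; apply: measurable_funM.
  apply: measurableT_comp => //; apply: measurable_funM => //.
  by apply: measurableT_comp => //; exact: continuous_measurable_fun.
exact: continuous_measurable_fun.
Qed.

Let mrK : measurable_fun setT (r : T -> measurableTypeR K) := mr.

(** Measurability of the inner integral is carried along in the same induction, because the sum and
    limit steps of the identity need it for the approximating functions. *)
Lemma law_integral (A : set T) (phi : measurableTypeR K -> \bar K) :
  <<s X >> A -> measurable_fun setT phi -> (forall y, 0 <= phi y)%E ->
  measurable_fun setT
    ((fun w => \int[nu]_y (phi y * (p (z w) y)%:E)) : TX -> \bar K)%E /\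
  (\int[P]_(w in A) phi (r w) =
   \int[P]_(w in A) \int[nu]_y (phi y * (p (z w) y)%:E))%E.
Proof.
move=> XA; have mA : measurable A by exact: (sub_measurable XT).
have mpE x : measurable_fun setT (fun y : measurableTypeR K => (p x y)%:E).
  by apply/measurable_EFinP; exact: mp.
have pE0 x y : (0 <= (p x y)%:E)%E by rewrite lee_fin glm_density_ge0.
pose Q (phi : measurableTypeR K -> \bar K) := measurable_fun setT
    ((fun w => \int[nu]_y (phi y * (p (z w) y)%:E)) : TX -> \bar K)%E /\
  (\int[P]_(w in A) phi (r w) =
   \int[P]_(w in A) \int[nu]_y (phi y * (p (z w) y)%:E))%E.
apply: (@nonneg_measurable_ind _ _ _ Q) => /=.
- move=> B mB.
  have E x : (\int[nu]_y ((\1_B y)%:E * (p x y)%:E) =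
      \int[nu]_(y in B) (p x y)%:E)%E.
    rewrite [RHS]integral_mkcond; apply: eq_integral => y _.
    by rewrite patchE indicE; case: ifPn => yB; rewrite ?mul1e ?mul0e.
  rewrite /Q; under [X in measurable_fun _ X]eq_fun do rewrite E; split.
    exact: (measurableT_comp (measurable_integral_glm_density mB) mz).
  under [RHS]eq_integral do rewrite E.
  rewrite -law//; have mrB : measurable (r @^-1` B).
    by rewrite -[_ @^-1` _]setTI; exact: mrK.
  rewrite setIC -(integral_indic P mA mrB).
  by apply: eq_integral => w _; rewrite !indicE.
- move=> c f c0 mf f0 [mI IH].
  have E x : (\int[nu]_y (c%:E * f y * (p x y)%:E) =
      c%:E * \int[nu]_y (f y * (p x y)%:E))%E.
    rewrite -ge0_integralZl//.
    - by apply: eq_integral => y _; rewrite muleA.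
    - exact: emeasurable_funM.
    - by move=> y _; rewrite mule_ge0.
  rewrite /Q; under [X in measurable_fun _ X]eq_fun do rewrite E; split.
    exact: measurable_funeM.
  under [RHS]eq_integral do rewrite E.
  rewrite !ge0_integralZl//; first by rewrite IH.
  - by apply: measurable_funTS; exact: (measurableT_comp mf mrK).
  - exact: measurable_funTS (sub_measurable_fun XT mI).
  - by move=> w _; apply: integral_ge0 => y _; rewrite mule_ge0.
- move=> f f' mf mf' f0 f0' [mI IH] [mI' IH'].
  have E x : (\int[nu]_y ((f y + f' y) * (p x y)%:E) =
      \int[nu]_y (f y * (p x y)%:E) + \int[nu]_y (f' y * (p x y)%:E))%E.
    rewrite -ge0_integralD//.
    - by apply: eq_integral => y _; rewrite ge0_muleDl.
    - by move=> y _; rewrite mule_ge0.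
    - exact: emeasurable_funM.
    - by move=> y _; rewrite mule_ge0.
    - exact: emeasurable_funM.
  rewrite /Q; under [X in measurable_fun _ X]eq_fun do rewrite E; split.
    exact: emeasurable_funD.
  under [RHS]eq_integral do rewrite E.
  have mfr (u : measurableTypeR K -> \bar K) : measurable_fun setT u ->
      measurable_fun A (fun w => u (r w)).
    by move=> mu; apply: measurable_funTS; exact: (measurableT_comp mu mrK).
  have I0 (u : measurableTypeR K -> \bar K) w : (forall y, 0 <= u y)%E ->
      (0 <= \int[nu]_y (u y * (p (z w) y)%:E))%E.
    by move=> u0; apply: integral_ge0 => y _; rewrite mule_ge0.
  have mIA := measurable_funTS (sub_measurable_fun XT mI) : measurable_fun A _.
  have mIA' := measurable_funTS (sub_measurable_fun XT mI') : measurable_fun A _.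
  rewrite (ge0_integralD P mA (fun w _ => f0 (r w)) (mfr _ mf) (fun w _ => f0' (r w)) (mfr _ mf')).
  rewrite (ge0_integralD P mA (fun w _ => I0 f w f0) mIA (fun w _ => I0 f' w f0') mIA').
  by rewrite IH IH'.
- move=> f_ mf_ f0 ndf IH.
  have mI n := (IH n).1.
  have cf y : cvgn (f_ ^~ y) by apply: ereal_nondecreasing_is_cvgn; exact: ndf.
  have E x : (\int[nu]_y (limn (f_ ^~ y) * (p x y)%:E) =
      limn (fun n => \int[nu]_y (f_ n y * (p x y)%:E)))%E.
    rewrite -monotone_convergence//.
    - apply: eq_integral => y _; rewrite muleC -limeMl//.
      by congr (limn _); apply/funext => n; rewrite muleC.
    - by move=> n; exact: emeasurable_funM.
    - by move=> n y _; rewrite mule_ge0.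
    - by move=> y _ a b ab; rewrite lee_wpmul2r// ndf.
  have ndI x : nondecreasing_seq (fun n => \int[nu]_y (f_ n y * (p x y)%:E))%E.
    move=> a b ab; apply: ge0_le_integral => //.
    - by move=> y _; rewrite mule_ge0.
    - exact: emeasurable_funM.
    - exact: emeasurable_funM.
    - by move=> y _; rewrite lee_wpmul2r// ndf.
  rewrite /Q; under [X in measurable_fun _ X]eq_fun do rewrite E; split.
    apply: (@emeasurable_fun_cvg _ TX K setT
      (fun n (w : TX) => \int[nu]_y (f_ n y * (p (z w) y)%:E))%E) => //.
    by move=> w _; apply: ereal_nondecreasing_is_cvgn; exact: ndI.
  under [RHS]eq_integral do rewrite E.
  have mfr n : measurable_fun A (fun w => f_ n (r w)).
    by apply: measurable_funTS; exact: (measurableT_comp (mf_ n) mrK).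
  have mIA n := measurable_funTS (sub_measurable_fun XT (mI n)) : measurable_fun A _.
  rewrite (@monotone_convergence _ _ _ P A mA (fun n w => f_ n (r w)) mfr
    (fun n w _ => f0 n (r w)) (fun w _ => ndf (r w))).
  rewrite (@monotone_convergence _ _ _ P A mA
    (fun n w => \int[nu]_y (f_ n y * (p (z w) y)%:E))%E mIA _ (fun w _ => ndI (z w))).
    by congr (limn _); apply/funext => n; rewrite (IH n).2.
  by move=> n w _; apply: integral_ge0 => y _; rewrite mule_ge0.
Qed.

Let ltil (c : K) (w : T) : K := (m (z w + c) - m (z w)) / g.

Let measurable_ltil_comp (D : T -> K) : measurable_fun setT (D : TX -> K) ->
  measurable_fun setT ((fun w => (m (z w + D w) - m (z w)) / g) : TX -> K).
Proof.
move=> mD; apply: measurable_funM => //; apply: measurable_funB.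
  apply: (measurableT_comp (continuous_measurable_fun cm)).
  exact: measurable_funD.
exact: (measurableT_comp (continuous_measurable_fun cm)).
Qed.

(** This is the conditional moment generating function of the reward, tested against past weights.
    The shift [c] is still deterministic; it becomes random only through level sets. *)
Lemma law_exp (c : K) (U : T -> \bar K) :
  measurable_fun setT (U : TX -> \bar K) -> (forall w, 0 <= U w)%E ->
  (\int[P]_w (U w * (expR (r w * c / g))%:E) =
   \int[P]_w (U w * (expR ((m (z w + c) - m (z w)) / g))%:E))%E.
Proof.
move=> mU U0; apply: (sub_sigma_integral XT) => //.
- apply: measurableT_comp => //; apply: measurable_funM => //.
  exact: measurable_funM.
- apply: measurableT_comp => //; apply: (sub_measurable_fun XT).
  exact: measurable_ltil_comp.
move=> A XA.
have mphi : measurable_fun setT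
    ((fun y => (expR (y * c / g))%:E) : measurableTypeR K -> \bar K).
  apply/measurable_EFinP; apply: measurableT_comp => //.
  by apply: measurable_funM => //; exact: measurable_funM.
have [] := law_integral XA mphi; first by move=> y; rewrite lee_fin expR_ge0.
move=> _ ->.
by apply: eq_integral => w _; exact: integral_glm_density_exp.
Qed.

Import HBSimple.

Let G (D : K) (w : T) : K := expR ((r w * D - (m (z w + D) - m (z w))) / g).

Let measurable_G (D : T -> K) : measurable_fun setT D ->
  measurable_fun setT (fun w => G (D w) w).
Proof.
move=> mD; apply: measurableT_comp => //; apply: measurable_funM => //.
apply: measurable_funB; first exact: measurable_funM.
have mz' : measurable_fun setT z by exact: (sub_measurable_fun XT).
apply: measurable_funB.
  apply: (measurableT_comp (continuous_measurable_fun cm)).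
  exact: measurable_funD.
exact: (measurableT_comp (continuous_measurable_fun cm)).
Qed.

Let law_ratio_sfun (s : {sfun TX >-> K}) (U : T -> \bar K) :
  measurable_fun setT (U : TX -> \bar K) -> (forall w, 0 <= U w)%E ->
  (\int[P]_w (U w * (G (s w) w)%:E) = \int[P]_w U w)%E.
Proof.
move=> mU U0.
pose sq : seq K := fset_set (range s).
pose I c w : \bar K := (\1_(s @^-1` [set c]) w)%:E.
have sumI (F : K -> \bar K) w : (F (s w) = \sum_(c <- sq) I c w * F c)%E.
  rewrite (bigD1_seq (s w)) ?fset_uniq//=; last first.
    by rewrite in_fset_set// in_setE; exists w.
  rewrite big1 ?adde0; last first.
    move=> c cs; rewrite /I indicE memNset ?mul0e//.
    by move=> /= E; rewrite E eqxx in cs.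
  by rewrite /I indicE mem_set// mul1e.
have mI c : measurable_fun setT (I c : TX -> \bar K).
  by apply/measurable_EFinP; exact: measurable_indic.
have I0 c w : (0 <= I c w)%E by rewrite lee_fin.
have mGc c : measurable_fun setT (fun w => (G c w)%:E).
  by apply/measurable_EFinP; exact: (measurable_G (measurable_cst c)).
have mUI c : measurable_fun setT ((fun w => U w * I c w) : TX -> \bar K)%E.
  exact: emeasurable_funM.
have piece c : (\int[P]_w (U w * I c w * (G c w)%:E) = \int[P]_w (U w * I c w))%E.
  (* The normalizing factor [expR (- ltil c w)] is known from the past, so it joins the weight
     before the law is applied. *)
  pose U' w : \bar K := (U w * I c w * (expR (- ltil c w))%:E)%E.
  have mU' : measurable_fun setT (U' : TX -> \bar K).
    apply: emeasurable_funM => //; apply/measurable_EFinP.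
    apply: measurableT_comp => //; apply: measurableT_comp => //.
    exact: (measurable_ltil_comp (measurable_cst c)).
  have U'0 w : (0 <= U' w)%E by rewrite !mule_ge0// lee_fin expR_ge0.
  have := law_exp c mU' U'0.
  rewrite (_ : (fun w => _) = (fun w => U w * I c w * (G c w)%:E)%E); last first.
    apply/funext => w; rewrite /U' -muleA -EFinM -expRD /G /ltil.
    by congr (_ * (expR _)%:E)%E; ring.
  move=> ->; apply: eq_integral => w _.
  by rewrite /U' -muleA -EFinM -expRD addNr expR0 mule1.
transitivity (\int[P]_w \sum_(c <- sq) (U w * I c w * (G c w)%:E))%E.
  apply: eq_integral => w _.
  rewrite (sumI (fun c => U w * (G c w)%:E)%E).
  by apply: eq_bigr => c _; rewrite muleCA muleA.
rewrite ge0_integral_sum//; last 2 first.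
- by move=> c; apply: emeasurable_funM => //; exact: (sub_measurable_fun XT (mUI c)).
- by move=> c w _; rewrite !mule_ge0// lee_fin expR_ge0.
under eq_bigr do rewrite piece.
rewrite -ge0_integral_sum//; last 2 first.
- by move=> c; exact: (sub_measurable_fun XT (mUI c)).
- by move=> c w _; rewrite !mule_ge0.
apply: eq_integral => w _.
rewrite [RHS](sumI (fun=> U w) w).
by apply: eq_bigr => c _; rewrite muleC.
Qed.

(* The only consequence of the law of the rewards that the regret bound needs;
   [D] is approximated by simple functions, whose level sets lie in the past. *)
Lemma likelihood_ratio_le (D : T -> K) (U : T -> \bar K) :
  measurable_fun setT (D : TX -> K) ->
  measurable_fun setT (U : TX -> \bar K) -> (forall w, 0 <= U w)%E ->
  (\int[P]_w (U w * (expR ((r w * D w - (m (z w + D w) - m (z w))) / g))%:E) <=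
   \int[P]_w U w)%E.
Proof.
move=> mD mU U0.
have mU' := sub_measurable_fun XT mU.
have [s scvg] : exists s : {sfun TX >-> K}^nat,
    forall w, setT w -> EFin \o s ^~ w @ \oo --> (EFin \o D) w.
  by apply: (@approximation_sfun _ TX K (EFin \o D) setT measurableT); exact/measurable_EFinP.
have Dcvg w : (fun n => s n w) @ \oo --> D w.
  by have /fine_cvgP[_] := scvg w Logic.I.
have cG w : continuous (G ^~ w).
  move=> x; apply: (cvg_comp _ expR); last exact: continuous_expR.
  apply: cvgM; last exact: cvg_cst.
  apply: cvgB; first by apply: cvgM; [exact: cvg_cst|exact: cvg_id].
  apply: cvgB; last exact: cvg_cst.
  apply: (cvg_comp _ m); last exact: cm.
  by apply: cvgD; [exact: cvg_cst|exact: cvg_id].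
have Gcvg w : (fun n => U w * (G (s n w) w)%:E)%E @ \oo --> (U w * (G (D w) w)%:E)%E.
  have GE : (fun n => (G (s n w) w)%:E) @ \oo --> (G (D w) w)%:E.
    by apply: cvg_EFin; [near=> n|exact: (cvg_comp _ _ (Dcvg w) (cG w (D w)))].
  move: (U0 w); case: (U w) => [u| |] // u0; first exact: cvgeMl.
  have yG c : (+oo * (G c w)%:E = +oo)%E.
    by rewrite gt0_mulye// lte_fin expR_gt0.
  by rewrite yG; under eq_fun do rewrite yG; exact: cvg_cst.
have mUG (s' : T -> K) : measurable_fun setT s' ->
    measurable_fun setT (fun w => U w * (G (s' w) w)%:E)%E.
  by move=> ms; apply: emeasurable_funM => //; apply/measurable_EFinP; exact: measurable_G.
have ms n : measurable_fun setT (s n : T -> K) by exact: (sub_measurable_fun XT).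
(* Fatou's lemma asks for no domination and yields an inequality only, which is what Markov's
   inequality will use. *)
have := @fatou _ _ _ P setT measurableT (fun n w => U w * (G (s n w) w)%:E)%E
  (fun n => mUG _ (ms n)).
have UG0 n w : setT w -> (0 <= U w * (G (s n w) w)%:E)%E.
  by move=> _; rewrite mule_ge0// lee_fin expR_ge0.
move=> /(_ UG0).
under eq_integral do rewrite (cvg_limn_einf_sup (Gcvg _)).1.
under [X in (_ <= limn_einf X)%E -> _]eq_fun do rewrite law_ratio_sfun//.
by rewrite (cvg_limn_einf_sup (cvg_cst _)).1.
Unshelve. all: by end_near. Qed.

End BanditLaw.

(** * The mixture supermartingale *)

Section MixtureFactor.
Context {K : realType}.
Context (m : K -> K) (g : K).
Hypothesis cm : continuous m.
Local Notation leb := (@lebesgue_measure K).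

(** The quotient of the densities at parameters [y] and [z]: the base term of the family cancels. *)
Definition lik_ratio (r z y : K) : K := expR ((r * (y - z) - (m y - m z)) / g).

Definition mix_ratio (r z a sg : K) : \bar K :=
  (\int[leb]_x (lik_ratio r z (a + sg * x) * normal_pdf 0 1 x)%:E)%E.

(** The discount [om] is a mixing weight against the constant 1, not an exponent, so a mean at most
    1 is immediate by linearity. *)
Definition mix_factor (om p r z a sg z' : K) : \bar K :=
  ((1 - om)%:E + om%:E * (p%:E * mix_ratio r z a sg
                          + (1 - p)%:E * (lik_ratio r z z')%:E))%E.

Lemma measurable_lik_ratio d (T : measurableType d) (r z y : T -> K) :
  measurable_fun setT r -> measurable_fun setT z -> measurable_fun setT y ->
  measurable_fun setT (fun w => lik_ratio (r w) (z w) (y w)).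
Proof.
move=> mr mz my; apply: measurableT_comp => //; apply: measurable_funM => //.
have mm f : measurable_fun setT f -> measurable_fun setT (m \o f : T -> K).
  by move=> mf; exact: (measurableT_comp (continuous_measurable_fun cm)).
apply: measurable_funB; last by apply: measurable_funB; exact: mm.
by apply: measurable_funM => //; exact: measurable_funB.
Qed.

Lemma mix_ratio_ge0 (r z a sg : K) : (0 <= mix_ratio r z a sg)%E.
Proof.
by apply: integral_ge0 => x _; rewrite lee_fin mulr_ge0 ?expR_ge0 ?normal_pdf_ge0.
Qed.

Let joint d (T : measurableType d) (r z a sg : T -> K) :=
  fun q : T * measurableTypeR K =>
  (lik_ratio (r q.1) (z q.1) (a q.1 + sg q.1 * q.2) * normal_pdf 0 1 q.2)%:E.

Let measurable_joint d (T : measurableType d) (r z a sg : T -> K) :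
  measurable_fun setT r -> measurable_fun setT z -> measurable_fun setT a ->
  measurable_fun setT sg -> measurable_fun setT (joint r z a sg).
Proof.
move=> mr mz ma msg; apply/measurable_EFinP; apply: measurable_funM.
  apply: measurable_lik_ratio; first exact: measurableT_comp.
    exact: measurableT_comp.
  apply: measurable_funD; first exact: measurableT_comp.
  apply: measurable_funM; first exact: measurableT_comp.
  exact: measurable_snd.
apply: (measurableT_comp (measurable_normal_pdf 0 1)); exact: measurable_snd.
Qed.

Let joint_ge0 d (T : measurableType d) (r z a sg : T -> K) q :
  (0 <= joint r z a sg q)%E.
Proof. by rewrite lee_fin mulr_ge0 ?expR_ge0 ?normal_pdf_ge0. Qed.

Lemma measurable_mix_ratio d (T : measurableType d) (r z a sg : T -> K) :
  measurable_fun setT r -> measurable_fun setT z -> measurable_fun setT a ->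
  measurable_fun setT sg ->
  measurable_fun setT (fun w => mix_ratio (r w) (z w) (a w) (sg w)).
Proof.
move=> mr mz ma msg.
exact: (@measurable_fun_fubini_tonelli_F _ _ _ _ _ leb (joint r z a sg)
  (measurable_joint mr mz ma msg) (joint_ge0 r z a sg)).
Qed.

Lemma measurable_mix_factor d (T : measurableType d) (om r z a sg z' : T -> K)
    (p : K) :
  measurable_fun setT om ->
  measurable_fun setT r -> measurable_fun setT z -> measurable_fun setT a ->
  measurable_fun setT sg -> measurable_fun setT z' ->
  measurable_fun setT
    (fun w => mix_factor (om w) p (r w) (z w) (a w) (sg w) (z' w)).
Proof.
move=> mom mr mz ma msg mz'; apply: emeasurable_funD.
  by apply/measurable_EFinP; exact: measurable_funB.
apply: emeasurable_funM; first exact/measurable_EFinP.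
apply: emeasurable_funD; apply: measurable_funeM.
  exact: measurable_mix_ratio.
by apply/measurable_EFinP; exact: measurable_lik_ratio.
Qed.

Lemma mix_factor_ge0 (om p r z a sg z' : K) : 0 <= om <= 1 -> 0 <= p <= 1 ->
  (0 <= mix_factor om p r z a sg z')%E.
Proof.
move=> /andP[om0 om1] /andP[p0 p1].
rewrite adde_ge0 ?mule_ge0 ?adde_ge0 ?mule_ge0 ?mix_ratio_ge0 ?lee_fin ?subr_ge0//.
exact: expR_ge0.
Qed.

(** Convexity is used twice, the constant 1 being the exponential of 0. This is what turns the
    discount from a mixing weight into a coefficient of the exponent. *)
Lemma expR_convex_le (om p A B : K) : 0 <= om <= 1 -> 0 <= p <= 1 ->
  expR (om * (p * A + (1 - p) * B)) <=
  1 - om + om * (p * expR A + (1 - p) * expR B).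
Proof.
have conv (t u v : K) : 0 <= t <= 1 ->
    expR (t * u + (1 - t) * v) <= t * expR u + (1 - t) * expR v.
  move=> /andP[t0 t1]; set w := t * u + (1 - t) * v.
  have tan x : expR w * (1 + (x - w)) <= expR x.
    have -> : expR x = expR w * expR (x - w) by rewrite -expRD; congr expR; ring.
    by rewrite ler_wpM2l ?expR_ge0// expR_ge1Dx.
  have h1 : t * (expR w * (1 + (u - w))) <= t * expR u by rewrite ler_wpM2l.
  have h2 : (1 - t) * (expR w * (1 + (v - w))) <= (1 - t) * expR v.
    by rewrite ler_wpM2l ?subr_ge0.
  apply: le_trans (lerD h1 h2); rewrite le_eqVlt; apply/orP; left; apply/eqP.
  by rewrite [in LHS](_ : expR w = expR w * (1 + (w - w))) ?subrr ?addr0 ?mulr1// /w; ring.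
move=> om01 p01; have := conv om (p * A + (1 - p) * B) 0 om01.
rewrite mulr0 addr0 expR0 mulr1 => /le_trans; apply.
rewrite addrC lerD2l ler_wpM2l//; last exact: conv.
by case/andP: om01.
Qed.

Lemma mix_factor_ge (om p r z a sg z' A : K) : 0 <= om <= 1 -> 0 <= p <= 1 ->
  ((expR A)%:E <= mix_ratio r z a sg)%E ->
  ((expR (om * (p * A + (1 - p) * ((r * (z' - z) - (m z' - m z)) / g))))%:E
     <= mix_factor om p r z a sg z')%E.
Proof.
move=> om01 p01 Ale.
have /andP[om0 om1] := om01. have /andP[p0 p1] := p01.
apply: (@le_trans _ _ ((1 - om)%:E + om%:E * (p%:E * (expR A)%:E
  + (1 - p)%:E * (lik_ratio r z z')%:E))%E).
  by rewrite -!(EFinM, EFinD) lee_fin; exact: expR_convex_le.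
rewrite leeD2l// lee_wpmul2l ?lee_fin// leeD2r//.
by rewrite lee_wpmul2l ?lee_fin.
Qed.

Lemma mix_ratio_gauss (m1 m2 m3 : K -> K) (R r z a sg e W : K) :
  0 < R -> 0 < g -> 0 <= sg ->
  (forall z : K, is_derive z 1 m (m1 z)) ->
  (forall z : K, is_derive z 1 m1 (m2 z)) ->
  (forall z : K, is_derive z 1 m2 (m3 z)) ->
  (forall z, `|m3 z| <= R * m2 z) ->
  (R * sg) ^+ 2 <= 7 / 32 ->
  W = m2 (a + sg * e) * sg ^+ 2 / g ->
  ((expR ((m z - r * z) / g - (m (a + sg * e) - r * (a + sg * e)) / g
       - e ^+ 2 / 2 - 2 * ln (1 + W)))%:E <= mix_ratio r z a sg)%E.
Proof.
move=> R0 g0 sg0 dm dm1 dm2 sc Rsg WE.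
have mm : measurable_fun setT m by exact: continuous_measurable_fun.
have -> : mix_ratio r z a sg = ((expR ((m z - r * z) / g))%:E *
   \int[leb]_x (expR (- (m (a + sg * x) - r * (a + sg * x)) / g)
                  * normal_pdf 0 1 x)%:E)%E.
  rewrite -ge0_integralZl//=; last 2 first.
  - apply/measurable_EFinP; apply: measurable_funM; last exact: measurable_normal_pdf.
    apply: measurableT_comp => //; apply: measurable_funM => //.
    apply: measurableT_comp => //.
    have ml : measurable_fun setT (fun x : measurableTypeR K => a + sg * x).
      by apply: measurable_funD => //; exact: measurable_funM.
    apply: measurable_funB; first exact: (measurableT_comp mm ml).
    exact: measurable_funM.
  - by move=> x _; rewrite lee_fin mulr_ge0 ?expR_ge0 ?normal_pdf_ge0.
  apply: eq_integral => x _; rewrite -EFinM mulrA -expRD /lik_ratio.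
  by congr ((expR _ * _)%:E); ring.
have E0 : (0 <= (expR ((m z - r * z) / g))%:E)%E by rewrite lee_fin expR_ge0.
have := lee_wpmul2l E0 (gaussian_mixture_ge r R0 g0 sg0 dm dm1 dm2 sc Rsg WE).
apply: le_trans; rewrite -EFinM -expRD lee_fin ler_expR.
by rewrite le_eqVlt; apply/orP; left; apply/eqP; ring.
Qed.

Let mix_factorM (u A B : \bar K) (om p : K) : (0 <= u)%E -> (0 <= A)%E ->
  (0 <= B)%E -> 0 <= om <= 1 -> 0 <= p <= 1 ->
  (u * ((1 - om)%:E + om%:E * (p%:E * A + (1 - p)%:E * B)) =
   u * (1 - om)%:E + (u * (om * p)%:E * A + u * (om * (1 - p))%:E * B))%E.
Proof.
move=> u0 A0 B0 /andP[om0 om1] /andP[p0 p1].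
have o0 : (0 <= om%:E)%E by rewrite lee_fin.
have o1 : (0 <= (1 - om)%:E)%E by rewrite lee_fin subr_ge0.
have q0 : (0 <= p%:E)%E by rewrite lee_fin.
have q1 : (0 <= (1 - p)%:E)%E by rewrite lee_fin subr_ge0.
have pA := mule_ge0 q0 A0. have pB := mule_ge0 q1 B0.
rewrite ge0_muleDr//; last by apply: mule_ge0 => //; exact: adde_ge0.
congr (_ + _)%E; rewrite (ge0_muleDr om%:E pA pB).
rewrite ge0_muleDr; [|exact: mule_ge0|exact: mule_ge0].
by rewrite !EFinM !muleA.
Qed.

(** The integrals over the sample space and over the mixture variable are exchanged: for each fixed
    [x] the alternative [a + sg * x] is known from the past, so [LR] applies under the integral. *)
Lemma mix_factor_step d (T : measurableType d) (P : probability T K)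
    (X : set (set T)) (om r z a sg z' : T -> K) (p : K) :
  X `<=` measurable -> 0 <= p <= 1 -> (forall w, 0 <= om w <= 1) ->
  measurable_fun setT r ->
  measurable_fun setT (z : g_sigma_algebraType X -> K) ->
  measurable_fun setT (om : g_sigma_algebraType X -> K) ->
  measurable_fun setT (a : g_sigma_algebraType X -> K) ->
  measurable_fun setT (sg : g_sigma_algebraType X -> K) ->
  measurable_fun setT (z' : g_sigma_algebraType X -> K) ->
  (forall (D : T -> K) (U : T -> \bar K),
    measurable_fun setT (D : g_sigma_algebraType X -> K) ->
    measurable_fun setT (U : g_sigma_algebraType X -> \bar K) ->
    (forall w, 0 <= U w)%E ->
    (\int[P]_w (U w * (expR ((r w * D w - (m (z w + D w) - m (z w))) / g))%:E) <=
     \int[P]_w U w)%E) ->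
  forall U : T -> \bar K, measurable_fun setT (U : g_sigma_algebraType X -> \bar K) ->
  (forall w, 0 <= U w)%E ->
  (\int[P]_w (U w * mix_factor (om w) p (r w) (z w) (a w) (sg w) (z' w)) <=
   \int[P]_w U w)%E.
Proof.
move=> XT /andP[p0 p1] om01 mr mz mom ma msg mz' LR U mU U0.
have om0 w : 0 <= om w by case/andP: (om01 w).
have om1 w : 0 <= 1 - om w by rewrite subr_ge0; case/andP: (om01 w).
have q0 : 0 <= 1 - p by rewrite subr_ge0.
have toT (f : T -> K) : measurable_fun setT (f : g_sigma_algebraType X -> K) ->
  measurable_fun setT f by exact: sub_measurable_fun.
have toTe (f : T -> \bar K) : measurable_fun setT (f : g_sigma_algebraType X -> \bar K) ->
  measurable_fun setT f by exact: sub_measurable_fun.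
have LR' (y : T -> K) (V : T -> \bar K) :
    measurable_fun setT (y : g_sigma_algebraType X -> K) ->
    measurable_fun setT (V : g_sigma_algebraType X -> \bar K) -> (forall w, 0 <= V w)%E ->
    (\int[P]_w (V w * (lik_ratio (r w) (z w) (y w))%:E) <= \int[P]_w V w)%E.
  move=> my mV V0; have := LR (fun w => y w - z w) V (measurable_funB my mz) mV V0.
  apply: le_trans; rewrite le_eqVlt; apply/orP; left; apply/eqP.
  by apply: eq_integral => w _; rewrite /lik_ratio [z w + _]addrC subrK.
pose V1 w : \bar K := (U w * (1 - om w)%:E)%E.
pose V2 w : \bar K := (U w * (om w * p)%:E)%E.
pose V3 w : \bar K := (U w * (om w * (1 - p))%:E)%E.
have mV1 : measurable_fun setT (V1 : g_sigma_algebraType X -> \bar K).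
  by apply: emeasurable_funM => //; apply/measurable_EFinP; exact: measurable_funB.
have mV2 : measurable_fun setT (V2 : g_sigma_algebraType X -> \bar K).
  by apply: emeasurable_funM => //; apply/measurable_EFinP; exact: measurable_funM.
have mV3 : measurable_fun setT (V3 : g_sigma_algebraType X -> \bar K).
  by apply: emeasurable_funM => //; apply/measurable_EFinP; exact: measurable_funM.
have V10 w : (0 <= V1 w)%E by rewrite mule_ge0 ?lee_fin.
have V20 w : (0 <= V2 w)%E by rewrite mule_ge0 ?lee_fin// mulr_ge0.
have V30 w : (0 <= V3 w)%E by rewrite mule_ge0 ?lee_fin// mulr_ge0.
have lr0 r' z'' y : (0 <= (lik_ratio r' z'' y)%:E)%E by rewrite lee_fin expR_ge0.
have UE w : (U w * mix_factor (om w) p (r w) (z w) (a w) (sg w) (z' w) =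
    V1 w + (V2 w * mix_ratio (r w) (z w) (a w) (sg w) +
      V3 w * (lik_ratio (r w) (z w) (z' w))%:E))%E.
  by apply: mix_factorM; rewrite ?p0 ?p1 ?mix_ratio_ge0.
under eq_integral do rewrite UE.
have mMix : measurable_fun setT (fun w => mix_ratio (r w) (z w) (a w) (sg w)).
  by apply: measurable_mix_ratio => //; exact: toT.
have mLz' : measurable_fun setT (fun w => (lik_ratio (r w) (z w) (z' w))%:E).
  by apply/measurable_EFinP; apply: measurable_lik_ratio => //; exact: toT.
have I2 : (\int[P]_w (V2 w * mix_ratio (r w) (z w) (a w) (sg w)) <= \int[P]_w V2 w)%E.
  pose F (q : T * measurableTypeR K) := (V2 q.1 * joint r z a sg q)%E.
  have mF : measurable_fun setT F.
    apply: emeasurable_funM; first by apply: measurableT_comp => //; exact: toTe.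
    by apply: measurable_joint => //; exact: toT.
  have F0 q : (0 <= F q)%E by rewrite mule_ge0// joint_ge0.
  rewrite (_ : (\int[P]_w _)%E = (\int[P]_w \int[leb]_x F (w, x))%E); last first.
    apply: eq_integral => w _.
    have mj : measurable_fun setT (fun x : measurableTypeR K => joint r z a sg (w, x)).
      apply: measurableT_comp; last exact: measurable_pair1.
      by apply: measurable_joint => //; exact: toT.
    have j0 (x : measurableTypeR K) : setT x -> (0 <= joint r z a sg (w, x))%E.
      by move=> _; exact: joint_ge0.
    exact/esym/(ge0_integralZl leb measurableT mj j0 (V20 w)).
  rewrite (@fubini_tonelli _ _ _ _ _ P leb F mF F0).
  have mpdf : measurable_fun setT (fun x : measurableTypeR K => (normal_pdf 0 1 x : K)%:E).
    by apply/measurable_EFinP; exact: measurable_normal_pdf.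
  have pdf0 (x : K) : (0 <= (normal_pdf 0 1 x)%:E)%E by rewrite lee_fin normal_pdf_ge0.
  have IV20 : (0 <= \int[P]_w V2 w)%E by apply: integral_ge0 => w _; exact: V20.
  have -> : (\int[P]_w V2 w = \int[leb]_x ((\int[P]_w V2 w) * (normal_pdf 0 1 x)%:E))%E.
    rewrite (ge0_integralZl leb measurableT mpdf (fun x _ => pdf0 x) IV20).
    by rewrite integral_normal_pdf mule1.
  have FE x : (\int[P]_w F (w, x) =
    (\int[P]_w (V2 w * (lik_ratio (r w) (z w) (a w + sg w * x))%:E)) * (normal_pdf 0 1 x)%:E)%E.
    have ma' : measurable_fun setT (fun w => V2 w * (lik_ratio (r w) (z w) (a w + sg w * x))%:E)%E.
      apply: emeasurable_funM; first exact: toTe.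
      apply/measurable_EFinP; apply: measurable_lik_ratio => //; first exact: toT.
      by apply: measurable_funD; [exact: toT|apply: measurable_funM => //; exact: toT].
    have a0 w : setT w -> (0 <= V2 w * (lik_ratio (r w) (z w) (a w + sg w * x))%:E)%E.
      by move=> _; rewrite mule_ge0.
    rewrite muleC -(ge0_integralZl P measurableT ma' a0 (pdf0 x)).
    by apply: eq_integral => w _; rewrite /F /joint EFinM muleA muleC.
  apply: ge0_le_integral => //.
  - by move=> x _; apply: integral_ge0 => w _.
  - exact: measurable_fun_fubini_tonelli_G.
  - exact: emeasurable_funM.
  move=> x _; rewrite FE lee_wpmul2r//; apply: LR' => //.
  by apply: measurable_funD => //; exact: measurable_funM.
have I3 := LR' z' V3 mz' mV3 V30.
have mT1 := toTe _ mV1. have mT2 := toTe _ mV2. have mT3 := toTe _ mV3.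
have mB2 : measurable_fun setT (fun w => V2 w * mix_ratio (r w) (z w) (a w) (sg w))%E.
  exact: emeasurable_funM.
have mB3 : measurable_fun setT (fun w => V3 w * (lik_ratio (r w) (z w) (z' w))%:E)%E.
  exact: emeasurable_funM.
have B20 w : setT w -> (0 <= V2 w * mix_ratio (r w) (z w) (a w) (sg w))%E.
  by move=> _; rewrite mule_ge0// mix_ratio_ge0.
have B30 w : setT w -> (0 <= V3 w * (lik_ratio (r w) (z w) (z' w))%:E)%E.
  by move=> _; rewrite mule_ge0.
rewrite (ge0_integralD P measurableT (fun w _ => V10 w) mT1
  (fun w wT => adde_ge0 (B20 w wT) (B30 w wT)) (emeasurable_funD mB2 mB3)).
rewrite (ge0_integralD P measurableT B20 mB2 B30 mB3).
apply: (@le_trans _ _ (\int[P]_w V1 w + (\int[P]_w V2 w + \int[P]_w V3 w))%E).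
  by rewrite leeD2l// leeD.
rewrite -(ge0_integralD P measurableT (fun w _ => V20 w) mT2 (fun w _ => V30 w) mT3).
rewrite -(ge0_integralD P measurableT (fun w _ => V10 w) mT1
  (fun w _ => adde_ge0 (V20 w) (V30 w)) (emeasurable_funD mT2 mT3)).
rewrite le_eqVlt; apply/orP; left; apply/eqP; apply: eq_integral => w _.
have e1 : (0 <= (1 - om w)%:E)%E by rewrite lee_fin.
have e2 : (0 <= (om w * p)%:E)%E by rewrite lee_fin mulr_ge0.
have e3 : (0 <= (om w * (1 - p))%:E)%E by rewrite lee_fin mulr_ge0.
rewrite /V1 /V2 /V3 -(ge0_muleDr _ e2 e3) -(ge0_muleDr _ e1 (adde_ge0 e2 e3)).
have -> : ((1 - om w)%:E + ((om w * p)%:E + (om w * (1 - p))%:E))%E = 1%E.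
  by rewrite -!EFinD; congr (_%:E); ring.
by rewrite mule1.
Qed.

(** The product over the rounds up to [n] is known to the sigma-algebra of round [n.+1], so it can
    serve as the weight [U] when the factor of that round is added. *)
Lemma mix_factor_prod_le1 d (T : measurableType d) (P : probability T K)
    (X : nat -> set (set T)) (om r z a sg z' : nat -> T -> K) (p : K) (N : nat) :
  0 <= p <= 1 -> (forall s w, 0 <= om s w <= 1) ->
  (forall s, (1 <= s <= N)%N -> X s `<=` measurable) ->
  (forall s, (1 <= s < N)%N -> <<s X s >> `<=` <<s X s.+1 >>) ->
  (forall s, (1 <= s < N)%N -> measurable_fun setT (r s : g_sigma_algebraType (X s.+1) -> K)) ->
  (forall s, (1 <= s < N)%N -> measurable_fun setT (r s)) ->
  (forall s, (1 <= s < N)%N -> measurable_fun setT (z s : g_sigma_algebraType (X s) -> K)) ->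
  (forall s, (1 <= s < N)%N -> measurable_fun setT (om s : g_sigma_algebraType (X s) -> K)) ->
  (forall s, (1 <= s < N)%N -> measurable_fun setT (a s : g_sigma_algebraType (X s) -> K)) ->
  (forall s, (1 <= s < N)%N -> measurable_fun setT (sg s : g_sigma_algebraType (X s) -> K)) ->
  (forall s, (1 <= s < N)%N -> measurable_fun setT (z' s : g_sigma_algebraType (X s) -> K)) ->
  (forall s, (1 <= s < N)%N -> forall (D : T -> K) (U : T -> \bar K),
    measurable_fun setT (D : g_sigma_algebraType (X s) -> K) ->
    measurable_fun setT (U : g_sigma_algebraType (X s) -> \bar K) ->
    (forall w, 0 <= U w)%E ->
    (\int[P]_w (U w * (expR ((r s w * D w - (m (z s w + D w) - m (z s w))) / g))%:E) <=
     \int[P]_w U w)%E) ->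
  forall n, (n < N)%N ->
  let U w := (\big[*%E/1%E]_(1 <= s < n.+1)
      mix_factor (om s w) p (r s w) (z s w) (a s w) (sg s w) (z' s w))%E in
  [/\ measurable_fun setT (U : g_sigma_algebraType (X n.+1) -> \bar K),
      (forall w, 0 <= U w)%E & (\int[P]_w U w <= 1)%E].
Proof.
move=> p01 om01 XT XS mrS mr mz mom ma msg mz' LR; elim=> [|n IH] nN U.
  have UE : U = cst 1%E by apply/funext => w; rewrite /U big_geq.
  rewrite UE; split; [exact: measurable_cst|by move=> w; rewrite lee01|].
  by rewrite integral_cst//= mul1e probability_setT.
have nN' : (n < N)%N by rewrite ltnW.
have [mU U0 IU] := IH nN'.
have n1N : (1 <= n.+1 < N)%N by [].
have UE w : U w = ((\big[*%E/1%E]_(1 <= s < n.+1)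
      mix_factor (om s w) p (r s w) (z s w) (a s w) (sg s w) (z' s w)) *
      mix_factor (om n.+1 w) p (r n.+1 w) (z n.+1 w) (a n.+1 w) (sg n.+1 w) (z' n.+1 w))%E.
  by rewrite /U big_nat_recr.
have lift d' (Y : measurableType d') (f : T -> Y) :
    measurable_fun setT (f : g_sigma_algebraType (X n.+1) -> Y) ->
    measurable_fun setT (f : g_sigma_algebraType (X n.+2) -> Y).
  by move=> mf _ B mB; apply: (XS _ n1N); exact: mf.
split.
- rewrite (funext UE); apply: emeasurable_funM; first exact: lift.
  apply: measurable_mix_factor.
  + by apply: lift; exact: mom.
  + exact: mrS.
  + by apply: lift; exact: mz.
  + by apply: lift; exact: ma.
  + by apply: lift; exact: msg.
  + by apply: lift; exact: mz'.
- by move=> w; rewrite UE mule_ge0// mix_factor_ge0.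
apply: le_trans IU; rewrite (eq_integral _ _ (fun w _ => UE w)).
apply: (mix_factor_step (XT _ _) p01 (om01 n.+1) (mr _ n1N) (mz _ n1N)
  (mom _ n1N) (ma _ n1N) (msg _ n1N) (mz' _ n1N) (LR _ n1N) mU U0).
by rewrite /= ltnW.
Qed.

End MixtureFactor.

(** * Linear algebra *)

Section LinearAlgebra.
Context {K : realType}.

Definition qf n (M : 'M[K]_n) (x : 'cV[K]_n) : K := (x^T *m M *m x) 0 0.

Lemma dotvE n (x y : 'cV[K]_n) : dotv x y = \sum_i x i 0 * y i 0.
Proof. by rewrite /dotv mxE; apply: eq_bigr => i _; rewrite mxE. Qed.

Lemma dotvC n (x y : 'cV[K]_n) : dotv x y = dotv y x.
Proof. by rewrite !dotvE; apply: eq_bigr => i _; rewrite mulrC. Qed.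

Lemma dotvDr n (x y z : 'cV[K]_n) : dotv x (y + z) = dotv x y + dotv x z.
Proof. by rewrite /dotv mulmxDr mxE. Qed.

Lemma dotvZr n (a : K) (x y : 'cV[K]_n) : dotv x (a *: y) = a * dotv x y.
Proof. by rewrite /dotv -scalemxAr mxE. Qed.

Lemma dotvNr n (x y : 'cV[K]_n) : dotv x (- y) = - dotv x y.
Proof. by rewrite /dotv mulmxN mxE. Qed.

Lemma dotvBr n (x y z : 'cV[K]_n) : dotv x (y - z) = dotv x y - dotv x z.
Proof. by rewrite dotvDr dotvNr. Qed.

Lemma dotvDl n (x y z : 'cV[K]_n) : dotv (x + y) z = dotv x z + dotv y z.
Proof. by rewrite dotvC dotvDr !(dotvC z). Qed.

Lemma dotvZl n (a : K) (x y : 'cV[K]_n) : dotv (a *: x) y = a * dotv x y.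
Proof. by rewrite dotvC dotvZr dotvC. Qed.

Lemma dotv_ge0 n (x : 'cV[K]_n) : 0 <= dotv x x.
Proof. by rewrite dotvE sumr_ge0// => i _; rewrite -expr2 sqr_ge0. Qed.

Lemma dotv_gt0 n (x : 'cV[K]_n) : x != 0 -> 0 < dotv x x.
Proof.
move=> x0; rewrite lt_neqAle dotv_ge0 andbT eq_sym.
apply: contra x0; rewrite dotvE psumr_eq0; last by move=> i _; rewrite -expr2 sqr_ge0.
move=> /allP h; apply/eqP/matrixP => i j; rewrite ord1 mxE.
by have := h i (mem_index_enum _); rewrite mulf_eq0 orbb => /eqP.
Qed.

Lemma dotv_mx n (M : 'M[K]_n) (x y : 'cV[K]_n) : M^T = M ->
  dotv x (M *m y) = dotv (M *m x) y.
Proof. by move=> sM; rewrite /dotv trmx_mul sM mulmxA. Qed.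

Lemma qfE n (M : 'M[K]_n) (x : 'cV[K]_n) : qf M x = dotv x (M *m x).
Proof. by rewrite /qf /dotv mulmxA. Qed.

Lemma dotv0r n (x : 'cV[K]_n) : dotv x 0 = 0.
Proof. by rewrite /dotv mulmx0 mxE. Qed.

Lemma qf0 n (M : 'M[K]_n) : qf M 0 = 0.
Proof. by rewrite qfE mulmx0 dotv0r. Qed.

Lemma qfD n (M N : 'M[K]_n) x : qf (M + N) x = qf M x + qf N x.
Proof. by rewrite !qfE mulmxDl dotvDr. Qed.

Lemma qfZ n a (M : 'M[K]_n) x : qf (a *: M) x = a * qf M x.
Proof. by rewrite !qfE -scalemxAl dotvZr. Qed.

Lemma qf_scalar n (a : K) (x : 'cV[K]_n) : qf a%:M x = a * dotv x x.
Proof. by rewrite qfE mul_scalar_mx dotvZr. Qed.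

Lemma qf_rank1 n (x y : 'cV[K]_n) : qf (x *m x^T) y = dotv x y ^+ 2.
Proof.
rewrite qfE -mulmxA (mx11_scalar (x^T *m y)) mul_mx_scalar dotvZr.
by rewrite (dotvC y) expr2.
Qed.

Lemma qfN n (M : 'M[K]_n) x : qf M (- x) = qf M x.
Proof. by rewrite !qfE mulmxN dotvNr dotvC dotvNr opprK dotvC. Qed.

Lemma qf_add n (M : 'M[K]_n) x y : M^T = M ->
  qf M (x + y) = qf M x + 2 * dotv x (M *m y) + qf M y.
Proof.
move=> sM; rewrite !qfE mulmxDr !dotvDr !dotvDl.
by rewrite (dotvC y (M *m x)) -(dotv_mx x y sM); ring.
Qed.

Lemma mxnorm_ge0 n (M : 'M[K]_n) x : 0 <= mxnorm M x.
Proof. exact: sqrtr_ge0. Qed.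

Lemma sqr_mxnorm n (M : 'M[K]_n) x : 0 <= qf M x -> mxnorm M x ^+ 2 = qf M x.
Proof. by move=> h; rewrite /mxnorm sqr_sqrtr. Qed.

Lemma sqr_l2norm n (x : 'cV[K]_n) : l2norm x ^+ 2 = dotv x x.
Proof.
rewrite /l2norm sqr_sqrtr ?dotvE//.
  by rewrite sumr_ge0// => i _; rewrite sqr_ge0.
Qed.

Lemma l2norm_ge0 n (x : 'cV[K]_n) : 0 <= l2norm x.
Proof. exact: sqrtr_ge0. Qed.

Lemma l2normE n (x : 'cV[K]_n) : l2norm x = Num.sqrt (dotv x x).
Proof. by rewrite -sqr_l2norm sqrtr_sqr ger0_norm ?l2norm_ge0. Qed.

Definition spd n (M : 'M[K]_n) := M^T = M /\ forall x, x != 0 -> 0 < qf M x.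

Lemma spd_ge0 n (M : 'M[K]_n) x : spd M -> 0 <= qf M x.
Proof.
move=> [_ h]; have [->|/h/ltW//] := eqVneq x 0.
by rewrite qf0.
Qed.

Lemma spd_unit n (M : 'M[K]_n) : spd M -> M \in unitmx.
Proof.
move=> [sM h]; rewrite unitmxE unitfE; apply/negP => /det0P[v v0 vM].
have vT0 : v^T != 0 by apply: contra v0 => /eqP/(congr1 trmx); rewrite trmxK trmx0 => ->.
by have := h _ vT0; rewrite /qf trmxK vM mul0mx mxE ltxx.
Qed.

Lemma trmx_inv_spd n (M : 'M[K]_n) : spd M -> (invmx M)^T = invmx M.
Proof. by move=> [sM _]; rewrite trmx_inv sM. Qed.

Lemma spd_inv n (M : 'M[K]_n) : spd M -> spd (invmx M).
Proof.
move=> hM; have uM := spd_unit hM; have [sM h] := hM.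
split; first exact: trmx_inv_spd.
move=> x x0; pose y := invmx M *m x.
have xE : x = M *m y by rewrite mulKVmx.
have y0 : y != 0 by apply: contra x0 => /eqP y0; rewrite xE y0 mulmx0.
by have := h _ y0; rewrite !qfE -xE dotvC.
Qed.

(** Completing the square in [invmx M *m x - t *: y]. Optimizing [t] gives Cauchy-Schwarz, and
    [t = 1] gives the antitonicity of inversion. *)
Lemma dotv_le_qf n (M : 'M[K]_n) (x y : 'cV[K]_n) (t : K) : spd M ->
  2 * t * dotv x y - t ^+ 2 * qf M y <= qf (invmx M) x.
Proof.
move=> hM; have uM := spd_unit hM; have [sM _] := hM.
have := spd_ge0 (invmx M *m x - t *: y) hM.
rewrite -scaleNr qf_add// !qfE -!scalemxAr !dotvZr mulKVmx//.
rewrite dotvZl (dotvC (invmx M *m x) x) (dotv_mx (invmx M *m x) y sM) mulKVmx//.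
move: (dotv x _) (dotv x y) (dotv y _) => *; lra.
Qed.

Lemma cauchy_schwarz_qf n (M : 'M[K]_n) (x y : 'cV[K]_n) : spd M ->
  dotv x y ^+ 2 <= qf (invmx M) x * qf M y.
Proof.
move=> hM; have [->|y0] := eqVneq y 0.
  by rewrite qf0 dotv0r expr0n mulr0.
have q0 : 0 < qf M y by have [_] := hM; apply.
have := dotv_le_qf x y (dotv x y / qf M y) hM.
rewrite (_ : _ - _ = dotv x y ^+ 2 / qf M y).
  by rewrite ler_pdivrMr.
by field; rewrite gt_eqF.
Qed.

(** Inversion reverses the order because [qf (invmx N) x] is the maximum over [y] of
    [2 * dotv x y - qf N y], which decreases when [N] grows. *)
Lemma qf_inv_anti n (M N : 'M[K]_n) x : spd M -> spd N ->
  (forall y, qf M y <= qf N y) -> qf (invmx N) x <= qf (invmx M) x.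
Proof.
move=> hM hN MN; have uN := spd_unit hN.
pose y := invmx N *m x.
have := dotv_le_qf x y 1 hM; apply: le_trans.
have -> : qf (invmx N) x = 2 * 1 * dotv x y - 1 ^+ 2 * qf N y.
  by rewrite !qfE /y mulKVmx// (dotvC (invmx N *m x)); ring.
by rewrite lerD2l expr1n !mul1r lerN2.
Qed.

Lemma cauchy_schwarz n (x y : 'cV[K]_n) : `|dotv x y| <= l2norm x * l2norm y.
Proof.
have spd1 : spd (1%:M : 'M[K]_n).
  by split; [rewrite trmx1|move=> z z0; rewrite qf_scalar mul1r dotv_gt0].
have := cauchy_schwarz_qf x y spd1; rewrite invmx1 !qf_scalar !mul1r.
rewrite -!sqr_l2norm -exprMn -[dotv x y ^+ 2]real_normK ?num_real//.
by rewrite ler_sqr ?nnegrE ?mulr_ge0 ?l2norm_ge0.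
Qed.

Lemma mxnorm_dotv n (M : 'M[K]_n) (x y : 'cV[K]_n) : spd M ->
  `|dotv x y| <= mxnorm (invmx M) x * mxnorm M y.
Proof.
move=> hM; have := cauchy_schwarz_qf x y hM.
rewrite -sqr_mxnorm; last exact/spd_ge0/spd_inv.
rewrite -[qf M y]sqr_mxnorm; last exact: spd_ge0.
rewrite -exprMn -[dotv x y ^+ 2]real_normK ?num_real//.
by rewrite ler_sqr ?nnegrE ?mulr_ge0 ?mxnorm_ge0.
Qed.

Lemma l2normD n (x y : 'cV[K]_n) : l2norm (x + y) <= l2norm x + l2norm y.
Proof.
rewrite -ler_sqr ?nnegrE ?addr_ge0 ?l2norm_ge0//.
rewrite sqr_l2norm !dotvDr !dotvDl sqrrD !sqr_l2norm (dotvC y x).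
have := le_trans (ler_norm _) (cauchy_schwarz x y).
by move=> h; lra.
Qed.

Lemma l2normN n (x : 'cV[K]_n) : l2norm (- x) = l2norm x.
Proof. by rewrite !l2normE dotvNr dotvC dotvNr opprK. Qed.

Lemma l2normB n (x y : 'cV[K]_n) : l2norm (x - y) <= l2norm x + l2norm y.
Proof. by rewrite (le_trans (l2normD _ _))// l2normN. Qed.

End LinearAlgebra.

(** * Determinants of positive definite matrices *)

Section LogDet.
Context {K : realType}.

Lemma qf_congr n p (L : 'M[K]_(p, n)) (M : 'M[K]_n) x :
  qf (L *m M *m L^T) x = qf M (L^T *m x).
Proof. by rewrite /qf trmx_mul trmxK !mulmxA. Qed.

Lemma spd_congr n (L M : 'M[K]_n) : \det L != 0 -> spd M -> spd (L *m M *m L^T).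
Proof.
move=> L0 [sM hM]; split; first by rewrite !trmx_mul trmxK sM mulmxA.
move=> x x0; rewrite qf_congr; apply: hM; apply: contra x0 => /eqP Lx.
have uL : L^T \in unitmx by rewrite unitmx_tr unitmxE unitfE.
by rewrite -(mulKmx uL x) Lx mulmx0.
Qed.

(* Symmetric Gaussian elimination: every pivot is a diagonal entry of a Schur
   complement, hence at most the original diagonal entry. *)
Lemma spd_diagonalize n (M : 'M[K]_n) : spd M ->
  exists L : 'M[K]_n, exists v : 'rV[K]_n,
  [/\ \det L = 1, L *m M *m L^T = diag_mx v & forall i, 0 < v 0 i <= M i i].
Proof.
elim: n M => [|n IH] M hM.
  by exists 1%:M, 0; split; [exact: det1|apply/matrixP; case|case].
pose M' : 'M[K]_(1 + n) := M.
have hM' : spd M' by [].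
pose a := ulsubmx M'; pose b := dlsubmx M'; pose N := drsubmx M'.
have [sM hpos] := hM'.
have ur : ursubmx M' = b^T by rewrite /b trmx_dlsub sM.
have ME : M' = block_mx a b^T b N by rewrite -ur submxK.
pose al := a 0 0.
have aE : a = al%:M by exact: mx11_scalar.
have al0 : 0 < al.
  have d0 : col_mx 1%:M 0 != 0 :> 'cV[K]_(1 + n).
    apply/eqP => /(congr1 usubmx); rewrite col_mxKu => /matrixP/(_ 0 0).
    by rewrite !mxE => /eqP; rewrite oner_eq0.
  have := hpos _ d0; rewrite ME /qf tr_col_mx mul_row_block mul_row_col trmx1 trmx0.
  by rewrite !mul0mx !mulmx0 !addr0 mul1mx mulmx1.
pose L1 : 'M[K]_(1 + n) := block_mx 1%:M 0 (- al^-1 *: b) 1%:M.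
pose S := N - al^-1 *: (b *m b^T).
have L1M : L1 *m M' *m L1^T = block_mx a 0 0 S.
  rewrite ME /L1 tr_block_mx !trmx1 trmx0 !mulmx_block.
  rewrite !mul1mx !mul0mx !mulmx1 !mulmx0 ?addr0 ?add0r.
  have -> : - al^-1 *: b *m a + b = 0.
    by rewrite aE mul_mx_scalar scalerA mulrN divff ?gt_eqF// scaleN1r addNr.
  rewrite mul0mx add0r aE mul_scalar_mx linearZ/= scalerA mulrN divff ?gt_eqF// scaleN1r addNr.
  congr block_mx.
  by rewrite -scalemxAl scaleNr addrC.
have detL1 : \det L1 = 1 by rewrite det_lblock !det1 mulr1.
have hD : spd (block_mx a 0 0 S : 'M[K]_(1 + n)).
  by rewrite -L1M; apply: spd_congr => //; rewrite detL1 oner_eq0.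
have hS : spd S.
  split.
    have [sD _] := hD; move: sD; rewrite tr_block_mx => /eq_block_mx[_ _ _ //].
  move=> y y0; have [_ /(_ (col_mx 0 y))] := hD.
  have -> : qf (block_mx a 0 0 S : 'M[K]_(1 + n)) (col_mx 0 y) = qf S y.
    rewrite /qf tr_col_mx mul_row_block mul_row_col trmx0.
    by rewrite !mul0mx !mulmx0 !add0r.
  apply; apply: contra y0 => /eqP/(congr1 dsubmx); rewrite col_mxKd => ->.
  by apply/eqP/matrixP => i j; rewrite !mxE.
have [L2 [v2 [detL2 L2S v2P]]] := IH S hS.
pose L3 : 'M[K]_(1 + n) := block_mx 1%:M 0 0 L2.
exists (L3 *m L1), (row_mx a v2); split.
- by rewrite det_mulmx detL1 mulr1 (@det_ublock _ 1 n) det1 detL2 mulr1.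
- transitivity (L3 *m (L1 *m M' *m L1^T) *m L3^T); first by rewrite trmx_mul !mulmxA.
  rewrite L1M /L3 tr_block_mx trmx1 !trmx0 !mulmx_block.
  rewrite !mul1mx !mul0mx !mulmx1 !mulmx0 ?addr0 ?add0r L2S.
  rewrite mul0mx; apply: etrans (esym (diag_mx_row a v2)); congr block_mx.
  by rewrite aE; apply/matrixP => i j; rewrite !mxE !ord1 !eqxx.
- move=> i; rewrite -[M]/M' ME; case: (@split_ordP 1 n i) => j ->.
    by have -> := row_mxEl a v2 0 j; have -> := block_mxEul a b^T b N j j; rewrite !ord1 lexx andbT.
  have -> := row_mxEr a v2 0 j; have -> := block_mxEdr a b^T b N j j; have /andP[-> /le_trans] := v2P j; apply.
  rewrite /S !mxE gerDl oppr_le0 big_ord1 !mxE mulr_ge0 ?invr_ge0 ?(ltW al0)//.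
  by rewrite -expr2 sqr_ge0.
Qed.

(** The identity [E] conjugates one block triangular matrix of size [1 + n] into another; comparing
    the products of their diagonal blocks gives the matrix determinant lemma. *)
Lemma det_rank1_add1 n (u v : 'cV[K]_n) : \det (1%:M + u *m v^T) = 1 + dotv v u.
Proof.
have E : block_mx 1%:M 0 u 1%:M *m block_mx 1%:M (- v^T) 0 (1%:M + u *m v^T) =
   block_mx (1%:M + v^T *m u) (- v^T) 0 1%:M *m block_mx 1%:M 0 u 1%:M :> 'M[K]_(1 + n).
  rewrite !mulmx_block !mul1mx !mul0mx !mulmx1 !mulmx0 ?addr0 ?add0r.
  by rewrite mulmxN addrCA addNr addr0 mulNmx addrK.
have := congr1 determinant E.
rewrite !det_mulmx !det_lblock !det_ublock !det1 !mul1r !mulr1 => ->.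
by rewrite det_mx11 /dotv !mxE eqxx mulr1n.
Qed.

Lemma det_rank1 n (A : 'M[K]_n) (w : K) (x : 'cV[K]_n) : spd A ->
  \det (A + w *: (x *m x^T)) = \det A * (1 + w * qf (invmx A) x).
Proof.
move=> hA; have uA := spd_unit hA.
have -> : A + w *: (x *m x^T) = A *m (1%:M + (w *: (invmx A *m x)) *m x^T).
  by rewrite mulmxDr mulmx1 -scalemxAl -scalemxAr !mulmxA mulmxV// mul1mx.
by rewrite det_mulmx det_rank1_add1 dotvZr -qfE.
Qed.

Lemma spd_det_gt0 n (M : 'M[K]_n) : spd M -> 0 < \det M.
Proof.
move=> /spd_diagonalize[L [v [dL LM vP]]].
have := congr1 determinant LM; rewrite !det_mulmx det_tr dL mul1r mulr1 det_diag => ->.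
by apply: prodr_gt0 => i _; case/andP: (vP i).
Qed.

(** Hadamard's inequality, read off from the pivots, followed by [x <= expR (x - 1)] on each
    diagonal entry. *)
Lemma spd_det_le_expR n (M : 'M[K]_n) : spd M -> \det M <= expR (\tr M - n%:R).
Proof.
move=> /spd_diagonalize[L [v [dL LM vP]]].
have := congr1 determinant LM; rewrite !det_mulmx det_tr dL mul1r mulr1 det_diag => ->.
have -> : \tr M - n%:R = \sum_(i < n) (M i i - 1).
  by rewrite /mxtrace big_split/= sumrN sumr_const card_ord.
rewrite expR_sum; apply: ler_prod => i _; have /andP[v0 vM] := vP i.
rewrite ltW//= (le_trans vM)//; have := expR_ge1Dx (M i i - 1).
by rewrite addrCA subrr addr0.
Qed.

Lemma spd_whiten n (M : 'M[K]_n) : spd M ->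
  exists C : 'M[K]_n, C *m M *m C^T = 1%:M.
Proof.
move=> /spd_diagonalize[L [v [dL LM vP]]].
pose D := diag_mx (\row_i (Num.sqrt (v 0 i))^-1).
exists (D *m L).
rewrite trmx_mul -!mulmxA (mulmxA L) (mulmxA (L *m M)) LM tr_diag_mx !mulmx_diag.
apply/matrixP => i j; rewrite !mxE; case: eqP => [->|]; rewrite ?mulr0n ?mulr1n//.
have /andP[v0 _] := vP j.
rewrite mulrCA -invfM -expr2 sqr_sqrtr ?(ltW v0)// mulfV// gt_eqF//.
Qed.

(** The tangent inequality at [N] of the concave function ln det, obtained by whitening [N]. Taken
    at a multiple of the identity it gives the trace bound, and at a convex combination it gives
    concavity. *)
Lemma ln_det_le n (N M : 'M[K]_n) : spd N -> spd M ->
  ln (\det M) <= ln (\det N) + \tr (M *m invmx N) - n%:R.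
Proof.
move=> hN hM; have [C CN] := spd_whiten hN.
have uC : C \in unitmx.
  by have /mulmx1_unit[] : C *m (N *m C^T) = 1%:M by rewrite mulmxA.
have C0 : \det C != 0 by rewrite -unitfE -unitmxE.
have invN : invmx N = C^T *m C.
  have uN := spd_unit hN.
  have uCT : C^T \in unitmx by rewrite unitmx_tr.
  have NE : N *m (C^T *m C) = 1%:M.
    have : C *m (N *m C^T) *m C = C by rewrite mulmxA CN mul1mx.
    move=> /(congr1 (mulmx (invmx C))).
    by rewrite -!mulmxA mulKmx// mulVmx.
  by rewrite -[LHS]mulmx1 -NE mulKmx.
have hCM := spd_congr C0 hM.
have := spd_det_le_expR hCM.
have -> : \tr (C *m M *m C^T) = \tr (M *m invmx N).
  by rewrite -mulmxA mxtrace_mulC invN mulmxA.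
have dCN : \det C * \det N * \det C = 1.
  by have := congr1 determinant CN; rewrite !det_mulmx det_tr det1.
have dM := spd_det_gt0 hM. have dN := spd_det_gt0 hN.
have -> : \det (C *m M *m C^T) = \det M / \det N.
  rewrite !det_mulmx det_tr; apply: (mulIf (lt0r_neq0 dN)).
  by rewrite divfK ?gt_eqF// -[RHS]mulr1 -dCN; ring.
rewrite -ler_ln ?posrE ?expR_gt0 ?divr_gt0// expRK ln_div ?posrE//.
by move=> h; lra.
Qed.

Lemma spd_scalar n (a : K) : 0 < a -> spd (a%:M : 'M[K]_n).
Proof.
move=> a0; split; first by rewrite tr_scalar_mx.
by move=> x x0; rewrite qf_scalar mulr_gt0// dotv_gt0.
Qed.

Lemma spd_trace_gt0 n (M : 'M[K]_n) : (0 < n)%N -> spd M -> 0 < \tr M.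
Proof.
move=> n0 hM; have [L [v [_ _ vP]]] := spd_diagonalize hM.
rewrite /mxtrace; case: n n0 M hM L v vP => // n _ M hM L v vP.
rewrite big_ord_recl ltr_wpDr ?sumr_ge0//.
  by move=> i _; have /andP[/ltW v0] := vP (lift ord0 i); exact: le_trans.
by have /andP[v0] := vP ord0; exact: lt_le_trans.
Qed.

Lemma ln_det_le_trace n (M : 'M[K]_n) : (0 < n)%N -> spd M ->
  ln (\det M) <= n%:R * ln (\tr M / n%:R).
Proof.
move=> n0 hM; have n0' : 0 < n%:R :> K by rewrite ltr0n.
pose c := \tr M / n%:R.
have tr0 := spd_trace_gt0 n0 hM.
have c0 : 0 < c by rewrite divr_gt0.
have := ln_det_le (spd_scalar n c0) hM.
rewrite det_scalar invmx_scalar mul_mx_scalar mxtraceZ lnXn//.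
have -> : c^-1 * \tr M = n%:R by rewrite /c invf_div divfK// gt_eqF.
by rewrite addrK mulr_natl.
Qed.

Lemma spd_comb n (A B : 'M[K]_n) (a b : K) : 0 <= a -> 0 < b -> spd A -> spd B ->
  spd (a *: A + b *: B).
Proof.
move=> a0 b0 hA [sB hB]; split.
  by rewrite linearD/= !linearZ/= sB; have [-> _] := hA.
move=> x x0; rewrite qfD !qfZ ltr_wpDl// ?mulr_ge0 ?spd_ge0//.
by rewrite mulr_gt0// hB.
Qed.

Lemma ln_det_concave n (A B : 'M[K]_n) (a : K) : 0 <= a < 1 -> spd A -> spd B ->
  a * ln (\det A) + (1 - a) * ln (\det B) <= ln (\det (a *: A + (1 - a) *: B)).
Proof.
move=> /andP[a0 a1] hA hB; have b0 : 0 < 1 - a by rewrite subr_gt0.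
have hC := spd_comb a0 b0 hA hB; set C := _ + _ in hC *.
have h1 := ler_wpM2l a0 (ln_det_le hC hA).
have h2 := ler_wpM2l (ltW b0) (ln_det_le hC hB).
have : a * \tr (A *m invmx C) + (1 - a) * \tr (B *m invmx C) = n%:R.
  rewrite -!mxtraceZ !scalemxAl -linearD/= -mulmxDl mulmxV ?mxtrace1//.
  exact: spd_unit.
move: h1 h2; rewrite !mulrDr !mulrN; set l := ln (\det C).
by move: (a * ln _) ((1 - a) * ln _) (a * \tr _) ((1 - a) * \tr _) => *; lra.
Qed.

End LogDet.

(** * The mirror descent step *)

Section GlbLoss.
Context {K : realType}.

Lemma derive_ridge n (F F1 : K -> K) (x th v : 'cV[K]_n) :
  (forall z : K, is_derive z 1 F (F1 z)) ->
  derive (fun u => F (dotv x u)) th v = F1 (dotv x th) * dotv x v.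
Proof.
move=> dF.
have [_ dG] := der_line (dotv x th) (dotv x v) 0 dF.
move: dG; rewrite mul0r addr0 mulrC => <-.
rewrite /derive.
apply: (congr1 (fun f : K -> K => lim (f t @[t --> (0 : K)^'])%classic)).
apply/funext => t /=.
by rewrite dotvDr dotvZr mul0r !addr0 /GRing.scale/= mulr1 (addrC (dotv x th)).
Qed.

Lemma dotv_delta n (x : 'cV[K]_n) i : dotv x (delta_mx i 0) = x i 0.
Proof.
rewrite dotvE (bigD1 i)//= mxE !eqxx mulr1 big1 ?addr0// => j ji.
by rewrite mxE (negbTE ji) mulr0.
Qed.

Section Loss.
Context (m m1 m2 : K -> K) (g : K).
Hypothesis dm : forall z : K, is_derive z 1 m (m1 z).
Hypothesis dm1 : forall z : K, is_derive z 1 m1 (m2 z).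

Let dloss r (z : K) : is_derive z 1 (fun z => (m z - r * z) / g) ((m1 z - r) / g).
Proof.
apply: der_eq (derM (derB (dm z) (derM (derC z r) (derX z))) (derC z g^-1)) _.
by ring.
Qed.

Lemma gradient_glb_loss n (x : 'cV[K]_n) r th :
  gradient (glb_loss m g x r) th = ((m1 (dotv x th) - r) / g) *: x.
Proof.
apply/matrixP => i j; rewrite !mxE ord1.
by rewrite (derive_ridge x th (delta_mx i 0) (dloss r)) dotv_delta.
Qed.

Lemma hessian_glb_loss n (x : 'cV[K]_n) r th :
  hessian (glb_loss m g x r) th = (m2 (dotv x th) / g) *: (x *m x^T).
Proof.
apply/matrixP => i j; rewrite !mxE big_ord1 !mxE.
rewrite (_ : (fun u => _) = fun u => (m1 (dotv x u) - r) / g * x j 0); last first.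
  by apply/funext => u; rewrite (derive_ridge x u (delta_mx j 0) (dloss r)) dotv_delta.
have dl (z : K) : is_derive z 1 (fun z => (m1 z - r) / g * x j 0) (m2 z / g * x j 0).
  apply: der_eq (derM (derM (derB (dm1 z) (derC z r)) (derC z g^-1)) (derC z (x j 0))) _.
  by ring.
by rewrite (derive_ridge x th (delta_mx i 0) dl) dotv_delta; ring.
Qed.

End Loss.

Lemma l2normZ n (a : K) (x : 'cV[K]_n) : l2norm (a *: x) = `|a| * l2norm x.
Proof.
rewrite !l2normE dotvZl dotvZr mulrA -expr2 sqrtrM ?sqr_ge0//.
by rewrite sqrtr_sqr.
Qed.

Lemma l2ball_convex n (S t : K) (u v : 'cV[K]_n) : l2ball S u -> l2ball S v ->
  0 <= t <= 1 -> l2ball S (u + t *: (v - u)).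
Proof.
rewrite /l2ball/= => uS vS /andP[t0 t1].
have -> : u + t *: (v - u) = (1 - t) *: u + t *: v.
  by rewrite scalerBr scalerBl scale1r addrCA [RHS]addrC addrCA addrC -addrA.
apply: le_trans (l2normD _ _) _; rewrite !l2normZ !ger0_norm ?subr_ge0//.
have -> : S = (1 - t) * S + t * S by ring.
by rewrite lerD// ler_wpM2l// subr_ge0.
Qed.

Lemma quad_argmin n (S c : K) (p th thp u : 'cV[K]_n) (M : 'M[K]_n) :
  M^T = M ->
  argmin (l2ball S) (fun u => c + dotv p (u - th) + 2^-1 * qf M (u - th)) thp ->
  l2ball S u ->
  0 <= dotv p (u - thp) + dotv (u - thp) (M *m (thp - th)).
Proof.
move=> sM [thpS hmin] uS; set d : 'cV[K]_n := u - thp; set e : 'cV[K]_n := thp - th.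
set G := dotv p d + _.
have hq (t : K) : 0 <= t <= 1 -> 0 <= t * G + t ^+ 2 / 2 * qf M d.
  move=> t01; have := hmin _ (l2ball_convex thpS uS t01).
  rewrite -/d (_ : thp + t *: d - th = t *: d + e); last first.
    by rewrite /e addrAC [RHS]addrC.
  rewrite -[thp - th]/e (qf_add (t *: d) e sM) (dotvDr p (t *: d)) (dotvZr t p) (dotvZl t d).
  have -> : qf M (t *: d) = t ^+ 2 * qf M d.
    by rewrite !qfE -scalemxAr dotvZl dotvZr mulrA -expr2.
  rewrite /G; move: (dotv p d) (dotv p e) (dotv d _) (qf M d) (qf M e).
  by move=> *; lra.
rewrite leNgt; apply/negP => G0.
have [q0|q0] := leP (qf M d) 0.
  have := hq 1; rewrite ler01 lexx => /(_ isT); rewrite expr1n; lra.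
(* For a negative slope [G], the quadratic correction at this [t] is at most half of the linear
   gain, so the objective would decrease along the segment. *)
pose t := Num.min 1 (- G / qf M d).
have t0 : 0 < t by rewrite lt_min ltr01 divr_gt0// oppr_gt0.
have t1 : t <= 1 by rewrite ge_min lexx.
have tq : t * qf M d <= - G.
  by rewrite -ler_pdivlMr// ge_min lexx orbT.
have := hq t; rewrite (ltW t0) t1 => /(_ isT).
have -> : t * G + t ^+ 2 / 2 * qf M d = t * (G + t * qf M d / 2) by field.
by rewrite pmulr_rge0//; lra.
Qed.

(** Strong convexity around the constrained minimizer, that is, uniqueness in quantitative form; it
    is what makes the iterates measurable. *)
Lemma quad_argmin_growth n (S c : K) (p th thp u : 'cV[K]_n) (M : 'M[K]_n) :
  M^T = M ->
  argmin (l2ball S) (fun u => c + dotv p (u - th) + 2^-1 * qf M (u - th)) thp ->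
  l2ball S u ->
  c + dotv p (thp - th) + 2^-1 * qf M (thp - th) + 2^-1 * qf M (u - thp) <=
  c + dotv p (u - th) + 2^-1 * qf M (u - th).
Proof.
move=> sM hmin uS; have := quad_argmin sM hmin uS.
have -> : u - th = (u - thp) + (thp - th) by rewrite addrA addrNK.
rewrite (qf_add (u - thp) _ sM) (dotvDr p (u - thp)).
move: (dotv p (u - thp)) (dotv p (thp - th)) (dotv (u - thp) _) (qf M (u - thp)) (qf M (thp - th)).
by move=> *; lra.
Qed.

Section OmdStep.
Context (m m1 m2 m3 : K -> K) (R S g k lam : K).
Hypothesis R0 : 0 < R.
Hypothesis S0 : 0 < S.
Hypothesis g0 : 0 < g.
Hypothesis k0 : 0 < k.
Hypothesis dm : forall z : K, is_derive z 1 m (m1 z).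
Hypothesis dm1 : forall z : K, is_derive z 1 m1 (m2 z).
Hypothesis dm2 : forall z : K, is_derive z 1 m2 (m3 z).
Hypothesis sc : forall z, `|m3 z| <= R * m2 z.
Hypothesis m2k : forall z : K, - S <= z <= S -> m2 z <= k.
Let eta := 1 + R * S.
Hypothesis lam_ge : 6 * eta * R * k * S / g <= lam.

Let eta0 : 0 < eta.
Proof. by rewrite /eta addr_gt0// mulr_gt0. Qed.

Let m20 z : 0 <= m2 z. Proof. exact: sc_ge0 R0 sc z. Qed.

Lemma dotv_ball n (x u : 'cV[K]_n) : l2norm x <= 1 -> l2ball S u ->
  - S <= dotv x u <= S.
Proof.
move=> x1 uS; rewrite -ler_norml (le_trans (cauchy_schwarz _ _))//.
by rewrite -[leRHS]mul1r ler_pM ?l2norm_ge0.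
Qed.

Definition omd_objective n (A : 'M[K]_n) (x : 'cV[K]_n) (r : K) (th u : 'cV[K]_n) :=
  quad_approx (glb_loss m g x r) th u + (2 * eta)^-1 * mxnorm A (u - th) ^+ 2.

Lemma omd_objectiveE n (A : 'M[K]_n) (x : 'cV[K]_n) (r : K) (th u : 'cV[K]_n) :
  spd A -> omd_objective A x r th u = glb_loss m g x r th
    + dotv (((m1 (dotv x th) - r) / g) *: x) (u - th)
    + 2^-1 * qf ((m2 (dotv x th) / g) *: (x *m x^T) + eta^-1 *: A) (u - th).
Proof.
move=> hA; rewrite /omd_objective /quad_approx (@gradient_glb_loss m m1 g dm).
have q0 : 0 <= qf ((m2 (dotv x th) / g) *: (x *m x^T)) (u - th).
  by rewrite qfZ qf_rank1 mulr_ge0 ?sqr_ge0// divr_ge0// ltW.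
rewrite (@hessian_glb_loss m m1 m2 g dm dm1) (sqr_mxnorm q0).
rewrite (sqr_mxnorm (spd_ge0 (u - th) hA)) qfD (qfZ eta^-1 A).
by field; rewrite gt_eqF.
Qed.

(** Optimality of [thp] speaks of the gradient model built at [th], while the comparison needs the
    gradient at [thp]. Their difference is a second-order Taylor remainder of the link, paid by one
    third of [qf A (thp - th)]; the other two thirds are kept for the mixture. *)
Lemma omd_step n (A : 'M[K]_n) (x : 'cV[K]_n) (r : K) (th thp u : 'cV[K]_n) :
  spd A -> (forall y, lam * dotv y y <= qf A y) -> l2norm x <= 1 ->
  l2ball S th -> l2ball S thp -> l2ball S u ->
  argmin (l2ball S) (omd_objective A x r th) thp ->
  qf (A + (m2 (dotv x thp) / g) *: (x *m x^T)) (thp - u) <=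
  qf A (th - u) + 2 * eta * (glb_loss m g x r u - glb_loss m g x r thp)
  - 2 / 3 * qf A (thp - th).
Proof.
move=> hA Alam x1 thS thpS uS hmin; have [sA _] := hA.
set a := dotv x th; set b := dotv x thp.
set d : 'cV[K]_n := u - thp; set e : 'cV[K]_n := thp - th.
pose M := (m2 a / g) *: (x *m x^T) + eta^-1 *: A.
have sM : M^T = M.
  by rewrite linearD/= !linearZ/= trmx_mul trmxK sA.
have hmin' : argmin (l2ball S) (fun u => glb_loss m g x r th
    + dotv (((m1 a - r) / g) *: x) (u - th) + 2^-1 * qf M (u - th)) thp.
  by have [h1 h2] := hmin; split=> // v vS; rewrite -!omd_objectiveE//; exact: h2.
have := quad_argmin sM hmin' uS.
rewrite -[u - thp]/d -[thp - th]/e.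
have ME : M *m e = (m2 a / g * dotv x e) *: x + eta^-1 *: (A *m e).
  rewrite mulmxDl -!scalemxAl -mulmxA (mx11_scalar (x^T *m e)) mul_mx_scalar.
  by rewrite scalerA.
rewrite ME (dotvDr d) (dotvZr _ d x) (dotvZr _ d (A *m e)) (dotvZl _ x d) (dotvC d x).
set s := dotv x d; set q := dotv d (A *m e) => G0.
have xe : dotv x e = b - a by exact: dotvBr.
have sE : dotv x u = b + s.
  by have := dotvBr x u thp; rewrite -[u - thp]/d -/s -/b => ->; rewrite addrC subrK.
have aS : - S <= a <= S := dotv_ball x1 thS.
have bS : - S <= b <= S := dotv_ball x1 thpS.
have s2S : `|s| <= 2 * S.
  have := dotv_ball x1 uS; rewrite sE => /andP[u1 u2].
  have /andP[b1 b2] := bS; rewrite ler_norml; apply/andP; split; clearbody b s; lra.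
have br := bregman_ge R0 dm dm1 dm2 sc b (ltW S0) s2S.
have tl := link_taylor_le R0 dm1 dm2 sc m2k aS bS.
have X2 : (b - a) ^+ 2 <= dotv e e.
  rewrite -xe -sqr_l2norm -[_ ^+ 2]real_normK ?num_real// ler_sqr ?nnegrE ?l2norm_ge0//.
  rewrite (le_trans (cauchy_schwarz _ _))// ler_piMl ?l2norm_ge0//.
(* This coefficient is three times [2 * eta / g * (S * R * k)], the one of the Taylor remainder,
   which therefore consumes one third of [qa]. *)
have qa_ge : 6 * eta * R * k * S / g * (b - a) ^+ 2 <= qf A e.
  apply: le_trans (Alam e); apply: ler_pM => //; last exact: sqr_ge0.
  by rewrite divr_ge0 ?(ltW g0)// !mulr_ge0// ltW.
have -> : thp - u = - d by rewrite opprB.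
have -> : th - u = - (d + e) by rewrite /d /e addrA addrNK opprB.
rewrite !qfN qfD qfZ qf_rank1 -/s (qf_add d e sA) -/q.
rewrite /glb_loss sE -/b.
set qa := qf A e in qa_ge *.
set dl := m1 b - m1 a - m2 a * (b - a) in tl.
have sdl : - (S * R * k * (b - a) ^+ 2) <= s * dl.
  have : `|s * dl| <= 2 * S * (R * k * (b - a) ^+ 2 / 2).
    by rewrite normrM ler_pM.
  rewrite ler_norml => /andP[+ _]; apply: le_trans.
  by rewrite le_eqVlt; apply/orP; left; apply/eqP; field.
have q_ge : - (s * ((m1 a - r) + m2 a * (b - a))) * eta / g <= q.
  have : 0 <= eta * (((m1 a - r) / g * s + (m2 a / g * ((b - a) * s) + eta^-1 * q))).
    by rewrite mulr_ge0 ?(ltW eta0)// -xe mulrA; exact: G0.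
  have -> : eta * (((m1 a - r) / g * s + (m2 a / g * ((b - a) * s) + eta^-1 * q))) =
     q - (- (s * ((m1 a - r) + m2 a * (b - a))) * eta / g).
    by field; rewrite !gt_eqF.
  by rewrite subr_ge0.
(* The factor [2 * eta] turns the lower bound on the Bregman divergence into exactly
   [m2 b * s ^+ 2 / g], the contribution of the rank-one update. *)
have l_ge : m2 b * s ^+ 2 / g + 2 * eta * (m1 b - r) * s / g <=
    2 * eta * ((m (b + s) - r * (b + s)) / g - (m b - r * b) / g).
  have := ler_wpM2l (ltW (divr_gt0 (mulr_gt0 (ltr0n K 2) eta0) g0)) br.
  rewrite -/eta => h.
  have e1 : 2 * eta / g * (m2 b * s ^+ 2 / (2 * eta)) = m2 b * s ^+ 2 / g.
    by field; rewrite !gt_eqF.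
  rewrite e1 in h.
  have -> : 2 * eta * ((m (b + s) - r * (b + s)) / g - (m b - r * b) / g) =
     2 * eta / g * (m (b + s) - m b - m1 b * s) + 2 * eta * (m1 b - r) * s / g.
    by field; rewrite gt_eqF.
  by rewrite lerD2r.
have sdl' := ler_wpM2l (ltW (divr_gt0 (mulr_gt0 (ltr0n K 2) eta0) g0)) sdl.
have e2 : 2 * (- (s * ((m1 a - r) + m2 a * (b - a))) * eta / g) +
    2 * eta * (m1 b - r) * s / g = 2 * eta / g * (s * dl).
  by rewrite /dl; field; rewrite gt_eqF.
have e3 : 2 * eta / g * - (S * R * k * (b - a) ^+ 2) =
    - (6 * eta * R * k * S / g * (b - a) ^+ 2) / 3.
  by field; rewrite gt_eqF.
rewrite e3 in sdl'.
have -> : m2 b / g * s ^+ 2 = m2 b * s ^+ 2 / g by rewrite mulrAC.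
move: (qf A d) (2 * eta * _) (m2 b * s ^+ 2 / g) l_ge q_ge sdl' e2 qa_ge => *.
lra.
Qed.

End OmdStep.

End GlbLoss.

(** * Discounted sums *)

Lemma glm_model_derive (K : realType) (R S g cmu kmu : K) (m h : K -> K)
    (nu : {measure set (measurableTypeR K) -> \bar K}) :
  glm_model R S g cmu kmu m h nu ->
  [/\ forall z : K, is_derive z 1 m (link m z),
      forall z : K, is_derive z 1 (link m) (derive1 (link m) z) &
      forall z : K, is_derive z 1 (derive1 (link m)) (derive1n 2 (link m) z)].
Proof.
move=> hm; have D (f : K -> K) (z : K) : derivable f z 1 -> is_derive z 1 f (derive1 f z).
  by move=> df; rewrite derive1E; exact: DeriveDef.
split=> z.
- by apply: D; exact: (glm_derivable hm (k := 0) isT).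
- by apply: D; exact: (glm_derivable hm (k := 1) isT).
- by apply: D; exact: (glm_derivable hm (k := 2) isT).
Qed.

Section WeightedSums.
Context {K : realType} (gamma : K).

(** Normalized so that the most recent round [t.-1] has weight 1; the sum then follows the same
    discounted recursion as the matrices [H]. *)
Definition wsum (f : nat -> K) (t : nat) : K :=
  \sum_(1 <= s < t) gamma ^+ (t.-1 - s) * f s.

Lemma wsum1 f : wsum f 1 = 0.
Proof. by rewrite /wsum big_geq. Qed.

Lemma wsumS f t : (1 <= t)%N -> wsum f t.+1 = gamma * wsum f t + f t.
Proof.
move=> t1; rewrite /wsum big_nat_recr//= subnn expr0 mul1r; congr (_ + _).
rewrite mulr_sumr; apply: eq_big_nat => s /andP[s1 st].
rewrite mulrA -exprS; congr (gamma ^+ _ * _).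
by case: t t1 st => // t _ st; rewrite subSn.
Qed.

Lemma wsum_le f h t : 0 <= gamma ->
  (forall s, (1 <= s < t)%N -> f s <= h s) -> wsum f t <= wsum h t.
Proof.
move=> g0 fh; apply: ler_sum_nat => s st.
by rewrite ler_wpM2l ?exprn_ge0// fh.
Qed.

Lemma wsumD f h t : wsum (fun s => f s + h s) t = wsum f t + wsum h t.
Proof. by rewrite /wsum -big_split; apply: eq_bigr => s _; rewrite mulrDr. Qed.

Lemma wsumZ a f t : wsum (fun s => a * f s) t = a * wsum f t.
Proof. by rewrite /wsum mulr_sumr; apply: eq_bigr => s _; rewrite mulrCA. Qed.

(* The induction carries the companion bound on the unsquared sum,
   [wsum (D^~ t) t <= F t / (1 - gamma)]. *)
Lemma wsum_sqr_drift (D : nat -> nat -> K) (dl F : nat -> K) (n : nat) :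
  0 < gamma < 1 -> (forall s t, 0 <= D s t) -> (forall t, 0 <= dl t) ->
  F 1%N = 0 -> (forall t, (1 <= t)%N -> F t.+1 = Num.sqrt gamma * F t + dl t) ->
  (forall s t, (1 <= s <= t)%N -> (t < n)%N -> D s t.+1 <= D s t + dl t) ->
  (forall t, (t < n)%N -> D t t = 0) ->
  forall t, (1 <= t <= n)%N ->
  wsum (fun s => D s t ^+ 2) t <= F t ^+ 2 / (1 - gamma).
Proof.
move=> /andP[g0 g1] D0 dl0 F1 FS Dle Dtt.
have g0' := ltW g0.
have h0 : 0 < 1 - gamma by rewrite subr_gt0.
have sg : gamma <= Num.sqrt gamma.
  rewrite -[leLHS]sqr_sqrtr// expr2 ler_piMl ?sqrtr_ge0//.
  by rewrite -[leRHS]sqrtr1 ler_sqrt// ltW.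
have F0 t : (1 <= t)%N -> 0 <= F t.
  elim: t => // -[|t] IH _; first by rewrite F1.
  by rewrite FS// addr_ge0// mulr_ge0 ?sqrtr_ge0// IH.
have W1 t : (1 <= t)%N -> wsum (fun=> 1) t <= (1 - gamma)^-1.
  elim: t => // -[|t] IH _; first by rewrite wsum1 invr_ge0 ltW.
  rewrite wsumS//; have := ler_wpM2l g0' (IH isT) => h.
  have -> : (1 - gamma)^-1 = gamma * (1 - gamma)^-1 + 1 by field; rewrite gt_eqF.
  by rewrite lerD2r.
suff H t : (1 <= t <= n)%N -> wsum (D^~ t) t <= F t / (1 - gamma) /\
    wsum (fun s => D s t ^+ 2) t <= F t ^+ 2 / (1 - gamma).
  by move=> t /H[].
elim: t => // -[|t] IH; first by rewrite !wsum1 F1 mul0r expr0n mul0r.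
move=> /andP[_ tn]; have [IH1 IH2] := IH (ltnW tn).
have W1' := W1 t.+1 isT.
have dt := dl0 t.+1. have Ft := F0 t.+1 isT.
(* One discounting step, for the identity and the square at once: old drifts grow by at most [dl],
   and the new term starts from a zero drift. *)
have shift (f : K -> K) : {in Num.nneg &, {homo f : a b / a <= b}} ->
    wsum (fun s => f (D s t.+2)) t.+2 <=
    gamma * wsum (fun s => f (D s t.+1 + dl t.+1)) t.+1 + f (dl t.+1).
  move=> hf; rewrite wsumS//.
  apply: lerD.
    rewrite ler_wpM2l//; apply: wsum_le => // s /andP[s1 st].
    apply: hf; rewrite ?nnegrE ?addr_ge0//.
    by apply: Dle; rewrite ?s1 ?(ltnW st).
  apply: hf; rewrite ?nnegrE//.
  by have := Dle t.+1 t.+1; rewrite leqnn => /(_ isT tn); rewrite Dtt// add0r.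
have := shift (fun y => y) (fun a b _ _ => id).
rewrite wsumD (_ : (fun=> dl t.+1) = fun s => dl t.+1 * 1); last first.
  by apply/funext => s; rewrite mulr1.
rewrite wsumZ => S1.
have sq_mono : {in Num.nneg &, {homo (fun y : K => y ^+ 2) : a b / a <= b}}.
  by move=> a b a0 b0; rewrite ler_sqr.
have := shift _ sq_mono.
rewrite (_ : (fun s => (D s t.+1 + dl t.+1) ^+ 2) = fun s => D s t.+1 ^+ 2 +
   (2 * dl t.+1 * D s t.+1 + dl t.+1 ^+ 2 * 1)); last first.
  by apply/funext => s; rewrite sqrrD; ring.
rewrite !wsumD !wsumZ => S2.
set i := (1 - gamma)^-1 in IH1 IH2 W1' *.
have i0 : 0 <= i by rewrite invr_ge0 ltW.
have iE : i = gamma * i + 1 by rewrite /i; field; rewrite gt_eqF.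
rewrite FS//; split.
  apply: le_trans S1 _.
  have h1 : gamma * wsum (D^~ t.+1) t.+1 <= Num.sqrt gamma * F t.+1 * i.
    rewrite -mulrA; apply: ler_pM => //.
    by rewrite /wsum sumr_ge0// => s _; rewrite mulr_ge0 ?exprn_ge0.
  have h2 : gamma * (dl t.+1 * wsum (fun=> 1) t.+1) <= gamma * (dl t.+1 * i).
    by rewrite ler_wpM2l// ler_wpM2l.
  have -> : (Num.sqrt gamma * F t.+1 + dl t.+1) * i =
     Num.sqrt gamma * F t.+1 * i + (gamma * (dl t.+1 * i) + dl t.+1).
    by rewrite [in X in _ = X]mulrCA mulrDl; congr (_ + _); rewrite {1}iE; ring.
  by rewrite mulrDr; lra.
apply: le_trans S2 _.
have h1 : gamma * wsum (fun s => D s t.+1 ^+ 2) t.+1 <= gamma * (F t.+1 ^+ 2 * i).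
  by rewrite ler_wpM2l.
(* The cross term is relaxed by [gamma <= sqrt gamma], so that the three terms complete the square
   of [sqrt gamma * F + dl]. *)
have h2 : gamma * (2 * dl t.+1 * wsum (D^~ t.+1) t.+1) <=
   Num.sqrt gamma * (2 * dl t.+1 * (F t.+1 * i)).
  apply: ler_pM => //.
    rewrite mulr_ge0 ?mulr_ge0//.
    by rewrite /wsum sumr_ge0// => s _; rewrite mulr_ge0 ?exprn_ge0.
  by rewrite ler_wpM2l// mulr_ge0.
have h3 : gamma * (dl t.+1 ^+ 2 * wsum (fun=> 1) t.+1) <= gamma * (dl t.+1 ^+ 2 * i).
  by rewrite ler_wpM2l// ler_wpM2l// sqr_ge0.
have -> : (Num.sqrt gamma * F t.+1 + dl t.+1) ^+ 2 * i =
   gamma * (F t.+1 ^+ 2 * i) + (Num.sqrt gamma * (2 * dl t.+1 * (F t.+1 * i)) +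
   (gamma * (dl t.+1 ^+ 2 * i) + dl t.+1 ^+ 2)).
  have -> : gamma * (dl t.+1 ^+ 2 * i) + dl t.+1 ^+ 2 = dl t.+1 ^+ 2 * i.
    by rewrite [in RHS]iE; ring.
  by rewrite sqrrD exprMn sqr_sqrtr//; ring.
rewrite !mulrDr; lra.
Qed.

(** A geometric series of ratio [sqrt gamma]: [1 / (1 - sqrt gamma)] equals
    [(1 + sqrt gamma) / (1 - gamma)], whose numerator is at most 2. The bias contributes a further
    [1 / sqrt (1 - gamma)], whence the exponent 3 / 2. *)
Lemma discounted_path_sum (dl F : nat -> K) (n : nat) :
  0 < gamma < 1 -> (forall t, 0 <= dl t) ->
  F 1%N = 0 -> (forall t, (1 <= t)%N -> F t.+1 = Num.sqrt gamma * F t + dl t) ->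
  (1 <= n)%N ->
  \sum_(1 <= t < n.+1) F t <= 2 * (\sum_(1 <= t < n) dl t) / (1 - gamma).
Proof.
move=> /andP[g0 g1] dl0 F1 FS n1.
have g0' := ltW g0.
pose q := Num.sqrt gamma.
have q0 : 0 <= q by rewrite sqrtr_ge0.
have q1 : q < 1 by rewrite -[ltRHS]sqrtr1 ltr_sqrt.
have F0 t : (1 <= t)%N -> 0 <= F t.
  elim: t => // -[|t] IH _; first by rewrite F1.
  by rewrite FS// addr_ge0// mulr_ge0 ?sqrtr_ge0// IH.
have sumE : \sum_(1 <= t < n.+1) F t =
    q * (\sum_(1 <= t < n) F t) + \sum_(1 <= t < n) dl t.
  elim: n n1 => // -[|n] IH _; first by rewrite big_nat1 F1 !big_geq// mulr0 addr0.
  rewrite big_nat_recr//= FS// {1}IH// [\sum_(1 <= t < n.+2) F t]big_nat_recr//=.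
  by rewrite [\sum_(1 <= t < n.+2) dl t]big_nat_recr//= -/q; ring.
have sumS : \sum_(1 <= t < n.+1) F t <=
    q * (\sum_(1 <= t < n.+1) F t) + \sum_(1 <= t < n) dl t.
  by rewrite {1}sumE lerD2r ler_wpM2l// [leRHS]big_nat_recr//= lerDl F0.
rewrite ler_pdivlMr ?subr_gt0//.
have P0 : 0 <= \sum_(1 <= t < n) dl t by rewrite sumr_ge0.
have gq : gamma = q * q by rewrite -expr2 sqr_sqrtr.
have := sumS; set A := \sum_(1 <= t < n.+1) F t; set B := \sum_(1 <= t < n) dl t in P0 *.
move=> h; rewrite gq.
have h1 : A * (1 - q) <= B by lra.
have -> : A * (1 - q * q) = (A * (1 - q)) * (1 + q) by ring.
apply: (@le_trans _ _ (B * (1 + q))); first by rewrite ler_wpM2r// addr_ge0.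
by rewrite mulrC; apply: ler_wpM2r => //; lra.
Qed.

End WeightedSums.

(** * Potential and confidence along a trajectory *)

Lemma spd_add_rank1 (K : realType) n (A : 'M[K]_n) (w : K) (x : 'cV[K]_n) :
  0 <= w -> spd A -> spd (A + w *: (x *m x^T)).
Proof.
move=> w0 [sA hA]; split.
  by rewrite linearD/= linearZ/= trmx_mul trmxK sA.
move=> y y0; rewrite qfD qfZ qf_rank1 ltr_wpDr ?hA//.
by rewrite mulr_ge0// sqr_ge0.
Qed.

Lemma mxtrace_rank1 (K : realType) n (x : 'cV[K]_n) : \tr (x *m x^T) = dotv x x.
Proof. by rewrite mxtrace_mulC /dotv trace_mx11. Qed.

Lemma prod_expR_le (K : realType) (f : nat -> \bar K) (a : nat -> K) t :
  (forall s, (1 <= s < t)%N -> ((expR (a s))%:E <= f s)%E) ->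
  ((expR (\sum_(1 <= s < t) a s))%:E <= \big[*%E/1%E]_(1 <= s < t) f s)%E.
Proof.
elim: t => [|t IH] h; first by rewrite !big_geq// expR0.
have [->|t0] := eqVneq t 0%N; first by rewrite !big_geq// expR0.
rewrite !big_nat_recr ?lt0n//= expRD EFinM; apply: lee_pmul.
- by rewrite lee_fin expR_ge0.
- by rewrite lee_fin expR_ge0.
- by apply: IH => s /andP[s1 st]; rewrite h// s1 ltnW.
- by rewrite h// lt0n t0 ltnS leqnn.
Qed.

(* The first-order terms in [D] cancel between the two differences. *)
Lemma drift_mismatch_le (K : realType) (m m1 m2 m3 : K -> K) (R S g k r z D c : K) :
  0 < R -> 0 < g -> 0 < c ->
  (forall z : K, is_derive z 1 m (m1 z)) ->
  (forall z : K, is_derive z 1 m1 (m2 z)) ->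
  (forall z : K, is_derive z 1 m2 (m3 z)) ->
  (forall z, `|m3 z| <= R * m2 z) -> m2 z <= k -> `|D| <= 2 * S ->
  (m (z + D) - r * (z + D)) / g - (m z - r * z) / g
   - c^-1 * ((r * (z - c * D - z) - (m (z - c * D) - m z)) / g) <=
  (1 + c) / 2 * k * expR (2 * R * S * (1 + c)) / g * D ^+ 2.
Proof.
move=> R0 g0 c0 dm dm1 dm2 sc mk DS.
have m20 : 0 <= m2 z := sc_ge0 R0 sc z.
have S0 : 0 <= S by have := normr_ge0 D; lra.
have c0' := ltW c0; have R0' := ltW R0.
have h1 := bregman_le R0 dm dm1 dm2 sc z D.
have h2 := bregman_le R0 dm dm1 dm2 sc z (- (c * D)).
have q0 : 0 <= R * S by rewrite mulr_ge0.
have RD : R * `|D| <= 2 * R * S.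
  by rewrite [2 * R]mulrC -mulrA ler_wpM2l.
set e := expR (2 * R * S * (1 + c)).
have e1 : expR (R * `|D|) <= e.
  by rewrite ler_expR mulrDr mulr1 ler_wpDr// mulr_ge0// -mulrA mulr_ge0.
have e2 : expR (R * `|- (c * D)|) <= e.
  rewrite ler_expR mulrDr mulr1 ler_wpDl ?mulr_ge0//.
  rewrite normrN normrM (ger0_norm c0') mulrCA mulrC.
  by rewrite ler_wpM2r.
have b1 : m (z + D) - m z - m1 z * D <= k / 2 * (D ^+ 2 * e).
  apply: le_trans h1 _; apply: ler_pM => //; first by rewrite divr_ge0.
  - by rewrite mulr_ge0 ?sqr_ge0 ?expR_ge0.
  - by rewrite ler_pM2r.
  - by rewrite ler_wpM2l ?sqr_ge0.
have b2 : m (z - c * D) - m z - m1 z * - (c * D) <= k / 2 * (c ^+ 2 * D ^+ 2 * e).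
  apply: le_trans h2 _; rewrite sqrrN exprMn; apply: ler_pM => //; first by rewrite divr_ge0.
  - by rewrite mulr_ge0 ?expR_ge0// mulr_ge0 ?sqr_ge0.
  - by rewrite ler_pM2r.
  - by rewrite ler_wpM2l// mulr_ge0 ?sqr_ge0.
have -> : (m (z + D) - r * (z + D)) / g - (m z - r * z) / g
   - c^-1 * ((r * (z - c * D - z) - (m (z - c * D) - m z)) / g) =
   ((m (z + D) - m z - m1 z * D) +
    c^-1 * (m (z - c * D) - m z - m1 z * - (c * D))) / g.
  by field; rewrite !gt_eqF.
have -> : (1 + c) / 2 * k * e / g * D ^+ 2 =
   (k / 2 * (D ^+ 2 * e) + c^-1 * (k / 2 * (c ^+ 2 * D ^+ 2 * e))) / g.
  by field; rewrite !gt_eqF.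
by rewrite ler_pM2r ?invr_gt0// lerD// ler_pM2l ?invr_gt0.
Qed.

Section Trajectory.
Context {K : realType} {n : nat}.
Context (m m1 m2 m3 : K -> K) (R S g k lam gamma : K) (T : nat).
Context (x : nat -> 'cV[K]_n) (r : nat -> K) (th : nat -> 'cV[K]_n).
Context (H : nat -> 'M[K]_n).
Hypothesis n0 : (0 < n)%N.
Hypothesis R0 : 0 < R.
Hypothesis S0 : 0 < S.
Hypothesis g0 : 0 < g.
Hypothesis k0 : 0 < k.
Hypothesis gamma01 : 0 < gamma < 1.
Hypothesis dm : forall z : K, is_derive z 1 m (m1 z).
Hypothesis dm1 : forall z : K, is_derive z 1 m1 (m2 z).
Hypothesis dm2 : forall z : K, is_derive z 1 m2 (m3 z).
Hypothesis sc : forall z, `|m3 z| <= R * m2 z.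
Hypothesis m2k : forall z : K, - S <= z <= S -> m2 z <= k.
Let eta := 1 + R * S.
Let alpha := 3 * eta / 2.
Hypothesis lam_omd : 6 * eta * R * k * S / g <= lam.
Hypothesis lam_mix : 32 * alpha * n%:R * R ^+ 2 / 7 <= lam.
Hypothesis x1 : forall t, (1 <= t <= T)%N -> l2norm (x t) <= 1.
Hypothesis th1S : l2ball S (th 1%N).
Hypothesis H1 : H 1%N = lam%:M.

(** The matrix [A_t] of the algorithm. Discounting towards [lambda I] rather than towards 0 keeps
    every [H] above [lambda I]. *)
Definition prior_mx (gamma lam : K) (M : 'M[K]_n) : 'M[K]_n :=
  gamma *: M + ((1 - gamma) * lam)%:M.

Local Notation A := (fun t => prior_mx gamma lam (H t)).
Local Notation b := (fun t => dotv (x t) (th t.+1)).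
Local Notation Xn := (fun t => qf (invmx (A t)) (x t)).
Local Notation u := (fun t => m2 (b t) / g * Xn t).

Hypothesis th_upd : forall t, (1 <= t <= T)%N ->
  argmin (l2ball S) (omd_objective m R S g (A t) (x t) (r t) (th t)) (th t.+1).
Hypothesis H_upd : forall t, (1 <= t <= T)%N ->
  H t.+1 = A t + (m2 (b t) / g) *: (x t *m (x t)^T).

Let eta0 : 0 < eta.
Proof. by rewrite /eta addr_gt0// mulr_gt0. Qed.

Let alpha0 : 0 < alpha.
Proof. by rewrite /alpha divr_gt0// mulr_gt0. Qed.

Let n0' : 0 < n%:R :> K.
Proof. by rewrite ltr0n. Qed.

Let lam0 : 0 < lam.
Proof.
apply: lt_le_trans lam_mix; by rewrite divr_gt0// !mulr_gt0// exprn_gt0.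
Qed.

Let m20 z : 0 <= m2 z. Proof. exact: sc_ge0 R0 sc z. Qed.

Lemma iterate_ball t : (1 <= t <= T.+1)%N -> l2ball S (th t).
Proof.
case: t => // -[|t] // /andP[_ tT].
by have [] := th_upd (t := t.+1) tT.
Qed.

Let w0 t : 0 <= m2 (b t) / g.
Proof. by rewrite divr_ge0// ltW. Qed.

Lemma prior_spd (M : 'M[K]_n) : spd M -> spd (prior_mx gamma lam M).
Proof.
move=> hM; rewrite /prior_mx -scale_scalar_mx; have /andP[g0' g1] := gamma01.
by apply: spd_comb => //; [exact: ltW|rewrite subr_gt0|exact: spd_scalar].
Qed.

Lemma qf_prior (M : 'M[K]_n) y :
  qf (prior_mx gamma lam M) y = gamma * qf M y + (1 - gamma) * (lam * dotv y y).
Proof. by rewrite /prior_mx qfD qfZ qf_scalar mulrA. Qed.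

Lemma H_spd t : (1 <= t <= T.+1)%N ->
  spd (H t) /\ forall y, lam * dotv y y <= qf (H t) y.
Proof.
have /andP[/ltW g0' g1] := gamma01.
elim: t => // -[|t] IH tT.
  by rewrite H1; split; [exact: spd_scalar|move=> y; rewrite qf_scalar].
have [IH1 IH2] := IH (ltnW tT); rewrite H_upd//; split.
  by apply: spd_add_rank1 => //; exact: prior_spd.
move=> y; rewrite qfD qfZ qf_rank1 qf_prior.
have := ler_wpM2l g0' (IH2 y).
have : 0 <= m2 (b t.+1) / g * dotv (x t.+1) y ^+ 2 by rewrite mulr_ge0// sqr_ge0.
move: (_ * _ ^+ 2) (qf _ _) (dotv y y) => *; lra.
Qed.

(** [A] lies below [H] because [H] dominates [lambda I]. The bonus is measured in the inverse of
    [H], whereas the determinant identity involves the inverse of [A]; this order links them. *)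
Lemma A_spd t : (1 <= t <= T.+1)%N ->
  [/\ spd (A t), forall y, lam * dotv y y <= qf (A t) y &
      forall y, qf (A t) y <= qf (H t) y].
Proof.
have /andP[/ltW g0' g1] := gamma01.
have g1' : 0 <= 1 - gamma by rewrite subr_ge0 ltW.
move=> /H_spd[h1 h2]; split; first exact: prior_spd.
- move=> y; rewrite qf_prior; have := ler_wpM2l g0' (h2 y).
  move: (qf _ _) (dotv y y) => *; lra.
- move=> y; rewrite qf_prior; have := ler_wpM2l g1' (h2 y).
  move: (qf _ _) (dotv y y) => *; lra.
Qed.

Lemma Xn_ge0 t : (1 <= t <= T.+1)%N -> 0 <= Xn t.
Proof. by move=> /A_spd[/spd_inv h _ _]; exact: spd_ge0. Qed.

Let leT1 t : (1 <= t <= T)%N -> (1 <= t <= T.+1)%N.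
Proof. by move=> /andP[-> tT]; rewrite ltnW. Qed.

Lemma qf_inv_le (M : 'M[K]_n) y : spd M -> (forall y, lam * dotv y y <= qf M y) ->
  qf (invmx M) y <= lam^-1 * dotv y y.
Proof.
move=> hM Ml; have := qf_inv_anti y (spd_scalar n lam0) hM.
rewrite invmx_scalar qf_scalar; apply => z; rewrite qf_scalar; exact: Ml.
Qed.

Let dotv_x_le1 t : (1 <= t <= T)%N -> dotv (x t) (x t) <= 1.
Proof.
by move=> tT; rewrite -sqr_l2norm expr_le1 ?l2norm_ge0// x1.
Qed.

Lemma Xn_le t : (1 <= t <= T)%N -> Xn t <= lam^-1.
Proof.
move=> tT; have [hA Al _] := A_spd (leT1 tT).
apply: le_trans (qf_inv_le (x t) hA Al) _.
by rewrite ler_piMr ?invr_ge0 ?(ltW lam0)// dotv_x_le1.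
Qed.

Let b_ball t : (1 <= t <= T)%N -> - S <= b t <= S.
Proof.
move=> tT; apply: dotv_ball (x1 tT) _; apply: iterate_ball.
by case/andP: tT.
Qed.

Let w_le t : (1 <= t <= T)%N -> m2 (b t) / g <= k / g.
Proof. by move=> tT; rewrite ler_pM2r ?invr_gt0// m2k// b_ball. Qed.

Let u0 t : (1 <= t <= T)%N -> 0 <= u t.
Proof. by move=> tT; rewrite mulr_ge0// Xn_ge0// leT1. Qed.

Lemma u_le t : (1 <= t <= T)%N -> u t <= k / g / lam.
Proof. by move=> tT; apply: ler_pM => //; [exact/Xn_ge0/leT1|exact: w_le|exact: Xn_le]. Qed.

(** Normalized to vanish at the initial matrix, so that concavity of ln det makes the potential of
    [A] at least [gamma] times that of [H]. *)
Definition potential (M : 'M[K]_n) := ln (\det M) - ln (\det (lam%:M : 'M[K]_n)).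

Lemma ln_u_le t : (1 <= t <= T)%N ->
  ln (1 + u t) <= potential (H t.+1) - gamma * potential (H t).
Proof.
move=> tT; have [hA _ _] := A_spd (leT1 tT); have [hH _] := H_spd (leT1 tT).
have dA := spd_det_gt0 hA.
have -> : ln (1 + u t) = ln (\det (H t.+1)) - ln (\det (A t)).
  rewrite H_upd// det_rank1// lnM ?posrE//; first by rewrite addrAC subrr add0r.
  by rewrite ltr_wpDr ?u0.
have g01 : 0 <= gamma < 1 by have /andP[/ltW -> ->] := gamma01.
have := ln_det_concave g01 hH (spd_scalar n lam0).
rewrite scale_scalar_mx -/(prior_mx gamma lam (H t)) /potential.
by move: (ln _) (ln _) (ln _) (ln _) => *; lra.
Qed.

Lemma wsum_ln_u t : (1 <= t <= T.+1)%N ->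
  wsum gamma (fun s => ln (1 + u s)) t <= potential (H t).
Proof.
have /andP[/ltW g0' g1] := gamma01.
elim: t => // -[|t] IH tT; first by rewrite wsum1 H1 /potential subrr.
rewrite wsumS//; have := ln_u_le (t := t.+1) tT.
have := ler_wpM2l g0' (IH (ltnW tT)); move: (ln _) (gamma * _) => *; lra.
Qed.

Lemma trace_H_le t : (1 <= t <= T.+1)%N ->
  \tr (H t) <= lam * n%:R + k / g * ((1 - gamma ^+ t.-1) / (1 - gamma)).
Proof.
have /andP[/ltW g0' g1] := gamma01.
elim: t => // -[|t] IH tT.
  by rewrite H1 mxtrace_scalar expr0 subrr mul0r mulr0 addr0 mulr_natr.
have tT' : (1 <= t.+1 <= T)%N by [].
rewrite H_upd// /prior_mx !mxtraceD !mxtraceZ mxtrace_scalar mxtrace_rank1.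
have h1 := ler_wpM2l g0' (IH (ltnW tT)).
have h2 : m2 (b t.+1) / g * dotv (x t.+1) (x t.+1) <= k / g.
  rewrite -[leRHS]mulr1; apply: ler_pM => //; first exact: dotv_ge0.
    exact: w_le.
  exact: dotv_x_le1.
have -> : (1 - gamma ^+ t.+1) / (1 - gamma) = gamma * ((1 - gamma ^+ t) / (1 - gamma)) + 1.
  by rewrite exprS; field; rewrite subr_eq0 gt_eqF.
rewrite -mulr_natr/=; move: (_ / (1 - gamma)) (\tr _) (_ * dotv _ _) h1 h2 => q a c h1 h2.
by rewrite mulrDr mulr1 mulrCA; lra.
Qed.

Lemma potential_le t : (1 <= t <= T.+1)%N ->
  potential (H t) <=
  n%:R * ln (1 + k * (1 - gamma ^+ t.-1) / (lam * n%:R * g * (1 - gamma))).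
Proof.
move=> tT; have [hH _] := H_spd tT; have /andP[g0' g1] := gamma01.
have := ln_det_le_trace n0 hH.
have q0 : 0 <= 1 - gamma ^+ t.-1 by rewrite subr_ge0 exprn_ile1 ?ltW.
have h1g : 0 < 1 - gamma by rewrite subr_gt0.
have i0 : 0 <= k * (1 - gamma ^+ t.-1) / (lam * n%:R * g * (1 - gamma)).
  by rewrite divr_ge0 ?mulr_ge0// ltW.
rewrite /potential det_scalar lnXn// => h; rewrite lerBlDr (le_trans h)//.
rewrite -[ln lam *+ n]mulr_natl -mulrDr ler_pM2l// -lnM ?posrE ?ltr_wpDr//.
rewrite ler_ln ?posrE ?mulr_gt0 ?ltr_wpDr//.
  rewrite ler_pdivrMr// (le_trans (trace_H_le tT))// le_eqVlt; apply/orP; left.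
  by apply/eqP; field; rewrite !gt_eqF.
  exact: spd_trace_gt0.
by rewrite invr_gt0.
Qed.

Let info := n%:R * ln (1 + k / (lam * n%:R * g * (1 - gamma))).

Lemma potential_le_info t : (1 <= t <= T.+1)%N -> potential (H t) <= info.
Proof.
move=> tT; apply: le_trans (potential_le tT) _.
have /andP[g0' g1] := gamma01.
have h1g : 0 < 1 - gamma by rewrite subr_gt0.
have q0 : 0 <= 1 - gamma ^+ t.-1 by rewrite subr_ge0 exprn_ile1 ?ltW.
have d0 : 0 < lam * n%:R * g * (1 - gamma) by rewrite !mulr_gt0.
rewrite ler_pM2l// ler_ln ?posrE.
- rewrite lerD2l ler_pM2r ?invr_gt0// ler_piMr ?(ltW k0)//.
  by rewrite lerBlDr lerDl exprn_ge0// ltW.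
- by rewrite ltr_wpDr// divr_ge0 ?(ltW d0)// mulr_ge0// ltW.
- by rewrite ltr_wpDr// divr_ge0 ?(ltW d0)// ltW.
Qed.

(** Without discount weights the increments do not telescope fully: each round leaves [1 - gamma]
    times the current potential. This residue is the source of the term in
    [T * sqrt (1 - gamma)]. *)
Lemma sum_ln_u : \sum_(1 <= t < T.+1) ln (1 + u t) <= (1 + (1 - gamma) * T%:R) * info.
Proof.
have /andP[g0' g1] := gamma01.
have h1g : 0 <= 1 - gamma by rewrite subr_ge0 ltW.
have : \sum_(1 <= t < T.+1) ln (1 + u t) <=
    \sum_(1 <= t < T.+1) (potential (H t.+1) - potential (H t) + (1 - gamma) * info).
  apply: ler_sum_nat => t tT; apply: le_trans (ln_u_le tT) _.
  have := ler_wpM2l h1g (potential_le_info (leT1 tT)).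
  by move: (potential _) (potential _) => *; lra.
move=> h; apply: le_trans h _.
rewrite big_split/= telescope_sumr// sumr_const_nat subn1/= -[_ * info *+ T]mulr_natr.
have -> : potential (H 1%N) = 0 by rewrite H1 /potential subrr.
rewrite subr0 mulrAC [leRHS]mulrDl mul1r lerD2r.
by apply: potential_le_info; rewrite leqnn.
Qed.

(** The comparator stays fixed over all past rounds. Reinjecting [lambda I] costs at most
    [(1 - gamma) * (4 * lam * S ^+ 2)] per round, and [4 * lam * S ^+ 2] is the fixed point of the
    resulting recursion. *)
Lemma tracking_le (v : 'cV[K]_n) t : l2ball S v -> (1 <= t <= T.+1)%N ->
  qf (H t) (th t - v) <= 4 * lam * S ^+ 2 + wsum gamma (fun s =>
    2 * eta * (glb_loss m g (x s) (r s) v - glb_loss m g (x s) (r s) (th s.+1))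
    - 2 / 3 * qf (A s) (th s.+1 - th s)) t.
Proof.
have /andP[/ltW g0' g1] := gamma01.
have g1' : 0 <= 1 - gamma by rewrite subr_ge0 ltW.
move=> vS.
have D2 t' : (1 <= t' <= T.+1)%N -> lam * dotv (th t' - v) (th t' - v) <= 4 * lam * S ^+ 2.
  move=> /iterate_ball tS; rewrite -sqr_l2norm mulrC [4 * lam]mulrC -[_ * 4 * _]mulrA mulrC ler_pM2l//.
  have -> : 4 * S ^+ 2 = (S + S) ^+ 2 by ring.
  rewrite ler_sqr ?nnegrE ?l2norm_ge0 ?addr_ge0 ?(ltW S0)//.
  by rewrite (le_trans (l2normB _ _))// lerD.
elim: t => // -[|t] IH tT; first by rewrite wsum1 addr0 H1 qf_scalar D2.
have tT' : (1 <= t.+1 <= T)%N by [].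
rewrite wsumS// H_upd//.
have [hA Al _] := A_spd (leT1 tT').
have t1S : l2ball S (th t.+1) by exact/iterate_ball/leT1.
have t2S : l2ball S (th t.+2) by exact/iterate_ball.
have := omd_step R0 S0 g0 k0 dm dm1 dm2 sc m2k lam_omd hA Al (x1 tT') t1S t2S vS (th_upd tT').
rewrite qf_prior -/eta => h.
have h1 := ler_wpM2l g0' (IH (leT1 tT')).
have h2 := ler_wpM2l g1' (D2 _ (leT1 tT')).
move: h h1 h2; move: (qf _ _) (qf _ _) (wsum _ _ _) (4 * lam * _) (lam * _) => *.
lra.
Qed.

(** * The confidence ellipsoid at one target round *)

Section Confidence.
Context (thstar : nat -> 'cV[K]_n).
Hypothesis thstarS : forall t, (1 <= t)%N -> l2ball S (thstar t).
(** Dictated by [beta], whose confidence logarithm carries the factor [1 / p]. The shift [c] is then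
    [p / (1 - p)], for the first-order drift terms to cancel. *)
Let p := (1 + R ^+ 2 / (g * k))^-1.
Let c := g * k / R ^+ 2.
Let drift t s := l2norm (thstar t - thstar s).
Local Notation z := (fun s => dotv (x s) (thstar s)).
Local Notation sg := (fun s => Num.sqrt (alpha * Xn s)).
Local Notation z' := (fun t s => z s - c * dotv (x s) (thstar t - thstar s)).
Let K1 := (1 + c) / 2 * k * expR (2 * R * S * (1 + c)) / g.

Let c0 : 0 < c. Proof. by rewrite divr_gt0 ?mulr_gt0// exprn_gt0. Qed.

Let pE : p = c / (c + 1).
Proof. by rewrite /p /c; field; rewrite !gt_eqF// addr_gt0// ?mulr_gt0// exprn_gt0. Qed.

Let p01 : 0 <= p <= 1.
Proof.
have c1 : 0 < c + 1 by rewrite addr_gt0.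
rewrite pE divr_ge0 ?(ltW c0) ?(ltW c1)//=.
by rewrite ler_pdivrMr// mul1r lerDl.
Qed.

(* [step s] is the standardized displacement of the linear prediction, so that
   [b s] is the point [a + sg * step] of the Gaussian mixture centred at [a]. *)
Let step s := if Xn s == 0 then 0 else (b s - dotv (x s) (th s)) / sg s.
Let mixexp s := (m (z s) - r s * z s) / g - (m (b s) - r s * b s) / g
  - step s ^+ 2 / 2 - 2 * ln (1 + alpha * u s).

Let stepP s : (1 <= s <= T)%N -> b s = dotv (x s) (th s) + sg s * step s /\
  alpha * step s ^+ 2 <= qf (A s) (th s.+1 - th s).
Proof.
move=> sT; have [hA _ _] := A_spd (leT1 sT).
have X0 := Xn_ge0 (leT1 sT).
have cs := cauchy_schwarz_qf (x s) (th s.+1 - th s) hA.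
(* If [Xn s] vanishes, Cauchy-Schwarz forces the linear prediction not to move, so the default step
   0 is consistent. *)
rewrite (dotvBr (x s)) in cs; rewrite /step; case: eqP => [X00|/eqP X00].
  rewrite mulr0 addr0 expr0n mulr0 spd_ge0//; split => //; apply/eqP.
  by rewrite -subr_eq0 -sqrf_eq0 eq_le sqr_ge0 andbT (le_trans cs)// X00 mul0r.
have Xp : 0 < Xn s by rewrite lt_neqAle eq_sym X00.
have aX : 0 < alpha * Xn s by rewrite mulr_gt0.
have sp : 0 < sg s by rewrite sqrtr_gt0.
rewrite mulrC divfK ?gt_eqF//; split; first by rewrite addrC subrK.
rewrite exprMn exprVn sqr_sqrtr ?(ltW aX)//.
have -> : alpha * ((b s - dotv (x s) (th s)) ^+ 2 / (alpha * Xn s)) =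
  (b s - dotv (x s) (th s)) ^+ 2 / Xn s by field; rewrite !gt_eqF.
by rewrite ler_pdivrMr// mulrC.
Qed.

Let mix_ge s : (1 <= s <= T)%N ->
  ((expR (mixexp s))%:E <= mix_ratio m g (r s) (z s) (dotv (x s) (th s)) (sg s))%E.
Proof.
move=> sT; have [bE _] := stepP sT; have X0 := Xn_ge0 (leT1 sT).
have aX : 0 <= alpha * Xn s by rewrite mulr_ge0// ltW.
rewrite /mixexp {1 2}bE.
apply: (@mix_ratio_gauss K m g (der_continuous dm) m1 m2 m3 R (r s) (z s)
  (dotv (x s) (th s)) (sg s) (step s) (alpha * u s) R0 g0 (sqrtr_ge0 _) dm dm1 dm2 sc).
  (* The second term of [lambda], with a dimension at least 1, bounds [R ^+ 2 * (alpha * Xn s)] by 7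
     / 32. *)
  rewrite exprMn sqr_sqrtr//.
  have h := ler_wpM2l (mulr_ge0 (sqr_ge0 R) (ltW alpha0)) (Xn_le sT).
  rewrite mulrA (le_trans h)// ler_pdivrMr//.
  have : 32 * alpha * 1 * R ^+ 2 / 7 <= lam.
    apply: le_trans lam_mix; rewrite ler_pM2r ?invr_gt0//.
    apply: ler_wpM2r; first exact: sqr_ge0.
    by apply: ler_wpM2l; rewrite ?ler1n// mulr_ge0// ltW.
  by move: (R ^+ 2) => q hq; lra.
by rewrite -bE sqr_sqrtr//; ring.
Qed.

(** Bernoulli's inequality with real exponent [alpha >= 1], in logarithmic form; moreover
    [2 * alpha = 3 * eta]. *)
Let bernoulli y : 0 <= y -> 2 * ln (1 + alpha * y) <= 3 * eta * ln (1 + y).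
Proof.
move=> y0; have a0 := ltW alpha0.
have y1 : 0 < 1 + y by rewrite ltr_wpDr.
have ay1 : 0 < 1 + alpha * y by rewrite ltr_wpDr// mulr_ge0.
have a1 : 1 <= alpha by rewrite /alpha /eta; have := mulr_gt0 R0 S0; lra.
have om : 0 <= alpha^-1 <= 1 by rewrite invr_ge0 a0 invf_le1.
have := expR_convex_le (ln (1 + alpha * y)) 0 om (_ : 0 <= 1 <= 1).
rewrite subrr mul0r addr0 mul1r lexx ler01 => /(_ isT).
rewrite mul0r addr0 mul1r lnK ?posrE// => h.
have : alpha^-1 * ln (1 + alpha * y) <= ln (1 + y).
  rewrite -ler_expR [leRHS]lnK ?posrE// (le_trans h)// le_eqVlt.
  by apply/orP; left; apply/eqP; field; rewrite gt_eqF.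
rewrite ler_pdivrMl// => h2; have -> : 3 * eta = 2 * alpha by rewrite /alpha; field.
by rewrite -mulrA ler_pM2l.
Qed.

Let shiftexp t s := (r s * (z' t s - z s) - (m (z' t s) - m (z s))) / g.

(** The loss difference is split at [thstar s]: from the next iterate to [thstar s] it is read in
    the mixture exponent, and from [thstar s] to [thstar t] in the shifted alternative, up to a
    second-order error. *)
Let round_le t s : (1 <= t)%N -> (1 <= s <= T)%N ->
  2 * eta * (glb_loss m g (x s) (r s) (thstar t) - glb_loss m g (x s) (r s) (th s.+1))
    - 2 / 3 * qf (A s) (th s.+1 - th s) <=
  2 * eta / p * (p * mixexp s + (1 - p) * shiftexp t s)
  + (2 * eta * (3 * eta + 2^-1) * ln (1 + u s) + 2 * eta * K1 * drift t s ^+ 2).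
Proof.
move=> t1 sT; have [bE qE] := stepP sT.
have s1 : (1 <= s)%N by case/andP: sT.
set D := dotv (x s) (thstar t - thstar s).
have DE : dotv (x s) (thstar t) = z s + D by rewrite /D dotvBr addrC subrK.
have Dd : `|D| <= drift t s.
  apply: le_trans (cauchy_schwarz _ _) _.
  by rewrite ler_piMl ?l2norm_ge0// x1.
have D2S : `|D| <= 2 * S.
  apply: le_trans Dd (le_trans (l2normB _ _) _).
  have := thstarS t1; have := thstarS s1; rewrite /l2ball/=; lra.
have zS : - S <= z s <= S by exact: dotv_ball (x1 sT) (thstarS s1).
have := drift_mismatch_le (r s) R0 g0 c0 dm dm1 dm2 sc (m2k zS) D2S.
rewrite -/K1 -/D -/(shiftexp t s) => kap.
have kap2 : K1 * D ^+ 2 <= K1 * drift t s ^+ 2.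
  have K10 : 0 <= K1.
    rewrite /K1 !mulr_ge0 ?expR_ge0 ?invr_ge0 ?(ltW k0) ?(ltW g0)//.
    by rewrite addr_ge0// ltW.
  rewrite ler_wpM2l// -[D ^+ 2]real_normK ?num_real// ler_sqr// nnegrE ?l2norm_ge0//.
have ub := bernoulli (u0 sT).
have lu0 : 0 <= ln (1 + u s) by rewrite ln_ge0// lerDl u0.
have pp : 2 * eta / p * (p * mixexp s + (1 - p) * shiftexp t s) =
    2 * eta * (mixexp s + c^-1 * shiftexp t s).
  by rewrite pE; field; rewrite !gt_eqF// addr_gt0.
rewrite pp /glb_loss DE; rewrite -/(b s) in kap *.
have -> : 2 * eta * (mixexp s + c^-1 * shiftexp t s) +
    (2 * eta * (3 * eta + 2^-1) * ln (1 + u s) + 2 * eta * K1 * drift t s ^+ 2) =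
  2 * eta * (mixexp s + c^-1 * shiftexp t s + (3 * eta + 2^-1) * ln (1 + u s)
     + K1 * drift t s ^+ 2) by ring.
(* The reason for [alpha = 3 * eta / 2]: the recentring cost [step s ^+ 2 / 2], times [2 * eta], is
   exactly two thirds of [alpha * step s ^+ 2]. *)
have qE' : 2 * eta * (step s ^+ 2 / 2) <= 2 / 3 * qf (A s) (th s.+1 - th s).
  have -> : 2 * eta * (step s ^+ 2 / 2) = 2 / 3 * (alpha * step s ^+ 2).
    by rewrite /alpha; field.
  by rewrite ler_pM2l.
rewrite lerBlDr; apply: le_trans (lerD (lexx _) qE').
rewrite -mulrDr ler_pM2l ?mulr_gt0//.
rewrite /mixexp; move: (ln (1 + u s)) (ln (1 + _ * _)) (step s ^+ 2) lu0 ub kap kap2 => *.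
lra.
Qed.

Lemma confidence_le t L : (1 <= t <= T)%N ->
  (\big[*%E/1%E]_(1 <= s < t) mix_factor m g (gamma ^+ (t.-1 - s)) p (r s) (z s)
     (dotv (x s) (th s)) (sg s) (z' t s) <= (expR L)%:E)%E ->
  qf (H t) (th t - thstar t) <= 4 * lam * S ^+ 2
    + 2 * eta * (1 + R ^+ 2 / (g * k)) * L
    + 2 * eta * (3 * eta + 2^-1) * n%:R
        * ln (1 + k * (1 - gamma ^+ t.-1) / (lam * n%:R * g * (1 - gamma)))
    + 2 * eta * K1 * wsum gamma (fun s => drift t s ^+ 2) t.
Proof.
move=> tT hL; have /andP[t1 tT1] := tT; have /andP[/ltW g0' /ltW g1] := gamma01.
have hlog : wsum gamma (fun s => p * mixexp s + (1 - p) * shiftexp t s) t <= L.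
  rewrite -ler_expR -lee_fin; apply: le_trans hL; apply: prod_expR_le => s /andP[s1 st].
  apply: mix_factor_ge => //; first by rewrite exprn_ge0// exprn_ile1.
  by apply: mix_ge; rewrite s1/= (leq_trans (ltnW st)).
apply: le_trans (tracking_le (thstarS t1) (leT1 tT)) _.
rewrite -!addrA lerD2l.
apply: (@le_trans _ _ (wsum gamma (fun s =>
    2 * eta / p * (p * mixexp s + (1 - p) * shiftexp t s)
    + (2 * eta * (3 * eta + 2^-1) * ln (1 + u s) + 2 * eta * K1 * drift t s ^+ 2)) t)).
  apply: wsum_le => // s /andP[s1 st]; apply: round_le => //.
  by rewrite s1/= (leq_trans (ltnW st)).
rewrite !wsumD wsumZ !(wsumZ gamma (_ * _)).
apply: lerD.
  have -> : 1 + R ^+ 2 / (g * k) = p^-1 by rewrite invrK.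
  rewrite ler_wpM2l// divr_ge0 ?mulr_ge0 ?(ltW eta0)//; by case/andP: p01.
rewrite lerD2r -[leRHS]mulrA; apply: ler_wpM2l.
  by have := eta0 => e0; rewrite mulr_ge0 ?addr_ge0 ?invr_ge0 ?mulr_ge0 ?(ltW e0).
exact: le_trans (wsum_ln_u (leT1 tT)) (potential_le (leT1 tT)).
Qed.

End Confidence.

End Trajectory.

(** * Regret of a trajectory *)

Lemma le_ln1D (K : realType) (u U : K) : 0 <= u <= U -> u <= (1 + U) * ln (1 + u).
Proof.
move=> /andP[u0 uU]; have u1 : 0 < 1 + u by rewrite ltr_wpDr.
have hln : u / (1 + u) <= ln (1 + u).
  rewrite -[ln _]opprK -lnV ?posrE// lerNr.
  rewrite -ler_expR lnK ?posrE ?invr_gt0//.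
  have := expR_ge1Dx (- (u / (1 + u))); apply: le_trans.
  by rewrite le_eqVlt; apply/orP; left; apply/eqP; field; rewrite gt_eqF.
have uE : u = (1 + u) * (u / (1 + u)) by field; rewrite gt_eqF.
by rewrite {1}uE; apply: ler_pM => //; rewrite ?divr_ge0 ?(ltW u1)// lerD2l.
Qed.

Lemma sum_le_sqrt (K : realType) (a : nat -> K) (T : nat) (Q : K) : 0 < Q -> (0 < T)%N ->
  \sum_(1 <= t < T.+1) a t ^+ 2 <= Q ->
  \sum_(1 <= t < T.+1) a t <= Num.sqrt (T%:R * Q).
Proof.
move=> Q0 T0 aQ; have T0' : 0 < T%:R :> K by rewrite ltr0n.
(* Cauchy-Schwarz through the arithmetic-geometric inequality at [q], the common value of the terms
   in the case of equality. *)
pose q := Num.sqrt Q / Num.sqrt T%:R.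
have sQ : 0 < Num.sqrt Q by rewrite sqrtr_gt0.
have sT : 0 < Num.sqrt T%:R :> K by rewrite sqrtr_gt0.
have q0 : 0 < q by rewrite divr_gt0.
have h t : a t <= q / 2 + a t ^+ 2 * (2 * q)^-1.
  rewrite -subr_ge0 (_ : _ - _ = (a t - q) ^+ 2 / (2 * q)).
    by rewrite divr_ge0 ?sqr_ge0// mulr_ge0// ltW.
  by field; rewrite gt_eqF.
apply: (le_trans (ler_sum_nat (fun t _ => h t))).
rewrite big_split/= sumr_const_nat subn1/= -mulr_suml.
apply: (@le_trans _ _ (q / 2 *+ T + Q / (2 * q))).
  by rewrite lerD2l ler_pM2r// invr_gt0 mulr_gt0.
rewrite -mulr_natr sqrtrM ?(ltW T0')// /q le_eqVlt; apply/orP; left; apply/eqP.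
move: sQ sT (sqr_sqrtr (ltW Q0)) (sqr_sqrtr (ltW T0')).
move: (Num.sqrt Q) (Num.sqrt T%:R) => p s p0 s0 <- <-.
by field; rewrite !gt_eqF.
Qed.

Lemma link_gap_le (K : realType) (m1 m2 : K -> K) (S k B z1 z2 : K) :
  (forall z : K, is_derive z 1 m1 (m2 z)) -> (forall z, 0 <= m2 z) ->
  (forall z, - S <= z <= S -> m2 z <= k) -> - S <= z1 <= S -> - S <= z2 <= S ->
  0 <= k -> 0 <= B -> z1 - z2 <= B -> m1 z1 - m1 z2 <= k * B.
Proof.
move=> dm1 m20 m2k z1S z2S k0 B0 z12.
have [z1z2|z21] := leP z1 z2.
  apply: le_trans (mulr_ge0 k0 B0).
  by rewrite subr_le0; exact: ge_derive_mono dm1 m20 z1z2.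
have := @is_derive_ge0 K (fun t => k * t - (m1 (z2 + t * 1) - m1 z2)) (fun t => k - m2 (z2 + t * 1))
   (z1 - z2) _ _ _ _.
have dF (t : K) : is_derive t 1 (fun t : K => k * t - (m1 (z2 + t * 1) - m1 z2)) (k - m2 (z2 + t * 1)).
  apply: der_eq (derB (derM (derC t k) (derX t))
    (derB (der_line z2 1 t dm1) (derC t (m1 z2)))) _.
  by ring.
move=> /(_ dF); rewrite mulr0 mul0r addr0 subrr subr0 => /(_ erefl).
rewrite subr_ge0 (ltW z21) => /(_ isT) h.
have /h : forall z, 0 <= z <= z1 - z2 -> 0 <= k - m2 (z2 + z * 1).
  move=> z /andP[hz0 hz1]; rewrite subr_ge0 mulr1; apply: m2k.
  by apply/andP; split; lra.
rewrite mulr1 (addrC z2) subrK subr_ge0 => h2; apply: le_trans h2 _.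
by rewrite ler_wpM2l.
Qed.

(** The bonus contains [be] but not [bi], which the learner cannot know. Optimism removes the [be]
    term at [y]; the [bi] terms survive at both actions and are bounded there by the crude norm
    [1 / sqrt lam]. *)
Lemma optimism_gap_le (K : realType) n (M : 'M[K]_n) (lam be bi : K)
    (X : set 'cV[K]_n) (th ths x y : 'cV[K]_n) :
  spd M -> 0 < lam -> (forall v, lam * dotv v v <= qf M v) ->
  0 <= be -> 0 <= bi -> X `<=` l2ball 1 ->
  argmax X (fun v => dotv v th + be * mxnorm (invmx M) v) x -> X y ->
  mxnorm M (th - ths) <= be + bi ->
  dotv y ths - dotv x ths <=
    2 * be * mxnorm (invmx M) x + 2 * bi / Num.sqrt lam.
Proof.
move=> hM lam0 Ml be0 bi0 X1 [xX xmax] yX hN.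
have inv_le v : X v -> mxnorm (invmx M) v <= (Num.sqrt lam)^-1.
  move=> /X1 v1; have sl : 0 < Num.sqrt lam by rewrite sqrtr_gt0.
  rewrite -ler_sqr ?nnegrE ?mxnorm_ge0 ?invr_ge0 ?(ltW sl)//.
  rewrite sqr_mxnorm; last exact/spd_ge0/spd_inv.
  rewrite exprVn sqr_sqrtr ?(ltW lam0)//.
  have := qf_inv_anti v (spd_scalar n lam0) hM.
  rewrite invmx_scalar qf_scalar => h; apply: (le_trans (h _)).
    by move=> w; rewrite qf_scalar.
  rewrite ler_piMr ?invr_ge0 ?(ltW lam0)//.
  by rewrite -sqr_l2norm expr_le1 ?l2norm_ge0.
have dev v : `|dotv v (th - ths)| <= mxnorm (invmx M) v * (be + bi).
  by rewrite (le_trans (mxnorm_dotv _ _ hM))// ler_wpM2l// mxnorm_ge0.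
have := dev x; have := dev y; rewrite !ler_norml !dotvBr => /andP[y1 y2] /andP[x1 x2].
have := xmax y yX => hxy.
have ny := ler_wpM2l bi0 (inv_le y yX); have nx := ler_wpM2l bi0 (inv_le x xX).
have -> : 2 * bi / Num.sqrt lam = bi / Num.sqrt lam + bi / Num.sqrt lam by ring.
move: (mxnorm _ x) (mxnorm _ y) (bi / _) (dotv x ths) (dotv y ths) (dotv x th) (dotv y th) y1 y2 x1 x2 hxy ny nx => *.
nra.
Qed.

(* The last argument of [mix_factor] is moved against the drift by the factor
   [g k / R ^+ 2], the ratio of the weights of the two alternatives, so that the
   first-order effect of the drift cancels. *)
Definition mixture_wealth (K : realType) n (m : K -> K) (R S g k lam gamma : K)
    (x : nat -> 'cV[K]_n) (r : nat -> K) (th : nat -> 'cV[K]_n)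
    (H : nat -> 'M[K]_n) (thstar : nat -> 'cV[K]_n) (t : nat) : \bar K :=
  (\big[*%E/1%E]_(1 <= s < t) mix_factor m g (gamma ^+ (t.-1 - s))
     (1 + R ^+ 2 / (g * k))^-1 (r s) (dotv (x s) (thstar s)) (dotv (x s) (th s))
     (Num.sqrt (3 * (1 + R * S) / 2 * qf (invmx (prior_mx gamma lam (H s))) (x s)))
     (dotv (x s) (thstar s) - g * k / R ^+ 2 * dotv (x s) (thstar t - thstar s)))%E.

Section Constants.
Context {K : realType} (R S g k : K).
Let eta := 1 + R * S.
Let alpha := 3 * eta / 2.
Let c := g * k / R ^+ 2.

(** The ratio of [k / g] to the second term of [lambda] with its dimension removed; it dominates
    every leverage. *)
Definition leverage_const := 7 * k / (32 * g * alpha * R ^+ 2).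

(* [beta ^+ 2 <= radius_const * d] up to logarithms. *)
Definition radius_const :=
  4 * (6 * eta * R * k * S / g + 32 * alpha * R ^+ 2 / 7 + k / g) * S ^+ 2
  + 2 * eta * (1 + R ^+ 2 / (g * k)) * 2
  + 2 * eta * (3 * eta + 2^-1) * (1 + leverage_const).

(** [2 * eta] times the coefficient found in [drift_mismatch_le]. *)
Definition drift_const :=
  2 * eta * ((1 + c) / 2 * k * expR (2 * R * S * (1 + c)) / g).

Definition regret_const :=
  2 * k * Num.sqrt (radius_const * g) * (1 + leverage_const)
  + 4 * k * Num.sqrt (drift_const * g).

End Constants.

Section DomdRegret.
Context {K : realType} {n : nat}.
Context (m h : K -> K) (nu : {measure set (measurableTypeR K) -> \bar K}).
Context (R S g cmu k delta gamma : K) (T : nat).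
Context (X : nat -> set 'cV[K]_n) (x : nat -> 'cV[K]_n) (r : nat -> K).
Context (th1 : 'cV[K]_n) (th : nat -> 'cV[K]_n) (H : nat -> 'M[K]_n).
Context (thstar xstar : nat -> 'cV[K]_n).
Hypothesis n0 : (0 < n)%N.
Hypothesis T2 : (2 <= T)%N.
Hypothesis R0 : 0 < R.
Hypothesis S0 : 0 < S.
Hypothesis g0 : 0 < g.
Hypothesis k0 : 0 < k.
Hypothesis cmu0 : 0 < cmu.
Hypothesis delta01 : 0 < delta < 1.
Hypothesis gamma01 : 0 < gamma < 1.
Hypothesis hm : glm_model R S g cmu k m h nu.
Hypothesis th1S : l2ball S th1.
Hypothesis thstarS : forall t, (1 <= t)%N -> l2ball S (thstar t).
Hypothesis X1 : forall t, (1 <= t <= T)%N -> X t `<=` l2ball 1.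
Hypothesis xstarP : forall t, (1 <= t <= T)%N ->
  argmax (X t) (fun y => link m (dotv y (thstar t))) (xstar t).
Let eta := 1 + R * S.
Let alpha := 3 * eta / 2.
Let lam := lambda_glb n R S g cmu k eta alpha.
Hypothesis alg : domd_glb m R S g k gamma lam delta eta T th1 X x r th H.

Let m1 := link m.
Let m2 := derive1 (link m).
Let m3 := derive1n 2 (link m).

Let dm (z : K) : is_derive z 1 m (m1 z).
Proof. by have [+ _ _] := glm_model_derive hm; exact. Qed.
Let dm1 (z : K) : is_derive z 1 m1 (m2 z).
Proof. by have [_ + _] := glm_model_derive hm; exact. Qed.
Let dm2 (z : K) : is_derive z 1 m2 (m3 z).
Proof. by have [_ _ +] := glm_model_derive hm; exact. Qed.
Let sc : forall z, `|m3 z| <= R * m2 z := glm_self_concordant hm.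
Let m2k (z : K) : - S <= z <= S -> m2 z <= k.
Proof. by move=> /(glm_bounded_link hm)/andP[]. Qed.
Let m2c (z : K) : - S <= z <= S -> cmu <= m2 z.
Proof. by move=> /(glm_bounded_link hm)/andP[]. Qed.

Let cmuk : cmu <= k.
Proof.
have z : - S <= 0 <= S by rewrite oppr_le0 ltW.
exact: le_trans (m2c z) (m2k z).
Qed.

Let eta0 : 0 < eta.
Proof. by rewrite /eta addr_gt0// mulr_gt0. Qed.

Let alpha0 : 0 < alpha.
Proof. by rewrite /alpha divr_gt0// mulr_gt0. Qed.

Let n0' : 0 < n%:R :> K.
Proof. by rewrite ltr0n. Qed.

Let lam_omd : 6 * eta * R * k * S / g <= lam.
Proof. by rewrite /lam /lambda_glb le_max lexx. Qed.

Let lam_mix : 32 * alpha * n%:R * R ^+ 2 / 7 <= lam.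
Proof. by rewrite /lam /lambda_glb !le_max lexx !orbT. Qed.

Let lam_cmu : cmu / g <= lam.
Proof. by rewrite /lam /lambda_glb !le_max lexx !orbT. Qed.

Let lam0 : 0 < lam.
Proof. by apply: lt_le_trans lam_cmu; rewrite divr_gt0. Qed.

Let leT1 t : (1 <= t <= T)%N -> (1 <= t <= T.+1)%N.
Proof. by move=> /andP[-> tT]; rewrite ltnW. Qed.

Let x1 t : (1 <= t <= T)%N -> l2norm (x t) <= 1.
Proof. by move=> tT; have [xX _] := domd_play alg tT; exact: X1 xX. Qed.

Let th1S' : l2ball S (th 1%N).
Proof. by rewrite (domd_th_init alg). Qed.

Let H1 : H 1%N = lam%:M := domd_H_init alg.

Lemma domd_th_step t : (1 <= t <= T)%N ->
  argmin (l2ball S) (omd_objective m R S g (prior_mx gamma lam (H t)) (x t) (r t) (th t)) (th t.+1).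
Proof. by move=> tT; have := domd_th_update alg tT; exact. Qed.
Let th_upd := domd_th_step.

Lemma domd_H_step t : (1 <= t <= T)%N ->
  H t.+1 = prior_mx gamma lam (H t) + (m2 (dotv (x t) (th t.+1)) / g) *: (x t *m (x t)^T).
Proof.
by move=> tT; rewrite (domd_H_update alg tT) (@hessian_glb_loss K m m1 m2 g dm dm1).
Qed.
Let H_upd := domd_H_step.

Local Notation A := (fun t => prior_mx gamma lam (H t)).
Local Notation b := (fun t => dotv (x t) (th t.+1)).
Local Notation Xn := (fun t => qf (invmx (A t)) (x t)).
Local Notation u := (fun t => m2 (b t) / g * Xn t).
Local Notation be t := (beta n R S g k gamma lam delta eta t).

Let HP := H_spd n0 R0 S0 g0 gamma01 sc lam_mix H1 H_upd.
Let AP := A_spd n0 R0 S0 g0 gamma01 sc lam_mix H1 H_upd.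

Lemma domd_spd t : (1 <= t <= T.+1)%N ->
  [/\ spd (H t), spd (A t) & forall y, lam * dotv y y <= qf (A t) y].
Proof. by move=> tT; have [] := HP tT; have [] := AP tT. Qed.

(** The lower slope bound at the updated prediction converts the bonus into a leverage at the price
    [g / cmu]; after a square root this is the factor [1 / sqrt cmu] of the exploration part. *)
Let xnorm_le t : (1 <= t <= T)%N ->
  mxnorm (invmx (H t)) (x t) ^+ 2 <= g / cmu * u t.
Proof.
move=> tT; have [hH _] := HP (leT1 tT); have [hA _ AH] := AP (leT1 tT).
rewrite sqr_mxnorm; last exact/spd_ge0/spd_inv.
apply: le_trans (qf_inv_anti (x t) hA hH AH) _.
have X0 : 0 <= Xn t by exact/spd_ge0/spd_inv.
have -> : g / cmu * u t = m2 (b t) / cmu * Xn t by field; rewrite !gt_eqF.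
rewrite -[leLHS]mul1r ler_wpM2r// ler_pdivlMr// mul1r m2c//.
apply: dotv_ball (x1 tT) _.
by have /(_ t.+1) := iterate_ball th1S' th_upd; apply; case/andP: tT.
Qed.

Let U1 := leverage_const R S g k.

Let U10 : 0 < U1.
Proof. by rewrite divr_gt0 ?mulr_gt0// exprn_gt0. Qed.

Let kglam : k / g / lam <= U1 / n%:R.
Proof.
rewrite ler_pdivrMr//.
have d0 : 0 < n%:R * (32 * g * alpha * R ^+ 2) by rewrite !mulr_gt0// exprn_gt0.
have -> : k / g = U1 / n%:R * (32 * alpha * n%:R * R ^+ 2 / 7).
  by rewrite /U1 /leverage_const -/eta -/alpha; field; rewrite !gt_eqF.
by rewrite ler_wpM2l// divr_ge0// ltW.
Qed.

(** The value of the logarithmic polynomial. Being at least 1, it absorbs all additive constants and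
    all other logarithms. *)
Let ell := ln (expR 1 * T%:R) + ln (expR 1 / delta) + ln (expR 1 / (1 - gamma)).

Let ellE : ell = 3 + ln T%:R - ln delta - ln (1 - gamma).
Proof.
have /andP[d0 d1] := delta01; have /andP[_ g1] := gamma01.
have h1g : 0 < 1 - gamma by rewrite subr_gt0.
rewrite /ell lnM ?posrE ?expR_gt0 ?ltr0n ?(ltn_trans _ T2)//.
by rewrite !ln_div ?posrE ?expR_gt0// expRK; ring.
Qed.

Let lnT : 0 <= ln T%:R :> K. Proof. by rewrite ln_ge0// ler1n (ltn_trans _ T2). Qed.
Let lnd : ln delta <= 0. Proof. by have /andP[_ /ltW d1] := delta01; exact: ln_le0. Qed.
Let lng : ln (1 - gamma) <= 0.
Proof. by have /andP[/ltW g0' _] := gamma01; apply: ln_le0; rewrite gerBl. Qed.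

Let ell1 : 1 <= ell.
Proof. rewrite ellE; move: lnT lnd lng; lra. Qed.

Let info_le : ln (1 + k / (lam * n%:R * g * (1 - gamma))) <= (1 + U1) * ell.
Proof.
have /andP[g0' g1] := gamma01; have h1g : 0 < 1 - gamma by rewrite subr_gt0.
have d0 : 0 < lam * n%:R * g * (1 - gamma) by rewrite !mulr_gt0.
have hq : 1 + k / (lam * n%:R * g * (1 - gamma)) <= (1 + U1) / (1 - gamma).
  have -> : k / (lam * n%:R * g * (1 - gamma)) = k / g / lam * (n%:R^-1 / (1 - gamma)).
    by field; rewrite !gt_eqF.
  have h1 : k / g / lam * (n%:R^-1 / (1 - gamma)) <= U1 / (1 - gamma).
    rewrite mulrA ler_pM2r ?invr_gt0//.
    apply: (@le_trans _ _ (U1 * 1)); last by rewrite mulr1.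
    apply: ler_pM; rewrite ?invr_ge0 ?invf_le1 ?ler1n// ?divr_ge0 ?(ltW k0) ?(ltW g0) ?(ltW lam0)//.
    apply: le_trans kglam _; rewrite ler_pdivrMr// ler_peMr ?(ltW U10)// ler1n//.
  have h2 : 1 <= (1 - gamma)^-1 by rewrite invf_ge1// gerBl ltW.
  by rewrite mulrDl mul1r lerD.
have p0 : 0 < 1 + k / (lam * n%:R * g * (1 - gamma)).
  by rewrite addr_gt0// divr_gt0.
have U1p : 0 < 1 + U1 by rewrite addr_gt0.
apply: (@le_trans _ _ (ln ((1 + U1) / (1 - gamma)))).
  by rewrite ler_ln ?posrE// divr_gt0.
rewrite ln_div ?posrE//.
have hU : ln (1 + U1) <= U1 by rewrite -ler_expR lnK ?posrE// expR_ge1Dx.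
have : U1 * 1 <= U1 * ell by rewrite ler_wpM2l// ltW.
rewrite (mulrDl 1) mul1r mulr1; move: ellE lnT lnd lng => *; lra.
Qed.

Let Lt t := ln (pi ^+ 2 * t%:R ^+ 2 / (3 * delta)) : K.

Let Lt_bounds t : (1 <= t <= T)%N -> 0 <= Lt t <= 2 * ell.
Proof.
move=> /andP[t1 tT]; have /andP[d0 d1] := delta01.
have p2 := pi_ge2 K.
have p4 : pi <= 4 :> K by have := pihalf_lt2 K; move: (pi : K) => p; lra.
have t1' : 1 <= t%:R :> K by rewrite ler1n.
have tT' : t%:R <= T%:R :> K by rewrite ler_nat.
have T0 : 0 < T%:R :> K by rewrite ltr0n (ltn_trans _ T2).
have d3 : 0 < 3 * delta by rewrite mulr_gt0.
have low : 4 <= pi ^+ 2 * t%:R ^+ 2 :> K.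
  rewrite -[leLHS]mulr1; apply: ler_pM => //.
    by rewrite expr2; have := p2; nra.
  by rewrite expr_ge1.
have up : pi ^+ 2 * t%:R ^+ 2 <= 16 * T%:R ^+ 2 :> K.
  apply: ler_pM; rewrite ?sqr_ge0//.
    by rewrite expr2; have := p2; have := p4; nra.
  by rewrite ler_sqr ?nnegrE.
have y1 : 1 <= pi ^+ 2 * t%:R ^+ 2 / (3 * delta).
  by rewrite ler_pdivlMr//; lra.
rewrite /Lt ln_ge0//=.
have hl : ln (16 / 3 * (T%:R ^+ 2 / delta)) <= 2 * ell.
  have T20 : 0 < T%:R ^+ 2 :> K by rewrite exprn_gt0.
  rewrite lnM ?posrE ?divr_gt0// [ln (T%:R ^+ 2 / delta)]ln_div ?posrE// lnXn//.
  (* A crude bound suffices: the constant 3 in [ellE], doubled, exceeds [16 / 3 - 1]. *)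
  have : ln (16 / 3) <= 16 / 3 - 1 :> K.
    rewrite -ler_expR lnK ?posrE ?divr_gt0//.
    have := expR_ge1Dx (16 / 3 - 1 : K).
    by rewrite (addrC 1) subrK.
  rewrite ellE mulr2n; move: (ln (16 / 3 : K)) lnT lnd lng => *; lra.
apply: le_trans hl; rewrite ler_ln ?posrE ?(lt_le_trans ltr01 y1)//.
  rewrite (_ : 16 / 3 * (T%:R ^+ 2 / delta) = 16 * T%:R ^+ 2 / (3 * delta)).
    by rewrite ler_pM2r ?invr_gt0.
  by field; rewrite gt_eqF.
by rewrite !mulr_gt0 ?invr_gt0// exprn_gt0.
Qed.

Let radius t := 4 * lam * S ^+ 2 + 2 * eta * (1 + R ^+ 2 / (g * k)) * Lt t
  + 2 * eta * (3 * eta + 2^-1) * n%:R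
      * ln (1 + k * (1 - gamma ^+ t.-1) / (lam * n%:R * g * (1 - gamma))).

Let radius_bounds t : (1 <= t <= T)%N ->
  0 <= radius t <= radius_const R S g k * n%:R * ell.
Proof.
move=> tT; have /andP[L0 L1] := Lt_bounds tT; have /andP[g0' g1] := gamma01.
have h1g : 0 < 1 - gamma by rewrite subr_gt0.
have d0 : 0 < lam * n%:R * g * (1 - gamma) by rewrite !mulr_gt0.
have q0 : 0 <= 1 - gamma ^+ t.-1 by rewrite subr_ge0 exprn_ile1 ?ltW.
have a0 : 0 <= k * (1 - gamma ^+ t.-1) / (lam * n%:R * g * (1 - gamma)).
  by rewrite divr_ge0 ?mulr_ge0 ?(ltW k0)// ltW.
set J := ln (1 + k * (1 - gamma ^+ t.-1) / (lam * n%:R * g * (1 - gamma))).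
have J0 : 0 <= J by rewrite ln_ge0// lerDl.
have J1 : J <= (1 + U1) * ell.
  apply: le_trans info_le; rewrite ler_ln ?posrE ?ltr_wpDr//.
    rewrite lerD2l ler_pM2r ?invr_gt0// ler_piMr ?(ltW k0)//.
    by rewrite gerBl exprn_ge0// ltW.
  by rewrite divr_ge0// ltW.
have n1 : 1 <= n%:R :> K by rewrite ler1n.
have e0 := eta0.
set c1 := 2 * eta * (1 + R ^+ 2 / (g * k)).
have c10 : 0 <= c1.
  apply: mulr_ge0; first by rewrite mulr_ge0// ltW.
  by rewrite addr_ge0// divr_ge0 ?sqr_ge0// mulr_ge0// ltW.
set c2 := 2 * eta * (3 * eta + 2^-1).
have c20 : 0 <= c2 by rewrite mulr_ge0 ?addr_ge0 ?invr_ge0 ?mulr_ge0 ?(ltW e0).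
have ell0 : 0 <= ell := le_trans ler01 ell1.
set Cl := 6 * eta * R * k * S / g + 32 * alpha * R ^+ 2 / 7 + k / g.
have q1 : 0 <= 6 * eta * R * k * S / g by rewrite divr_ge0 ?mulr_ge0// ltW.
have q2 : 0 <= 32 * alpha * R ^+ 2 / 7.
  by rewrite divr_ge0 ?mulr_ge0 ?sqr_ge0// ltW.
have q3 : 0 <= k / g by rewrite divr_ge0// ltW.
have Cl0 : 0 <= Cl by rewrite !addr_ge0.
have lamC : lam <= Cl * n%:R.
  rewrite /lam /lambda_glb !ge_max; apply/andP; split; last (apply/andP; split).
  - apply: le_trans (_ : Cl <= _); first by rewrite /Cl -addrA lerDl addr_ge0.
    by rewrite ler_peMr.
  - rewrite (_ : 32 * alpha * n%:R * R ^+ 2 / 7 = (32 * alpha * R ^+ 2 / 7) * n%:R); last by ring.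
    by rewrite ler_pM2r// /Cl addrAC lerDr addr_ge0.
  - apply: le_trans (_ : Cl <= _); last by rewrite ler_peMr.
    apply: (@le_trans _ _ (k / g)); first by rewrite ler_pM2r ?invr_gt0.
    by rewrite /Cl lerDr addr_ge0.
have s1 : 0 <= 4 * lam * S ^+ 2 by rewrite !mulr_ge0 ?sqr_ge0// ltW.
have nl : 1 <= n%:R * ell by rewrite mulr_ege1.
have nl' : ell <= n%:R * ell by rewrite ler_peMl.
apply/andP; split.
  rewrite /radius -/c1 -/c2 -/J; apply: addr_ge0; first apply: addr_ge0 => //.
    exact: mulr_ge0.
  by apply: mulr_ge0 => //; rewrite mulr_ge0// ltW.
have -> : radius_const R S g k * n%:R * ell =
   4 * (Cl * n%:R) * S ^+ 2 * ell + c1 * (2 * (n%:R * ell)) + c2 * n%:R * ((1 + U1) * ell).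
  by rewrite /radius_const -/eta -/alpha -/U1 -/Cl -/c1 -/c2; ring.
rewrite /radius -/c1 -/c2 -/J; apply: lerD; first apply: lerD.
- apply: (@le_trans _ _ (4 * (Cl * n%:R) * S ^+ 2)).
    by rewrite ler_wpM2r ?sqr_ge0// ler_pM2l.
  by rewrite ler_peMr// mulr_ge0 ?sqr_ge0// mulr_ge0// mulr_ge0// ltW.
- by rewrite ler_wpM2l// (le_trans L1)// ler_pM2l.
- by rewrite ler_wpM2l// mulr_ge0// ltW.
Qed.

(** Probability enters the analysis of a trajectory through this hypothesis alone; the rest of the
    section is deterministic. *)
Hypothesis wealth_le : forall t, (1 <= t <= T)%N ->
  (mixture_wealth m R S g k lam gamma x r th H thstar t <= (expR (Lt t))%:E)%E.

Let dl t := l2norm (thstar t.+1 - thstar t).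
(** The rate is [sqrt gamma] because drifts enter the confidence bound squared with weights [gamma]:
    the square root of such a sum is a norm that contracts by [sqrt gamma] per round. *)
Let F := wsum (Num.sqrt gamma) dl.
Let KD := drift_const R S g k.
Let bias t := Num.sqrt (KD / (1 - gamma)) * F t.

Let dl0 t : 0 <= dl t. Proof. exact: l2norm_ge0. Qed.

Let F1 : F 1%N = 0. Proof. exact: wsum1. Qed.

Let FS t : (1 <= t)%N -> F t.+1 = Num.sqrt gamma * F t + dl t.
Proof. exact: wsumS. Qed.

Let F0 t : 0 <= F t.
Proof. by rewrite sumr_ge0// => s _; rewrite mulr_ge0 ?exprn_ge0 ?sqrtr_ge0. Qed.

Let KD0 : 0 <= KD.
Proof.
have e0 := ltW eta0; have g0' := ltW g0; have k0' := ltW k0.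
have c0 : 0 <= 1 + g * k / R ^+ 2 by rewrite addr_ge0// divr_ge0 ?sqr_ge0// mulr_ge0.
rewrite /KD /drift_const -/eta; apply: mulr_ge0; first exact: mulr_ge0.
apply: divr_ge0 => //; apply: mulr_ge0; last exact: expR_ge0.
by apply: mulr_ge0 => //; apply: divr_ge0.
Qed.

Let confidence t : (1 <= t <= T)%N -> mxnorm (H t) (th t - thstar t) <= be t + bias t.
Proof.
move=> tT; have /andP[g0' g1] := gamma01; have h1g : 0 < 1 - gamma by rewrite subr_gt0.
have [hH _] := HP (leT1 tT).
have /andP[rad0 _] := radius_bounds tT.
have b0 : 0 <= be t by rewrite sqrtr_ge0.
have bi0 : 0 <= bias t by rewrite mulr_ge0 ?sqrtr_ge0.
rewrite -ler_sqr ?nnegrE ?mxnorm_ge0 ?addr_ge0//.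
rewrite sqr_mxnorm; last exact: spd_ge0.
apply: (@le_trans _ _ (be t ^+ 2 + bias t ^+ 2)); last first.
  by have := mulr_ge0 b0 bi0; rewrite sqrrD mulr2n; move: (be t) (bias t) => p q; lra.
rewrite /beta sqr_sqrtr; last exact: rad0.
have := confidence_le n0 R0 S0 g0 k0 gamma01 dm dm1 dm2 sc m2k lam_omd lam_mix x1
  th1S' H1 th_upd H_upd thstarS tT (wealth_le tT).
move=> conf; apply: le_trans conf _; rewrite lerD2l -/(drift_const R S g k) -/KD.
rewrite /bias exprMn sqr_sqrtr; last by rewrite divr_ge0// ltW.
rewrite -[leRHS]mulrA; apply: ler_wpM2l => //; rewrite mulrC.
apply: (@wsum_sqr_drift K gamma (fun s t => l2norm (thstar t - thstar s)) dl F T) => //.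
- by move=> s t'; exact: l2norm_ge0.
- move=> s t' _ _; rewrite /dl [leRHS]addrC.
  have -> : thstar t'.+1 - thstar s = (thstar t'.+1 - thstar t') + (thstar t' - thstar s).
    by rewrite addrA subrK.
  exact: l2normD.
- by move=> t' _; rewrite subrr l2normE dotv0r sqrtr0.
Qed.

Let sum_sqr_norm : \sum_(1 <= t < T.+1) mxnorm (invmx (H t)) (x t) ^+ 2 <=
  g / cmu * (1 + U1) ^+ 2 * (1 + (1 - gamma) * T%:R) * n%:R * ell.
Proof.
have /andP[g0' g1] := gamma01; have h1g : 0 < 1 - gamma by rewrite subr_gt0.
have gc : 0 < g / cmu by rewrite divr_gt0.
have U1p : 0 < 1 + U1 by rewrite addr_gt0.
have c0 : 0 <= g / cmu * (1 + U1) by rewrite mulr_ge0 ?ltW.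
have hu t : (1 <= t <= T)%N ->
    mxnorm (invmx (H t)) (x t) ^+ 2 <= g / cmu * (1 + U1) * ln (1 + u t).
  move=> tT; apply: le_trans (xnorm_le tT) _; rewrite -[leRHS]mulrA ler_pM2l//.
  have u0 : 0 <= u t.
    by rewrite mulr_ge0 ?divr_ge0 ?(sc_ge0 R0 sc) ?(ltW g0)//;
      have [hA _ _] := AP (leT1 tT); exact/spd_ge0/spd_inv.
  have uU : u t <= U1.
    have ul := u_le n0 R0 S0 g0 gamma01 sc m2k lam_mix x1 th1S' H1 th_upd H_upd tT.
    apply: (le_trans ul); apply: le_trans kglam _.
    by rewrite ler_pdivrMr// ler_peMr ?(ltW U10)// ler1n.
  by apply: le_ln1D; rewrite u0.
apply: (@le_trans _ _ (\sum_(1 <= t < T.+1) (g / cmu * (1 + U1) * ln (1 + u t)))).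
  exact: ler_sum_nat.
rewrite -mulr_sumr.
have := sum_ln_u n0 R0 S0 g0 k0 gamma01 sc m2k lam_mix x1 th1S' H1 th_upd H_upd.
move=> lnu; apply: (le_trans (ler_wpM2l c0 lnu)).
have -> : g / cmu * (1 + U1) ^+ 2 * (1 + (1 - gamma) * T%:R) * n%:R * ell =
  g / cmu * (1 + U1) * ((1 + (1 - gamma) * T%:R) * (n%:R * ((1 + U1) * ell))) by ring.
apply: ler_wpM2l => //; apply: ler_wpM2l.
  by rewrite addr_ge0// mulr_ge0// ltW.
by rewrite ler_pM2l// info_le.
Qed.

Lemma regret_le_of_wealth :
  dyn_regret m T thstar xstar x <= regret_const R S g k * ell *
   ((n%:R * Num.sqrt T%:R + n%:R * T%:R * Num.sqrt (1 - gamma)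
     + path_length T thstar / ((1 - gamma) * Num.sqrt (1 - gamma))) / Num.sqrt cmu).
Proof.
have /andP[g0' g1] := gamma01; have h1g : 0 < 1 - gamma by rewrite subr_gt0.
have k0' := ltW k0; have ell0 : 0 <= ell := le_trans ler01 ell1.
have T0 : (0 < T)%N := ltn_trans (isT : (0 < 1)%N) T2.
have T0' : 0 < T%:R :> K by rewrite ltr0n.
pose rc := radius_const R S g k.
set Bm := Num.sqrt (rc * n%:R * ell).
have beB t : (1 <= t <= T)%N -> be t <= Bm.
  move=> tT; have /andP[r0 r1] := radius_bounds tT.
  by rewrite /beta ler_wsqrtr.
set N := fun t => mxnorm (invmx (H t)) (x t).
have round t : (1 <= t < T.+1)%N ->
    link m (dotv (xstar t) (thstar t)) - link m (dotv (x t) (thstar t)) <=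
    2 * k * Bm * N t + 2 * k / Num.sqrt lam * bias t.
  move=> tT; have [hH Hl] := HP (leT1 tT).
  have b0 : 0 <= be t by rewrite sqrtr_ge0.
  have bi0 : 0 <= bias t by rewrite mulr_ge0 ?sqrtr_ge0.
  have t1 : (1 <= t)%N by case/andP: tT.
  have [xsX _] := xstarP tT.
  have := optimism_gap_le hH lam0 Hl b0 bi0 (X1 tT) (domd_play alg tT) xsX (confidence tT).
  move=> gap.
  have B0 : 0 <= 2 * be t * N t + 2 * bias t / Num.sqrt lam.
    by rewrite addr_ge0 ?divr_ge0 ?mulr_ge0 ?sqrtr_ge0.
  have xsS : - S <= dotv (xstar t) (thstar t) <= S.
    by apply: dotv_ball (thstarS t1); exact: X1 xsX.
  have xS : - S <= dotv (x t) (thstar t) <= S by apply: dotv_ball (thstarS t1); exact: x1.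
  have := link_gap_le dm1 (fun z => sc_ge0 R0 sc z) m2k xsS xS k0' B0 gap.
  move=> h'; apply: le_trans h' _; rewrite mulrDr; apply: lerD.
    rewrite mulrA; apply: ler_wpM2r; first exact: mxnorm_ge0.
    by rewrite mulrCA mulrA ler_wpM2l ?mulr_ge0// beB.
  by rewrite le_eqVlt; apply/orP; left; apply/eqP; ring.
rewrite /dyn_regret; apply: (le_trans (ler_sum_nat round)).
rewrite big_split/= -!mulr_sumr.
have rc0 : 0 <= rc.
  have T11 : (1 <= 1 <= T)%N by rewrite T0.
  have /andP[r0 r1] := radius_bounds T11.
  have : 0 <= rc * n%:R * ell := le_trans r0 r1.
  by rewrite -mulrA pmulr_lge0// mulr_gt0// (lt_le_trans ltr01 ell1).
have U1p : 0 < 1 + U1 by rewrite addr_gt0.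
have sc0 : 0 < Num.sqrt cmu by rewrite sqrtr_gt0.
set sT := Num.sqrt T%:R; set sg := Num.sqrt (1 - gamma).
have sT0 : 0 < sT by rewrite sqrtr_gt0.
have sg0 : 0 < sg by rewrite sqrtr_gt0.
have sT2 : sT ^+ 2 = T%:R by rewrite sqr_sqrtr// ltW.
have sg2 : sg ^+ 2 = 1 - gamma by rewrite sqr_sqrtr// ltW.
have ellp : 0 < ell := lt_le_trans ltr01 ell1.
have part1 : Bm * (\sum_(1 <= t < T.+1) N t) <=
    Num.sqrt (rc * g) * (1 + U1) * ell * ((n%:R * sT + n%:R * T%:R * sg) / Num.sqrt cmu).
  set Q := g / cmu * (1 + U1) ^+ 2 * (1 + (1 - gamma) * T%:R) * n%:R * ell.
  have Q0 : 0 < Q.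
    rewrite /Q !mulr_gt0 ?invr_gt0// ?exprn_gt0// addr_gt0// mulr_gt0//.
  have sN : \sum_(1 <= t < T.+1) N t <= Num.sqrt (T%:R * Q).
    exact: sum_le_sqrt Q0 T0 sum_sqr_norm.
  apply: (le_trans (ler_wpM2l (sqrtr_ge0 _) sN)).
  have rg0 : 0 <= rc * g by rewrite mulr_ge0// ltW.
  have y0 : 0 <= (n%:R * sT + n%:R * T%:R * sg) / Num.sqrt cmu.
    by rewrite divr_ge0 ?(ltW sc0)// addr_ge0// !mulr_ge0// ltW.
  have Y0 : 0 <= Num.sqrt (rc * g) * (1 + U1) * ell.
    by rewrite !mulr_ge0 ?sqrtr_ge0// ltW.
  rewrite -ler_sqr ?nnegrE ?(mulr_ge0 Y0 y0) ?(mulr_ge0 (sqrtr_ge0 _) (sqrtr_ge0 _))//.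
  have i0 : 0 <= rc * n%:R * ell by rewrite !mulr_ge0// ltW.
  have i1 : 0 <= T%:R * Q by rewrite mulr_ge0// ltW.
  rewrite !exprMn exprVn !sqr_sqrtr// ?(ltW cmu0)//.
  have -> : rc * n%:R * ell * (T%:R * Q) = rc * g * (1 + U1) ^+ 2 * ell ^+ 2 *
      (n%:R ^+ 2 * (T%:R + T%:R ^+ 2 * (1 - gamma)) / cmu).
    by rewrite /Q; field; rewrite gt_eqF.
  apply: ler_wpM2l; first by apply: mulr_ge0; rewrite ?sqr_ge0// mulr_ge0 ?sqr_ge0.
  rewrite ler_pM2r ?invr_gt0// -sT2 -sg2.
  (* Dropping this cross term is the inequality [sqrt (T + T^2 (1 - gamma)) <= sqrt T + T sqrt (1 -
     gamma)], compared through squares. *)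
  have -> : (n%:R * sT + n%:R * sT ^+ 2 * sg) ^+ 2 = n%:R ^+ 2 * (sT ^+ 2 + (sT ^+ 2) ^+ 2 * sg ^+ 2)
     + 2 * (n%:R ^+ 2 * sT ^+ 3 * sg) by ring.
  rewrite lerDl mulr_ge0// mulr_ge0 ?(ltW sg0)// mulr_ge0 ?sqr_ge0//.
  by rewrite exprn_ge0// ltW.
have part2 : Num.sqrt (KD / (1 - gamma)) * (\sum_(1 <= t < T.+1) F t) / Num.sqrt lam <=
    2 * Num.sqrt (KD * g) * (path_length T thstar / ((1 - gamma) * sg) / Num.sqrt cmu).
  have P0 : 0 <= path_length T thstar by rewrite sumr_ge0// => t _; exact: l2norm_ge0.
  have sF := discounted_path_sum gamma01 dl0 F1 FS T0.
  have kd : Num.sqrt (KD / (1 - gamma)) = Num.sqrt KD / sg.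
    by rewrite sqrtrM// sqrtrV// ltW.
  (* The third term [cmu / g] of [lambda] is used here. *)
  have il : (Num.sqrt lam)^-1 <= Num.sqrt g / Num.sqrt cmu.
    rewrite -sqrtrV ?(ltW lam0)// -sqrtrV ?(ltW cmu0)// -sqrtrM ?(ltW g0)//.
    by rewrite ler_wsqrtr// -[g / cmu]invrK invf_div lef_pV2 ?posrE// divr_gt0.
  rewrite kd [Num.sqrt (KD * g)]sqrtrM//.
  have -> : 2 * (Num.sqrt KD * Num.sqrt g) *
      (path_length T thstar / ((1 - gamma) * sg) / Num.sqrt cmu) =
    Num.sqrt KD / sg * (2 * path_length T thstar / (1 - gamma)) * (Num.sqrt g / Num.sqrt cmu).
    by field; rewrite !gt_eqF.
  have kd0 : 0 <= Num.sqrt KD / sg by rewrite divr_ge0 ?sqrtr_ge0.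
  apply: ler_pM => //; rewrite ?invr_ge0 ?sqrtr_ge0//.
    by rewrite mulr_ge0// sumr_ge0.
  by rewrite ler_wpM2l.
have Y0 : 0 <= path_length T thstar / ((1 - gamma) * sg) / Num.sqrt cmu.
  rewrite !divr_ge0 ?mulr_ge0 ?(ltW sg0) ?(ltW sc0) ?(ltW h1g)//.
  by rewrite sumr_ge0// => t _; exact: l2norm_ge0.
have Y1 : 0 <= (n%:R * sT + n%:R * T%:R * sg) / Num.sqrt cmu.
  by rewrite divr_ge0 ?(ltW sc0)// addr_ge0// !mulr_ge0// ltW.
set y1 := (n%:R * sT + _) / _ in Y1 part1; set y2 := path_length _ _ / _ / _ in Y0 part2.
set c1 := Num.sqrt (rc * g) * (1 + U1) in part1.
set c2 := Num.sqrt (KD * g) in part2.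
have c10 : 0 <= c1 by rewrite mulr_ge0 ?sqrtr_ge0// ltW.
have c20 : 0 <= c2 by rewrite sqrtr_ge0.
rewrite [X in _ <= _ * X]mulrDl -/y1 -/y2.
have -> : regret_const R S g k = 2 * k * c1 + 4 * k * c2.
  by rewrite /regret_const -/U1 -/KD -/rc -/c2 /c1; ring.
set s1 := \sum_(_ <= _ < _) _ in part1 *; set s2 := Num.sqrt _ * _ in part2 *.
have -> : 2 * k / Num.sqrt lam * s2 = 2 * k * (s2 / Num.sqrt lam) by ring.
clearbody c1 c2 y1 y2 s1 s2 Bm.
have p1 : 2 * k * Bm * s1 <= 2 * k * (c1 * ell * y1).
  by rewrite -[leLHS]mulrA ler_wpM2l// mulr_ge0.
have p2 : 2 * k * (s2 / Num.sqrt lam) <= 2 * k * (2 * c2 * y2 * ell).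
  rewrite ler_wpM2l ?mulr_ge0//; apply: (le_trans part2).
  by rewrite ler_peMr ?ell1// !mulr_ge0.
apply: (le_trans (lerD p1 p2)); rewrite -subr_ge0.
have -> : (2 * k * c1 + 4 * k * c2) * ell * (y1 + y2)
    - (2 * k * (c1 * ell * y1) + 2 * k * (2 * c2 * y2 * ell))
  = 2 * k * ell * (c1 * y2 + 2 * c2 * y1) by ring.
by rewrite mulr_ge0 ?mulr_ge0// addr_ge0 ?mulr_ge0.
Qed.

End DomdRegret.

(** * Measurability of the iterates *)

Section MxMeasurable.
Context {d : measure_display} {T : measurableType d} {K : realType}.

Lemma measurable_bigsum I (s : seq I) (P : pred I) (F : I -> T -> K) :
  (forall i, measurable_fun setT (F i)) ->
  measurable_fun setT (fun w => \sum_(i <- s | P i) F i w).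
Proof.
move=> mF; elim: s => [|i s IH].
  by under eq_fun do rewrite big_nil; exact: measurable_cst.
under eq_fun do rewrite big_cons; case: (P i) => //.
exact: measurable_funD.
Qed.

Lemma measurable_bigprod I (s : seq I) (P : pred I) (F : I -> T -> K) :
  (forall i, measurable_fun setT (F i)) ->
  measurable_fun setT (fun w => \prod_(i <- s | P i) F i w).
Proof.
move=> mF; elim: s => [|i s IH].
  by under eq_fun do rewrite big_nil; exact: measurable_cst.
under eq_fun do rewrite big_cons; case: (P i) => //.
exact: measurable_funM.
Qed.

(** Stated by coordinates to match [history], which the coordinates generate. *)
Definition mx_measurable p q (f : T -> 'M[K]_(p, q)) :=
  forall i j, measurable_fun setT (fun w => f w i j).

Lemma mx_measurable_cst p q (A : 'M[K]_(p, q)) : mx_measurable (fun=> A).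
Proof. by move=> i j; exact: measurable_cst. Qed.

Lemma mx_measurableD p q (f g : T -> 'M[K]_(p, q)) :
  mx_measurable f -> mx_measurable g -> mx_measurable (fun w => f w + g w).
Proof.
by move=> mf mg i j; under eq_fun do rewrite mxE; exact: measurable_funD.
Qed.

Lemma mx_measurableZ p q (a : T -> K) (f : T -> 'M[K]_(p, q)) :
  measurable_fun setT a -> mx_measurable f -> mx_measurable (fun w => a w *: f w).
Proof.
by move=> ma mf i j; under eq_fun do rewrite mxE; exact: measurable_funM.
Qed.

Lemma mx_measurableB p q (f g : T -> 'M[K]_(p, q)) :
  mx_measurable f -> mx_measurable g -> mx_measurable (fun w => f w - g w).
Proof.
by move=> mf mg i j; under eq_fun do rewrite !mxE; exact: measurable_funB.
Qed.

Lemma mx_measurable_tr p q (f : T -> 'M[K]_(p, q)) :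
  mx_measurable f -> mx_measurable (fun w => (f w)^T).
Proof. by move=> mf i j; under eq_fun do rewrite mxE; exact: mf. Qed.

Lemma mx_measurableM p q r (f : T -> 'M[K]_(p, q)) (g : T -> 'M[K]_(q, r)) :
  mx_measurable f -> mx_measurable g -> mx_measurable (fun w => f w *m g w).
Proof.
move=> mf mg i j; under eq_fun do rewrite mxE.
by apply: measurable_bigsum => l; exact: measurable_funM.
Qed.

Lemma mx_measurable_scalar n (a : T -> K) :
  measurable_fun setT a -> mx_measurable (fun w => (a w)%:M : 'M[K]_n).
Proof.
move=> ma i j; under eq_fun do rewrite mxE.
by case: (i == j); [under eq_fun do rewrite mulr1n|exact: measurable_cst].
Qed.

Lemma measurable_dotv n (f g : T -> 'cV[K]_n) :
  mx_measurable f -> mx_measurable g -> measurable_fun setT (fun w => dotv (f w) (g w)).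
Proof. by move=> mf mg; apply: mx_measurableM => //; exact: mx_measurable_tr. Qed.

Lemma measurable_qf n (M : T -> 'M[K]_n) (g : T -> 'cV[K]_n) :
  mx_measurable M -> mx_measurable g -> measurable_fun setT (fun w => qf (M w) (g w)).
Proof.
move=> mM mg; apply: mx_measurableM => //; apply: mx_measurableM => //.
exact: mx_measurable_tr.
Qed.

Lemma measurable_det n (M : T -> 'M[K]_n) :
  mx_measurable M -> measurable_fun setT (fun w => \det (M w)).
Proof.
move=> mM; apply: measurable_bigsum => s; apply: measurable_funM => //.
by apply: measurable_bigprod => i; exact: mM.
Qed.

Lemma mx_measurable_inv n (M : T -> 'M[K]_n) : (forall w, spd (M w)) ->
  mx_measurable M -> mx_measurable (fun w => invmx (M w)).
Proof.
move=> sM mM.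
(* Cramer's rule, with the reciprocal of the positive determinant written as a real power, whose
   measurability is at hand. *)
have -> : (fun w => invmx (M w)) = fun w => (\det (M w)) `^ (-1) *: \adj (M w).
  apply/funext => w; have uM := spd_unit (sM w).
  by rewrite /invmx uM powR_inv1// ltW// spd_det_gt0.
apply: mx_measurableZ.
  exact: (measurableT_comp (@measurable_powR K (-1)) (measurable_det mM)).
move=> i j; under eq_fun do rewrite mxE.
apply: measurable_funM => //; apply: measurable_det => k l.
by under eq_fun do rewrite !mxE; exact: mM.
Qed.

Lemma measurable_sqrt (f : T -> K) :
  measurable_fun setT f -> measurable_fun setT (fun w => Num.sqrt (f w)).
Proof.
move=> mf; apply: (measurableT_comp _ mf).
by apply: continuous_measurable_fun => x; exact: sqrt_continuous.
Qed.

End MxMeasurable.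

(** * Measurability of constrained minimizers *)

Section MeasurableArgmin.
Context {K : realType} {n : nat}.

Definition rat_pt (i : nat) : 'cV[K]_n :=
  map_mx ratr (odflt 0 (choice.unpickle i : option 'cV[rat]_n)).

Lemma rat_pt_dense (v : 'cV[K]_n) (e : K) : 0 < e ->
  exists i, forall j, `|rat_pt i j 0 - v j 0| <= e.
Proof.
move=> e0.
have hq (j : 'I_n) : exists q : rat, `|ratr q - v j 0| <= e.
  have /rat_in_itvoo[q] : v j 0 - e < v j 0 + e by rewrite ltrBlDr -addrA ltrDl addr_gt0.
  rewrite in_itv/= => /andP[q1 q2]; exists q.
  by rewrite ler_distl; apply/andP; split; exact: ltW.
pose Q : 'cV[rat]_n := \col_j xchoose (hq j).
exists (choice.pickle Q) => j; rewrite /rat_pt choice.pickleK/= !mxE.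
exact: (xchooseP (hq j)).
Qed.

Lemma norm_coord_le (v : 'cV[K]_n) j : `|v j 0| <= l2norm v.
Proof.
rewrite -ler_sqr ?nnegrE ?l2norm_ge0// real_normK ?num_real// sqr_l2norm dotvE.
rewrite (bigD1 j)//= -expr2 lerDl sumr_ge0// => i _.
by rewrite -expr2 sqr_ge0.
Qed.

Lemma l2norm_le_sup (v : 'cV[K]_n) (e : K) : 0 <= e -> (forall j, `|v j 0| <= e) ->
  l2norm v <= n%:R * e.
Proof.
move=> e0 ve; rewrite -ler_sqr ?nnegrE ?l2norm_ge0 ?mulr_ge0// sqr_l2norm dotvE.
apply: (@le_trans _ _ (\sum_(i < n) e ^+ 2)).
  apply: ler_sum => i _; rewrite -expr2 -[leLHS]real_normK ?num_real//.
  by rewrite ler_sqr ?nnegrE.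
rewrite sumr_const card_ord exprMn -[_ *+ n]mulr_natl ler_wpM2r ?sqr_ge0//.
by rewrite -natrX ler_nat; case: (n) => // k; rewrite leq_pmulr.
Qed.

(* Shrinking [v] first ensures that rounding does not leave the ball. *)
Lemma rat_pt_dense_ball (S : K) (v : 'cV[K]_n) (e : K) : 0 < S -> l2ball S v ->
  0 < e -> exists i, l2ball S (rat_pt i) /\ forall j, `|rat_pt i j 0 - v j 0| <= e.
Proof.
move=> S0 vS e0.
pose a := Num.min S (e / 2).
have a0 : 0 < a by rewrite lt_min S0 divr_gt0.
have aS : a <= S by rewrite ge_min lexx.
have ae : a <= e / 2 by rewrite ge_min lexx orbT.
have n1 : 0 < n.+1%:R :> K by rewrite ltr0n.
have [i hi] := rat_pt_dense ((1 - a / S) *: v) (divr_gt0 a0 n1).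
have aSi : 0 <= a / S <= 1 by rewrite divr_ge0 ?(ltW a0) ?(ltW S0)//= ler_pdivrMr// mul1r.
have /andP[aS0 aS1] := aSi.
exists i; split=> [|j].
  have -> : rat_pt i = (rat_pt i - (1 - a / S) *: v) + (1 - a / S) *: v by rewrite subrK.
  rewrite /l2ball/=; apply: le_trans (l2normD _ _) _.
  have h1 : l2norm (rat_pt i - (1 - a / S) *: v) <= a.
    apply: le_trans (l2norm_le_sup (e := a / n.+1%:R) _ _) _.
    - by rewrite divr_ge0// ltW.
    - by move=> j; rewrite mxE [in X in _ + X]mxE; exact: hi.
    - by rewrite mulrCA ler_piMr ?(ltW a0)// ler_pdivrMr// mul1r ler_nat.
  have h2 : l2norm ((1 - a / S) *: v) <= S - a.
    rewrite l2normZ ger0_norm ?subr_ge0//.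
    apply: le_trans (ler_wpM2l _ (vS : l2norm v <= S)) _; first by rewrite subr_ge0.
    by rewrite mulrBl mul1r divfK// gt_eqF.
  by have := lerD h1 h2; rewrite [leRHS]addrC subrK.
have -> : rat_pt i j 0 - v j 0 = (rat_pt i j 0 - ((1 - a / S) *: v) j 0) - a / S * v j 0.
  by rewrite [((1 - a / S) *: v) j 0]mxE; ring.
apply: le_trans (ler_normB _ _) _.
have h1 : a / n.+1%:R <= e / 2.
  by apply: le_trans ae; rewrite ler_pdivrMr// ler_peMr ?(ltW a0)// ler1n.
have h2 : `|a / S * v j 0| <= e / 2.
  rewrite normrM ger0_norm//; apply: le_trans ae.
  have aE : a / S * S = a by rewrite divfK// gt_eqF.
  by rewrite -[leRHS]aE ler_wpM2l//; exact: le_trans (norm_coord_le v j) vS.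
by rewrite [leRHS]splitr; apply: lerD => //; exact: le_trans (hi j) h1.
Qed.

Context {d : measure_display} {T : measurableType d}.

(** The minimizer is the pointwise limit of the best among the first [i] rational points of the
    ball. The bound with [C] makes their values tend to the minimum, and the growth with [c] then
    makes the points tend to the minimizer. Both constants may vary with [w] in any manner, since
    convergence is only pointwise. *)
Lemma mx_measurable_argmin (S : K) (c : T -> K) (C : T -> K) (f : T -> 'cV[K]_n -> K)
    (th : T -> 'cV[K]_n) : 0 < S ->
  (forall u, mx_measurable u -> measurable_fun setT (fun w => f w (u w))) ->
  (forall w, argmin (l2ball S) (f w) (th w)) ->
  (forall w, 0 < c w) ->
  (forall w u, l2ball S u -> c w * dotv (u - th w) (u - th w) <= f w u - f w (th w)) ->
  (forall w (e : K) (u : 'cV[K]_n), 0 <= e <= 1 -> (forall j, `|u j 0 - th w j 0| <= e) ->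
     f w u <= f w (th w) + C w * e) ->
  mx_measurable th.
Proof.
move=> S0 mf thP c0 fc fC.
have z_in : l2ball S (0 : 'cV[K]_n) by rewrite /l2ball/= l2normE dotv0r sqrtr0 ltW.
(* Rational points outside the ball are replaced by its centre, so that every candidate is
   admissible. *)
pose q i := if l2norm (rat_pt i) <= S then rat_pt i else 0.
have qS i : l2ball S (q i) by rewrite /q; case: ifPn.
pose v := fix v i w := if i is j.+1 then
   (if f w (q j) < f w (v j w) then q j else v j w) else 0.
have vS i w : l2ball S (v i w) by elim: i => //= i IH; case: ifP.
have mv i : mx_measurable (v i).
  elim: i => [|i IH]; first exact: mx_measurable_cst.
  move=> j l /=.
  rewrite (_ : (fun w => _) = fun w => if f w (q i) < f w (v i w) then q i j l else v i w j l).
    apply: measurable_fun_ifT; [|exact: measurable_cst|exact: IH].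
    by apply: measurable_fun_ltr; apply: mf => //; exact: mx_measurable_cst.
  by apply/funext => w; case: ifP.
have vle w i j : (i < j)%N -> f w (v j w) <= f w (q i).
  elim: j => // j IH; rewrite ltnS leq_eqVlt => /orP[/eqP->|ij] /=.
    by case: ltP.
  by case: ltP => [/ltW h|_]; [exact: le_trans h (IH ij)|exact: IH].
move=> j l; rewrite ord1.
apply: (@measurable_fun_cvg _ _ _ setT (fun i w => v i w j 0)) => [i|w _].
  exact: mv.
apply/cvgrPdist_le => e e0.
have C0 : 0 <= C w.
  have := fC w 1 (th w); rewrite ler01 lexx mulr1 => /(_ isT) h.
  have : f w (th w) <= f w (th w) + C w by apply: h => i; rewrite subrr normr0.
  by rewrite lerDl.
(* Small enough that the excess [C w * e'] forces a distance at most [e]; the cap 1 is the range in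
   which [C] is assumed to work. *)
pose e' := Num.min 1 (c w * e ^+ 2 / (C w + 1)).
have C1 : 0 < C w + 1 by rewrite ltr_wpDl.
have e'0 : 0 < e' by rewrite lt_min ltr01 divr_gt0// mulr_gt0// exprn_gt0.
have [thS _] := thP w.
have [i [iS hi]] := rat_pt_dense_ball S0 thS e'0.
have qi : q i = rat_pt i by rewrite /q (iS : _ <= _).
exists i.+1 => // p /= ip.
have h1 := vle w i p ip.
have h2 : f w (q i) <= f w (th w) + C w * e'.
  by apply: fC; rewrite ?(ltW e'0) ?ge_min ?lexx// qi.
have h3 := fc w (v p w) (vS p w).
have h4 : C w * e' <= c w * e ^+ 2.
  apply: (@le_trans _ _ ((C w + 1) * e')).
    by rewrite ler_wpM2r ?lerDl// ltW.
  by rewrite mulrC -ler_pdivlMr// ge_min lexx orbT.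
have h5 : dotv (v p w - th w) (v p w - th w) <= e ^+ 2.
  by rewrite -(ler_pM2l (c0 w)); lra.
rewrite distrC; have := norm_coord_le (v p w - th w) j; rewrite !mxE => h6.
apply: le_trans h6 _; rewrite -ler_sqr ?nnegrE ?l2norm_ge0 ?(ltW e0)//.
by rewrite sqr_l2norm.
Qed.

End MeasurableArgmin.

Lemma dotv_le_coord (K : realType) n (v u : 'cV[K]_n) (e : K) :
  (forall j, `|u j 0| <= e) -> dotv v u <= (\sum_j `|v j 0|) * e.
Proof.
move=> ue; rewrite dotvE mulr_suml; apply: ler_sum => j _.
by apply: le_trans (ler_norm _) _; rewrite normrM ler_wpM2l.
Qed.

Lemma qf_le_coord (K : realType) n (M : 'M[K]_n) (u : 'cV[K]_n) (e : K) :
  0 <= e <= 1 -> (forall j, `|u j 0| <= e) ->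
  qf M u <= (\sum_i \sum_j `|M i j|) * e.
Proof.
move=> /andP[e0 e1] ue; rewrite qfE dotvE mulr_suml; apply: ler_sum => i _.
apply: le_trans (ler_norm _) _; rewrite normrM mulrC.
apply: ler_pM => //; rewrite mxE; apply: le_trans (ler_norm_sum _ _ _) _.
apply: ler_sum => j _; rewrite normrM ler_piMr//.
exact: le_trans (ue j) e1.
Qed.

Section IterateMeasurability.
Context {K : realType} {n : nat}.
Context (m h : K -> K) (nu : {measure set (measurableTypeR K) -> \bar K}).
Context (R S g cmu k delta : K) (T : nat).
Hypothesis n0 : (0 < n)%N.
Hypothesis R0 : 0 < R.
Hypothesis S0 : 0 < S.
Hypothesis g0 : 0 < g.
Hypothesis cmu0 : 0 < cmu.
Hypothesis hm : glm_model R S g cmu k m h nu.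
Let eta := 1 + R * S.
Let alpha := 3 * eta / 2.
Let lam := lambda_glb n R S g cmu k eta alpha.
Context {d : measure_display} {Omega : measurableType d}.
Context (gamma : Omega -> K) (th1 : 'cV[K]_n).
Context (X : nat -> Omega -> set 'cV[K]_n) (x : nat -> Omega -> 'cV[K]_n).
Context (r : nat -> Omega -> K) (th : nat -> Omega -> 'cV[K]_n).
Context (H : nat -> Omega -> 'M[K]_n).
Hypothesis gamma01 : forall w, 0 < gamma w < 1.
Hypothesis alg : forall w, domd_glb m R S g k (gamma w) lam delta eta T th1
  (X^~ w) (x^~ w) (r^~ w) (th^~ w) (H^~ w).

Let m1 := link m.
Let m2 := derive1 (link m).

Let dm (z : K) : is_derive z 1 m (m1 z).
Proof. by have [+ _ _] := glm_model_derive hm; exact. Qed.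
Let dm1 (z : K) : is_derive z 1 m1 (m2 z).
Proof. by have [_ + _] := glm_model_derive hm; exact. Qed.
Let dm2 (z : K) : is_derive z 1 m2 (derive1n 2 (link m) z).
Proof. by have [_ _ +] := glm_model_derive hm; exact. Qed.
Let sc : forall z, `|derive1n 2 (link m) z| <= R * m2 z := glm_self_concordant hm.
Let mm1 : measurable_fun setT m1.
Proof. by apply: continuous_measurable_fun; exact: der_continuous dm1. Qed.
Let mm2 : measurable_fun setT m2.
Proof. by apply: continuous_measurable_fun; exact: der_continuous dm2. Qed.

Let eta0 : 0 < eta.
Proof. by rewrite /eta addr_gt0// mulr_gt0. Qed.

Let lam0 : 0 < lam.
Proof.
have : cmu / g <= lam by rewrite /lam /lambda_glb !le_max lexx !orbT.
by apply: lt_le_trans; rewrite divr_gt0.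
Qed.

Local Notation A := (fun t w => prior_mx (gamma w) lam (H t w)).

Lemma mx_measurable_prior t : measurable_fun setT gamma ->
  mx_measurable (H t) -> mx_measurable (A t).
Proof.
move=> mg mH; apply: mx_measurableD; first exact: mx_measurableZ.
apply: mx_measurable_scalar; apply: measurable_funM => //.
exact: measurable_funB.
Qed.

(** The predicate [domd_glb] constrains the iterates on each trajectory without constructing them,
    so measurability is recovered round by round. The sigma-algebra on [Omega] is generic in order
    that the history can be substituted for it. *)
Lemma mx_measurable_iterates t : (1 <= t <= T.+1)%N -> measurable_fun setT gamma ->
  (forall s, (1 <= s < t)%N -> mx_measurable (x s)) ->
  (forall s, (1 <= s < t)%N -> measurable_fun setT (r s)) ->
  mx_measurable (th t) /\ mx_measurable (H t).
Proof.
move=> + mg; elim: t => // -[|t] IH tT mx mr.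
  split.
    rewrite (_ : th 1%N = fun=> th1); first exact: mx_measurable_cst.
    by apply/funext => w; exact: domd_th_init (alg w).
  rewrite (_ : H 1%N = fun=> lam%:M); first exact: mx_measurable_cst.
  by apply/funext => w; exact: domd_H_init (alg w).
have tT' : (1 <= t.+1 <= T)%N by [].
have [mth mH] : mx_measurable (th t.+1) /\ mx_measurable (H t.+1).
  apply: IH; first exact: ltnW.
  - by move=> s /andP[s1 st]; apply: mx; rewrite s1 ltnW.
  - by move=> s /andP[s1 st]; apply: mr; rewrite s1 ltnW.
have mxt : mx_measurable (x t.+1) by apply: mx; rewrite /= ltnS leqnn.
have mrt : measurable_fun setT (r t.+1) by apply: mr; rewrite /= ltnS leqnn.
have mA := mx_measurable_prior mg mH.
have mxx : mx_measurable (fun w => x t.+1 w *m (x t.+1 w)^T).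
  by apply: mx_measurableM => //; exact: mx_measurable_tr.
have sA w : spd (A t.+1 w) /\ forall y, lam * dotv y y <= qf (A t.+1 w) y.
  have [_ h1 h2] := domd_spd n0 R0 S0 g0 (gamma01 w) hm (alg w) (t := t.+1) (ltnW tT).
  by split.
have mdiv (q : Omega -> K) : measurable_fun setT q -> measurable_fun setT (fun w => q w / g).
  by move=> mq; exact: measurable_funM.
pose a w := dotv (x t.+1 w) (th t.+1 w).
have ma : measurable_fun setT a by exact: measurable_dotv.
pose p w := ((m1 (a w) - r t.+1 w) / g) *: x t.+1 w.
pose M w := (m2 (a w) / g) *: (x t.+1 w *m (x t.+1 w)^T) + eta^-1 *: A t.+1 w.
have mp : mx_measurable p.
  apply: mx_measurableZ => //; apply: mdiv.
  exact: (measurable_funB (measurableT_comp mm1 ma)).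
have mM : mx_measurable M.
  apply: mx_measurableD; apply: mx_measurableZ => //.
  exact: mdiv (measurableT_comp mm2 ma).
have sM w : (M w)^T = M w.
  have [[sA' _] _] := sA w.
  by rewrite linearD/= !linearZ/= trmx_mul trmxK sA'.
(* The constant term of the surrogate is replaced by 0: the minimizer is the same and the shape
   still fits [quad_argmin_growth]. *)
pose f w u := 0 + dotv (p w) (u - th t.+1 w) + 2^-1 * qf (M w) (u - th t.+1 w).
have argf w : argmin (l2ball S) (f w) (th t.+2 w).
  have [thS hmin] := domd_th_step (alg w) tT'.
  have [hA _] := sA w.
  split=> // u uS; have := hmin u uS.
  rewrite !(@omd_objectiveE K m m1 m2 _ R S g R0 S0 g0 dm dm1 sc n _ _ _ _ _ hA).
  by rewrite -!addrA !lerD2l /f !add0r.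
have mth2 : mx_measurable (th t.+2).
  apply: (@mx_measurable_argmin K n d Omega S (fun=> 2^-1 * (eta^-1 * lam))
    (fun w => \sum_j `|(p w + M w *m (th t.+2 w - th t.+1 w)) j 0|
      + \sum_i \sum_j `|M w i j|) f) => //.
  - move=> u mu; apply: measurable_funD.
      apply: measurable_funD => //; apply: measurable_dotv => //.
      exact: mx_measurableB.
    apply: measurable_funM => //; apply: measurable_qf => //.
    exact: mx_measurableB.
  - by move=> _; rewrite !mulr_gt0 ?invr_gt0.
  - move=> w u uS; have := quad_argmin_growth (sM w) (argf w) uS.
    rewrite -/(f w u) -/(f w (th t.+2 w)) => gr.
    rewrite lerBrDl; apply: le_trans gr; rewrite lerD2l -mulrA ler_pM2l ?invr_gt0//.
    rewrite /M qfD !qfZ qf_rank1; have [_ Al] := sA w.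
    rewrite -[leLHS]add0r; apply: lerD.
      by rewrite mulr_ge0 ?sqr_ge0// divr_ge0 ?(ltW g0)//; exact: sc_ge0 R0 sc _.
    by rewrite -mulrA ler_wpM2l// invr_ge0 ltW.
  - move=> w e u e01 ue; have /andP[e0 e1] := e01.
    set v := u - th t.+2 w.
    have vE : u - th t.+1 w = v + (th t.+2 w - th t.+1 w) by rewrite addrA subrK.
    have ve j : `|v j 0| <= e by rewrite !mxE; exact: ue.
    rewrite /f vE (qf_add v _ (sM w)) (dotvDr (p w) v).
    have h1 := dotv_le_coord (p w + M w *m (th t.+2 w - th t.+1 w)) ve.
    rewrite (dotvDl (p w)) (dotvC (M w *m _) v) in h1.
    have h2 := qf_le_coord (M w) e01 ve.
    have s0 : 0 <= \sum_i \sum_j `|M w i j| by rewrite sumr_ge0// => i _; rewrite sumr_ge0.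
    have := mulr_ge0 s0 e0.
    move: h1 h2; set s1 := \sum_j `|(p w + _) j 0|; set s2 := \sum_i \sum_j _.
    have -> : (s1 + s2) * e = s1 * e + s2 * e by ring.
    move: (s1 * e) (s2 * e) (qf (M w) v) (qf (M w) _) (dotv (p w) v) (dotv (p w) _) (dotv v _).
    by move=> *; lra.
split=> //.
rewrite (_ : H t.+2 = fun w => A t.+1 w + (m2 (dotv (x t.+1 w) (th t.+2 w)) / g)
    *: (x t.+1 w *m (x t.+1 w)^T)).
  apply: mx_measurableD => //; apply: mx_measurableZ => //.
  exact: mdiv (measurableT_comp mm2 (measurable_dotv mxt mth2)).
by apply/funext => w; exact: domd_H_step hm (alg w) _ tT'.
Qed.

End IterateMeasurability.

(** * The good event *)

Section Adaptedness.
Context {K : realType} {n : nat} {disp : measure_display} {Omega : measurableType disp}.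
Context (x thstar : nat -> Omega -> 'cV[K]_n) (r : nat -> Omega -> K).

(** The generators of [history], named so that inclusions between rounds are checked before closing
    under sigma-operations. *)
Definition histgen (t : nat) : set (set Omega) :=
  \bigcup_(s in [set s | (1 <= s <= t)%N]) \bigcup_(i in [set: 'I_n])
        preimage_set_system setT (fun w => x s w i 0) measurable
      `|` \bigcup_(s in [set s | (1 <= s < t)%N])
        preimage_set_system setT (r s) measurable
      `|` \bigcup_(s in [set s | (1 <= s)%N]) \bigcup_(i in [set: 'I_n])
        preimage_set_system setT (fun w => thstar s w i 0) measurable.

Lemma histgen_subset t : histgen t `<=` histgen t.+1.
Proof.
move=> A [[[s /= st hA]|[s /= st hA]]|hA]; last by right.
- by left; left; exists s => //=; case/andP: st => -> /leqW.
- by left; right; exists s => //=; case/andP: st => -> /leqW.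
Qed.

Lemma measurable_fun_gen (G : set (set Omega)) (f : Omega -> K) :
  preimage_set_system setT f measurable `<=` G ->
  measurable_fun setT (f : g_sigma_algebraType G -> K).
Proof.
move=> fG _ B mB; apply: sub_sigma_algebra; apply: fG.
by exists B.
Qed.

Lemma adapted_x s t : (1 <= s <= t)%N ->
  @mx_measurable _ (g_sigma_algebraType (histgen t)) K n 1 (x s).
Proof.
move=> st i j; rewrite ord1; apply: measurable_fun_gen => A hA.
by left; left; exists s => //; exists i.
Qed.

Lemma adapted_r s t : (1 <= s < t)%N ->
  measurable_fun setT (r s : g_sigma_algebraType (histgen t) -> K).
Proof.
by move=> st; apply: measurable_fun_gen => A hA; left; right; exists s.
Qed.

Lemma adapted_thstar s t : (1 <= s)%N ->
  @mx_measurable _ (g_sigma_algebraType (histgen t)) K n 1 (thstar s).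
Proof.
move=> s1 i j; rewrite ord1; apply: measurable_fun_gen => A hA.
by right; exists s => //; exists i.
Qed.

Lemma histgen_measurable t :
  (forall s i, (1 <= s <= t)%N -> measurable_fun setT (fun w => x s w i 0)) ->
  (forall s, (1 <= s < t)%N -> measurable_fun setT (r s)) ->
  (forall s i, (1 <= s)%N -> measurable_fun setT (fun w => thstar s w i 0)) ->
  histgen t `<=` measurable.
Proof.
move=> mx mr mth A [[[s st [i _ [B mB <-]]]|[s st [B mB <-]]]|[s s1 [i _ [B mB <-]]]].
- exact: mx.
- exact: mr.
- exact: mth.
Qed.

End Adaptedness.

Lemma markov_ge0 (K : realType) d (T : measurableType d) (P : probability T K)
    (U : T -> \bar K) (c : K) : 0 < c ->
  measurable_fun setT U -> (forall w, 0 <= U w)%E -> (\int[P]_w U w <= 1)%E ->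
  (P [set w | c%:E < U w] <= c^-1%:E)%E.
Proof.
move=> c0 mU U0 U1.
set B := [set w | _].
have mB : measurable B.
  by rewrite /B -[X in measurable X]setTI; exact: emeasurable_fun_o_infty.
have : (c%:E * P B <= 1)%E.
  rewrite -integral_cst//; apply: le_trans U1.
  apply: (@le_trans _ _ (\int[P]_(w in B) U w)%E).
    apply: ge0_le_integral => //=.
    - by move=> w _; rewrite lee_fin ltW.
    - exact: measurable_funS mU.
    - by move=> w /ltW.
  exact: ge0_subset_integral.
by move=> cB; rewrite -[X in (_ <= X)%E]mule1 lee_pdivlMl.
Qed.

(** Comparison with the telescoping sum of [1 / (i + 1) - 1 / (i + 2)]. The sum starts at 2 because
    the product of round 1 is empty. *)
Lemma sum_inv_sqr_le1 (K : realType) n : \sum_(i < n) (i.+2%:R ^+ 2)^-1 <= 1 :> K.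
Proof.
suff : \sum_(i < n) (i.+2%:R ^+ 2)^-1 <= 1 - n.+1%:R^-1 :> K.
  by move=> /le_trans; apply; rewrite gerBl invr_ge0.
elim: n => [|n IH]; first by rewrite big_ord0 invr1 subrr.
rewrite big_ord_recr/=; apply: (le_trans (lerD IH (lexx _))).
rewrite -subr_ge0.
have -> : 1 - n.+2%:R^-1 - (1 - n.+1%:R^-1 + (n.+2%:R ^+ 2)^-1) =
   (n.+1%:R * n.+2%:R ^+ 2)^-1 :> K.
  have -> : n.+2%:R = n.+1%:R + 1 :> K by rewrite -natr1.
  have : 0 < n.+1%:R :> K by rewrite ltr0n.
  move: (n.+1%:R : K) => a a0; have a1 : 0 < a + 1 by rewrite addr_gt0.
  by field; rewrite !gt_eqF.
by rewrite invr_ge0.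
Qed.

Section Wealth.
Context {K : realType} {n : nat}.
Context (m h : K -> K) (nu : {measure set (measurableTypeR K) -> \bar K}).
Context (R S g cmu k delta : K) (T : nat).
Hypothesis n0 : (0 < n)%N.
Hypothesis T2 : (2 <= T)%N.
Hypothesis R0 : 0 < R.
Hypothesis S0 : 0 < S.
Hypothesis g0 : 0 < g.
Hypothesis k0 : 0 < k.
Hypothesis cmu0 : 0 < cmu.
Hypothesis delta01 : 0 < delta < 1.
Hypothesis hm : glm_model R S g cmu k m h nu.
Let eta := 1 + R * S.
Let alpha := 3 * eta / 2.
Let lam := lambda_glb n R S g cmu k eta alpha.
Context {d : measure_display} {Omega : measurableType d} (P : probability Omega K).
Context (gamma : Omega -> K) (th1 : 'cV[K]_n) (thstar : nat -> Omega -> 'cV[K]_n).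
Context (X : nat -> Omega -> set 'cV[K]_n) (x : nat -> Omega -> 'cV[K]_n).
Context (r : nat -> Omega -> K) (th : nat -> Omega -> 'cV[K]_n).
Context (H : nat -> Omega -> 'M[K]_n).
Hypothesis bandit : glm_bandit R S g m h nu T P thstar X x r.
Hypothesis gamma01 : forall w, 0 < gamma w < 1.
Hypothesis alg : forall w, domd_glb m R S g k (gamma w) lam delta eta T th1
  (X^~ w) (x^~ w) (r^~ w) (th^~ w) (H^~ w).
(** A random discount factor is allowed provided every history knows it, which covers a tuning by
    the whole path length. *)
Hypothesis gamma_adapted : forall t, (1 <= t)%N ->
  measurable_fun setT (gamma : g_sigma_algebraType (histgen x thstar r t) -> K).

Local Notation G := (histgen x thstar r).
Local Notation wealth t w := (mixture_wealth m R S g k lam (gamma w) (x^~ w) (r^~ w)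
  (th^~ w) (H^~ w) (thstar^~ w) t).

Let G_measurable t : (1 <= t <= T)%N -> G t `<=` measurable.
Proof.
move=> /andP[t1 tT]; apply: histgen_measurable.
- move=> s i /andP[s1 st]; apply: (bandit_x_measurable bandit).
  by rewrite s1 (leq_trans st).
- move=> s /andP[s1 st]; apply: (bandit_r_measurable bandit).
  by rewrite s1 (leq_trans (ltnW st)).
- by move=> s i s1; exact: (bandit_thstar_measurable bandit).
Qed.

Let dm (z : K) : is_derive z 1 m (link m z).
Proof. by have [+ _ _] := glm_model_derive hm; exact. Qed.

Let p := (1 + R ^+ 2 / (g * k))^-1.

Let p01 : 0 <= p <= 1.
Proof.
have q0 : 0 <= R ^+ 2 / (g * k) by rewrite divr_ge0 ?sqr_ge0// mulr_ge0// ltW.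
by rewrite invr_ge0 addr_ge0//= invf_le1 ?lerDl// ltr_wpDr.
Qed.

Let wealth_mean t : (1 <= t <= T)%N ->
  [/\ measurable_fun setT (fun w => wealth t w), (forall w, 0 <= wealth t w)%E &
      (\int[P]_w wealth t w <= 1)%E].
Proof.
move=> tT; have /andP[t1 tT'] := tT.
have inT s : (1 <= s < t)%N -> (1 <= s <= T)%N.
  by move=> /andP[s1 st]; rewrite s1 (leq_trans (ltnW st)).
have iter s : (1 <= s < t)%N ->
    @mx_measurable _ (g_sigma_algebraType (G s)) K n 1 (th s) /\
    @mx_measurable _ (g_sigma_algebraType (G s)) K n n (H s).
  move=> st; have /andP[s1 sT] := inT s st.
  apply: (@mx_measurable_iterates K n m h nu R S g cmu k delta T n0 R0 S0 g0 cmu0 hm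
    _ (g_sigma_algebraType (G s)) gamma th1 X x r th H gamma01 alg s _).
  - by rewrite s1 ltnW.
  - exact: gamma_adapted.
  - by move=> q /andP[q1 qs]; apply: adapted_x; rewrite q1 ltnW.
  - by move=> q qs; exact: adapted_r.
have ax s : (1 <= s < t)%N -> @mx_measurable _ (g_sigma_algebraType (G s)) K n 1 (x s).
  by move=> /andP[s1 _]; apply: adapted_x; rewrite s1 leqnn.
(* The target parameter concerns a later round, yet every history contains it. *)
have ath s q : (1 <= q)%N -> @mx_measurable _ (g_sigma_algebraType (G s)) K n 1 (thstar q).
  by move=> q1; exact: adapted_thstar.
have g01 w : 0 <= gamma w <= 1 by have /andP[/ltW -> /ltW ->] := gamma01 w.
pose z s w := dotv (x s w) (thstar s w).
pose om s w := gamma w ^+ (t.-1 - s).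
pose a s w := dotv (x s w) (th s w).
pose sg s w := Num.sqrt (3 * (1 + R * S) / 2 *
      qf (invmx (prior_mx (gamma w) lam (H s w))) (x s w)).
pose z' s w := z s w - g * k / R ^+ 2 * dotv (x s w) (thstar t w - thstar s w).
have om01 s w : 0 <= om s w <= 1.
  by have /andP[q0 q1] := g01 w; rewrite exprn_ge0//= exprn_ile1.
have GT s : (1 <= s <= t)%N -> G s `<=` measurable.
  by move=> /andP[s1 st]; apply: G_measurable; rewrite s1 (leq_trans st).
have GS s : (1 <= s < t)%N -> <<s G s >> `<=` <<s G s.+1 >>.
  by move=> _; apply: sub_sigma_algebra2; exact: histgen_subset.
have rA s : (1 <= s < t)%N ->
    measurable_fun setT (r s : g_sigma_algebraType (G s.+1) -> K).
  by move=> /andP[s1 _]; apply: adapted_r; rewrite s1 ltnS leqnn.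
have rm s : (1 <= s < t)%N -> measurable_fun setT (r s).
  by move=> /inT; exact: bandit_r_measurable bandit s.
have zA s : (1 <= s < t)%N ->
    measurable_fun setT (z s : g_sigma_algebraType (G s) -> K).
  by move=> st; apply: (measurable_dotv (ax s st)); apply: ath; case/andP: st.
have omA s : (1 <= s < t)%N ->
    measurable_fun setT (om s : g_sigma_algebraType (G s) -> K).
  by move=> /andP[s1 _]; apply: measurable_funX; exact: gamma_adapted.
have aA s : (1 <= s < t)%N ->
    measurable_fun setT (a s : g_sigma_algebraType (G s) -> K).
  by move=> st; apply: (measurable_dotv (ax s st)); case: (iter s st).
have sgA s : (1 <= s < t)%N ->
    measurable_fun setT (sg s : g_sigma_algebraType (G s) -> K).
  move=> st; apply: measurable_sqrt; apply: measurable_funM => //.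
  have sT := inT s st; have /andP[s1 _] := st.
  apply: measurable_qf (ax s st).
  apply: mx_measurable_inv => [w|].
    have sT1 : (1 <= s <= T.+1)%N by case/andP: sT => -> /leqW.
    by have [] := domd_spd n0 R0 S0 g0 (gamma01 w) hm (alg w) sT1.
  by apply: mx_measurable_prior; [exact: gamma_adapted|case: (iter s st)].
have z'A s : (1 <= s < t)%N ->
    measurable_fun setT (z' s : g_sigma_algebraType (G s) -> K).
  move=> st; have /andP[s1 _] := st.
  apply: measurable_funB; first exact: zA.
  apply: measurable_funM => //; apply: (measurable_dotv (ax s st)).
  by apply: mx_measurableB; exact: ath.
have LR s : (1 <= s < t)%N -> forall (D : Omega -> K) (U : Omega -> \bar K),
    measurable_fun setT (D : g_sigma_algebraType (G s) -> K) ->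
    measurable_fun setT (U : g_sigma_algebraType (G s) -> \bar K) ->
    (forall w, 0 <= U w)%E ->
    (\int[P]_w (U w * (expR ((r s w * D w - (m (z s w + D w) - m (z s w))) / g))%:E) <=
     \int[P]_w U w)%E.
  move=> st D U mD mU U0; have sT := inT s st.
  apply: (@likelihood_ratio_le K _ Omega P (G s) (G_measurable sT) m h g nu (r s) (z s)
    g0 (der_continuous dm) (glm_density_measurable hm) (glm_density_total hm)
    (rm s st) (zA s st) _ D U mD mU U0).
  by move=> A B hA mB; exact: (bandit_law bandit sT hA mB).
have E : t.-1.+1 = t by rewrite prednK.
have tlt : (t.-1 < t)%N by rewrite E.
have := @mix_factor_prod_le1 K m g (der_continuous dm) _ Omega P G om r z a sg z' p t
  p01 om01 GT GS rA rm zA omA aA sgA z'A LR t.-1 tlt.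
rewrite /= E => -[mU U0 U1]; split=> //.
apply: sub_measurable_fun mU; exact: G_measurable.
Qed.

Lemma wealth_whp : with_prob_ge P (1 - delta) (fun w => forall t, (1 <= t <= T)%N ->
  (wealth t w <= (expR (ln (pi ^+ 2 * t%:R ^+ 2 / (3 * delta))))%:E)%E).
Proof.
have /andP[d0 d1] := delta01.
have p3 : 3 <= pi ^+ 2 :> K.
  by have p2 := pi_ge2 K; rewrite expr2; move: (pi : K) p2 => q q2; nra.
have p20 : 0 < pi ^+ 2 :> K := lt_le_trans (ltr0n K 3) p3.
pose c t : K := pi ^+ 2 * t%:R ^+ 2 / (3 * delta).
have c0 t : (1 <= t)%N -> 0 < c t.
  move=> t1; have t20 : 0 < t%:R ^+ 2 :> K by rewrite exprn_gt0// ltr0n.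
  have q1 := mulr_gt0 p20 t20.
  by apply: divr_gt0; rewrite ?q1// mulr_gt0.
(* The index is shifted by 2: at round 1 the empty product meets its bound surely. *)
pose B i := [set w | ((c i.+2)%:E < wealth i.+2 w)%E].
have iT i : (i < T.-1)%N -> (1 <= i.+2 <= T)%N.
  by case: T T2 => // T' _ /=.
have mB i : (i < T.-1)%N -> measurable (B i).
  move=> /iT/wealth_mean[mU _ _].
  by rewrite /B -[X in measurable X]setTI; exact: emeasurable_fun_o_infty.
pose BB := \big[setU/set0]_(i < T.-1) B i.
have mBB : measurable BB by apply: bigsetU_measurable => i _; exact: mB.
have PB : (P BB <= delta%:E)%E.
  apply: (le_trans (Boole_inequality _ _)); first exact: mB.
  (* Markov's inequality gives [3 * delta / (pi ^+ 2 * t ^+ 2)], which is at most [delta / t ^+ 2]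
     since [3 <= pi ^+ 2]. *)
  apply: (@le_trans _ _ (\sum_(i < T.-1) (delta * (i.+2%:R ^+ 2)^-1)%:E)%E).
    apply: lee_sum => i _; have [mU U0 U1] := wealth_mean (iT _ (ltn_ord i)).
    apply: (le_trans (markov_ge0 (c0 i.+2 isT) mU U0 U1)).
    rewrite lee_fin /c invf_div ler_pdivrMr; last first.
      by apply: (mulr_gt0 p20); rewrite exprn_gt0// ltr0n.
    have -> : delta * (i.+2%:R ^+ 2)^-1 * (pi ^+ 2 * i.+2%:R ^+ 2) = delta * pi ^+ 2.
      by rewrite [pi ^+ 2 * _]mulrC mulrA divfK// sqrf_eq0 pnatr_eq0.
    by rewrite mulrC ler_pM2l.
  rewrite sumEFin lee_fin -mulr_sumr ler_piMr ?(ltW d0)//.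
  exact: sum_inv_sqr_le1.
exists (~` BB); first split; first exact: measurableC.
  by rewrite probability_setC// EFinB leeB.
move=> w BBw t /andP[t1 tT]; rewrite lnK ?posrE; last exact: c0.
case: t t1 tT => // -[|t] _ tT.
  rewrite /mixture_wealth big_geq// lee_fin expr1n mulr1.
  by rewrite ler_pdivlMr ?mulr_gt0// mul1r; apply: le_trans p3; rewrite ler_piMr// ltW.
rewrite leNgt; apply/negP => hw; apply: BBw; rewrite /BB.
have tlt : (t < T.-1)%N by case: T T2 tT.
rewrite -bigcup_mkord; exists t => //.
Qed.

End Wealth.

(** * Tuning the discount factor *)

Lemma powR32 (K : realType) (a : K) : 0 <= a -> a `^ (3 / 2) = a * Num.sqrt a.
Proof.
move=> a0; have -> : 3 / 2 = 1 + 2^-1 :> K by field.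
rewrite powRD; first by rewrite powRr1// powR12_sqrt.
by apply/implyP => /eqP; lra.
Qed.

Import -(notations) mpoly.

Definition log_poly (K : realType) : mpoly.mpoly 3 K :=
  \sum_(i < 3) mpolyX K (mnm1 i).

Lemma meval_log_poly (K : realType) (a b c : K) :
  meval (tnth [tuple a; b; c]) (log_poly K) = a + b + c.
Proof.
rewrite /log_poly raddf_sum/= !big_ord_recl big_ord0 !mevalXU addr0 addrA.
by rewrite !(tnth_nth 0).
Qed.

Lemma log_sum_ge1 (K : realType) (T : nat) (delta gamma : K) :
  (1 <= T)%N -> 0 < delta < 1 -> 0 < gamma < 1 ->
  1 <= ln (expR 1 * T%:R) + ln (expR 1 / delta) + ln (expR 1 / (1 - gamma)).
Proof.
move=> T1 /andP[d0 d1] /andP[g0 g1].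
have h1g : 0 < 1 - gamma by rewrite subr_gt0.
have T0 : 0 < T%:R :> K by rewrite ltr0n.
have e1 : 1 <= expR 1 :> K by rewrite -expR0 ler_expR.
have lnge (y : K) : 1 <= y -> expR 1 <= expR 1 * y by move=> y1; rewrite ler_peMr// expR_ge0.
have l1 : 1 <= ln (expR 1 * T%:R) :> K.
  rewrite -[leLHS](expRK 1) ler_ln ?posrE ?expR_gt0 ?mulr_gt0 ?expR_gt0//.
  by rewrite lnge// ler1n.
have l2 (y : K) : 0 < y <= 1 -> 0 <= ln (expR 1 / y).
  move=> /andP[y0 y1]; apply: ln_ge0; apply: (le_trans e1); apply: lnge.
  by rewrite invf_ge1.
have := l2 delta; rewrite d0 (ltW d1) => /(_ isT) q1.
have := l2 (1 - gamma); rewrite h1g gerBl (ltW g0) => /(_ isT) q2.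
by move: l1 q1 q2; move: (ln _) (ln _) (ln _) => *; lra.
Qed.

Lemma regret_const_ge0 (K : realType) (R S g k : K) : 0 < R -> 0 < S -> 0 < g -> 0 < k ->
  0 <= regret_const R S g k.
Proof.
move=> R0 S0 g0 k0; have e0 : 0 < 1 + R * S by rewrite addr_gt0// mulr_gt0.
have U0 : 0 <= leverage_const R S g k.
  have a0 : 0 <= 3 * (1 + R * S) / 2 by rewrite divr_ge0// mulr_ge0// ltW.
  apply: divr_ge0; first by rewrite mulr_ge0// ltW.
  by apply: mulr_ge0; rewrite ?sqr_ge0// !mulr_ge0// ltW.
by rewrite /regret_const addr_ge0// ?mulr_ge0 ?sqrtr_ge0 ?addr_ge0 ?(ltW k0).
Qed.

Lemma dyn_regret_trivial (K : realType) n (m h : K -> K)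
    (nu : {measure set (measurableTypeR K) -> \bar K}) (R S g cmu k : K) (T : nat)
    (thstar xstar x : nat -> 'cV[K]_n) : 0 < R -> 0 < S -> 0 < k ->
  glm_model R S g cmu k m h nu ->
  (forall t, (1 <= t <= T)%N -> [/\ l2ball S (thstar t), l2ball 1 (xstar t) & l2ball 1 (x t)]) ->
  dyn_regret m T thstar xstar x <= 2 * S * k * T%:R.
Proof.
move=> R0 S0 k0 hm b; have [_ dm1 _] := glm_model_derive hm.
have m20 z := sc_ge0 R0 (glm_self_concordant hm) z.
have m2k (z : K) : - S <= z <= S -> derive1 (link m) z <= k.
  by move=> /(glm_bounded_link hm)/andP[].
apply: (@le_trans _ _ (\sum_(1 <= t < T.+1) (k * (2 * S)))).
  apply: ler_sum_nat => t /b[thS xsB xB].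
  have h1 := dotv_ball (xsB : _ <= 1) thS; have h2 := dotv_ball (xB : _ <= 1) thS.
  apply: (link_gap_le dm1 m20 m2k h1 h2 (ltW k0)); first by rewrite mulr_ge0// ltW.
  by move: h1 h2 => /andP[a1 a2] /andP[a3 a4]; lra.
rewrite sumr_const_nat subn1/= -mulr_natr le_eqVlt; apply/orP; left; apply/eqP.
by ring.
Qed.

Section GammaOpt.
Context {K : realType} (d T : nat) (k P : K).
Hypothesis d1 : (1 <= d)%N.
Hypothesis T2 : (2 <= T)%N.
Hypothesis k0 : 0 < k.
Hypothesis P0 : 0 <= P.
Let q := 1 - gamma_opt d T k P.
(** The balance point of the discount-dependent terms of the regret: [d * T * sqrt s] equals
    [sqrt k * P / (s * sqrt s)]. *)
Let s := Num.sqrt (Num.sqrt k * P / (d%:R * T%:R)).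

Let T0 : 0 < T%:R :> K. Proof. by rewrite ltr0n (ltn_trans _ T2). Qed.
Let d0 : 0 < d%:R :> K. Proof. by rewrite ltr0n. Qed.
Let sk0 : 0 < Num.sqrt k. Proof. by rewrite sqrtr_gt0. Qed.

Let iT : T%:R^-1 <= 1 - T%:R^-1 :> K.
Proof.
have : T%:R^-1 <= 2^-1 :> K by rewrite lef_pV2 ?posrE// ler_nat.
by move: (T%:R^-1 : K) => y; lra.
Qed.

Let iT0 : 0 < T%:R^-1 :> K. Proof. by rewrite invr_gt0. Qed.

Lemma gamma_opt_bounds : T%:R^-1 <= gamma_opt d T k P <= 1 - T%:R^-1.
Proof.
rewrite /gamma_opt; apply/andP; split.
  by rewrite lerBrDl addrC -lerBrDl ge_min lexx.
by rewrite lerD2l lerN2 le_min iT le_max lexx.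
Qed.

Lemma gamma_opt01 : 0 < gamma_opt d T k P < 1.
Proof.
have /andP[h1 h2] := gamma_opt_bounds.
by rewrite (lt_le_trans iT0)//= (le_lt_trans h2)// gtrBl.
Qed.

Let qE : q = Num.min (1 - T%:R^-1) (Num.max T%:R^-1 s).
Proof. by rewrite /q /gamma_opt opprB addrC subrK. Qed.

Let ratio0 : 0 <= Num.sqrt k * P / (d%:R * T%:R).
Proof. by rewrite divr_ge0 ?mulr_ge0 ?sqrtr_ge0. Qed.

Let sqr_s : s ^+ 2 = Num.sqrt k * P / (d%:R * T%:R).
Proof. by rewrite sqr_sqrtr. Qed.

Let s0 : 0 <= s. Proof. exact: sqrtr_ge0. Qed.

Lemma gamma_opt_low : P < d%:R / (Num.sqrt k * T%:R) -> q = T%:R^-1.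
Proof.
move=> hP; have sT : s <= T%:R^-1.
  rewrite -ler_sqr ?nnegrE ?(ltW iT0)// sqr_s ler_pdivrMr ?mulr_gt0//.
  apply: (@le_trans _ _ (Num.sqrt k * (d%:R / (Num.sqrt k * T%:R)))).
    by rewrite ler_pM2l// ltW.
  by rewrite le_eqVlt; apply/orP; left; apply/eqP; field; rewrite !gt_eqF.
by rewrite qE max_l// min_r.
Qed.

Lemma gamma_opt_mid : d%:R / (Num.sqrt k * T%:R) <= P ->
  P <= d%:R * T%:R / Num.sqrt k * (1 - T%:R^-1) ^+ 2 -> q = s.
Proof.
move=> P1 P2; have i0 : 0 <= 1 - T%:R^-1 := le_trans (ltW iT0) iT.
rewrite qE max_r; last first.
  rewrite -ler_sqr ?nnegrE ?(ltW iT0)// sqr_s ler_pdivlMr ?mulr_gt0//.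
  rewrite (_ : T%:R^-1 ^+ 2 * _ = Num.sqrt k * (d%:R / (Num.sqrt k * T%:R))).
    by rewrite ler_pM2l.
  by field; rewrite !gt_eqF.
rewrite min_r// -ler_sqr ?nnegrE// sqr_s ler_pdivrMr ?mulr_gt0//.
rewrite (_ : (1 - T%:R^-1) ^+ 2 * _ =
    Num.sqrt k * (d%:R * T%:R / Num.sqrt k * (1 - T%:R^-1) ^+ 2)); last first.
  by field; rewrite !gt_eqF.
by rewrite ler_pM2l.
Qed.

Let bound y := d%:R * Num.sqrt T%:R + d%:R * T%:R * Num.sqrt y + P / (y * Num.sqrt y).

Lemma bound_low : P < d%:R / (Num.sqrt k * T%:R) ->
  bound q <= (2 + (Num.sqrt k)^-1) * (d%:R * Num.sqrt T%:R).
Proof.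
move=> hP; rewrite /bound gamma_opt_low//.
have sT0 : 0 < Num.sqrt T%:R :> K by rewrite sqrtr_gt0.
have TE : T%:R = Num.sqrt T%:R ^+ 2 :> K by rewrite sqr_sqrtr// ltW.
rewrite sqrtrV ?(ltW T0)//.
have -> : d%:R * T%:R / Num.sqrt T%:R = d%:R * Num.sqrt T%:R :> K.
  by rewrite {1}TE expr2 mulrA mulfK// gt_eqF.
have -> : (2 + (Num.sqrt k)^-1) * (d%:R * Num.sqrt T%:R) =
   d%:R * Num.sqrt T%:R + d%:R * Num.sqrt T%:R + d%:R / (Num.sqrt k * T%:R) * (T%:R * Num.sqrt T%:R).
  by field; rewrite !gt_eqF.
rewrite lerD2l -invfM invrK; apply: ler_wpM2r (ltW hP).
by rewrite mulr_ge0// ltW.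
Qed.

Lemma bound_mid : d%:R / (Num.sqrt k * T%:R) <= P ->
  P <= d%:R * T%:R / Num.sqrt k * (1 - T%:R^-1) ^+ 2 ->
  bound q <= (2 + (Num.sqrt k)^-1) *
    (k `^ (1 / 8) * d%:R `^ (3 / 4) * P `^ (1 / 4) * T%:R `^ (3 / 4)).
Proof.
move=> P1 P2; rewrite /bound (gamma_opt_mid P1 P2).
have Pp : 0 < P by apply: lt_le_trans P1; rewrite divr_gt0// mulr_gt0.
have ratio_gt0 : 0 < Num.sqrt k * P / (d%:R * T%:R) by rewrite divr_gt0 ?mulr_gt0.
have sp : 0 < s by rewrite sqrtr_gt0.
have ssp : 0 < Num.sqrt s by rewrite sqrtr_gt0.
have -> : k `^ (1 / 8) * d%:R `^ (3 / 4) * P `^ (1 / 4) * T%:R `^ (3 / 4) =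
    d%:R * T%:R * Num.sqrt s.
  rewrite -[Num.sqrt s]powR12_sqrt// /s -[Num.sqrt (_ / _)]powR12_sqrt//.
  rewrite -[Num.sqrt k]powR12_sqrt ?(ltW k0)//.
  rewrite /powR !gt_eqF// ?expR_gt0 ?mulr_gt0 ?invr_gt0 ?expR_gt0 ?mulr_gt0//.
  rewrite -{2}(lnK d0) -{2}(lnK T0) -!expRD expRK.
  rewrite ln_div ?posrE ?mulr_gt0 ?expR_gt0// !lnM ?posrE ?expR_gt0//.
  by congr expR; rewrite expRK; field.
(* Since [s] is at least [1 / T], the first term of the bound is dominated by the second. *)
have sE : T%:R^-1 <= s by rewrite -(gamma_opt_mid P1 P2) qE le_min iT le_max lexx.
have h1 : Num.sqrt T%:R <= T%:R * Num.sqrt s.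
  rewrite -ler_sqr ?nnegrE ?mulr_ge0 ?sqrtr_ge0 ?(ltW T0)// exprMn !sqr_sqrtr ?(ltW T0)//.
  apply: (@le_trans _ _ (T%:R ^+ 2 * T%:R^-1)); last by rewrite ler_pM2l// exprn_gt0.
  by rewrite expr2 mulfK// gt_eqF.
(* By the balance equation the third term is the second divided by [sqrt k]. *)
have -> : P / (s * Num.sqrt s) = (Num.sqrt k)^-1 * (d%:R * T%:R * Num.sqrt s).
  have -> : P = s ^+ 2 * (d%:R * T%:R) / Num.sqrt k.
    by rewrite sqr_s; field; rewrite !gt_eqF.
  have -> : s ^+ 2 = s * Num.sqrt s ^+ 2 by rewrite sqr_sqrtr// expr2.
  by field; rewrite !gt_eqF.
have := ler_wpM2l (ltW d0) h1; rewrite mulrA => h2.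
by rewrite mulrDl lerD2r; move: (d%:R * T%:R * _) (d%:R * _) h2 => *; lra.
Qed.

(** [T >= 2] makes [(1 - 1 / T) ^+ 2] at least 1 / 4. In this regime the horizon is thus at most a
    multiple of the path length, so a regret bound linear in [T] has the claimed order. *)
Lemma path_high : d%:R * T%:R / Num.sqrt k * (1 - T%:R^-1) ^+ 2 < P ->
  T%:R <= 4 * Num.sqrt k * P.
Proof.
move=> hP; have i2 : T%:R^-1 <= 2^-1 :> K by rewrite lef_pV2 ?posrE// ler_nat.
have h4 : 4^-1 <= (1 - T%:R^-1) ^+ 2 :> K.
  have -> : 4^-1 = 2^-1 ^+ 2 :> K by field.
  by rewrite ler_sqr ?nnegrE; move: (T%:R^-1 : K) i2 => y ?; lra.
have : d%:R * T%:R / Num.sqrt k * 4^-1 <= P.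
  apply: le_trans (ltW hP); rewrite ler_wpM2l// divr_ge0 ?mulr_ge0// ltW.
move=> h; have := ler_wpM2l (mulr_ge0 (ler0n K 4) (ltW sk0)) h.
have -> : 4 * Num.sqrt k * (d%:R * T%:R / Num.sqrt k * 4^-1) = d%:R * T%:R.
  by field; rewrite !gt_eqF.
apply: le_trans; rewrite ler_peMl ?(ltW T0)//.
by rewrite ler1n.
Qed.

End GammaOpt.

(** Stated for a random [gamma] so that the fixed and the tuned discount factors are both
    instances. *)
Lemma regret_whp (K : realType) n (m h : K -> K)
    (nu : {measure set (measurableTypeR K) -> \bar K}) (R S g cmu k delta : K) (T : nat)
    d (Omega : measurableType d) (P : probability Omega K)
    (gamma : Omega -> K) (th1 : 'cV[K]_n) (thstar xstar : nat -> Omega -> 'cV[K]_n)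
    (X : nat -> Omega -> set 'cV[K]_n) (x : nat -> Omega -> 'cV[K]_n)
    (r : nat -> Omega -> K) (th : nat -> Omega -> 'cV[K]_n) (H : nat -> Omega -> 'M[K]_n) :
  (0 < n)%N -> (2 <= T)%N -> 0 < R -> 0 < S -> 0 < g -> 0 < k -> 0 < cmu ->
  0 < delta < 1 -> glm_model R S g cmu k m h nu ->
  glm_bandit R S g m h nu T P thstar X x r ->
  (forall w, 0 < gamma w < 1) ->
  (forall w, domd_glb m R S g k (gamma w)
    (lambda_glb n R S g cmu k (1 + R * S) (3 * (1 + R * S) / 2)) delta (1 + R * S) T th1
    (X^~ w) (x^~ w) (r^~ w) (th^~ w) (H^~ w)) ->
  (forall t, (1 <= t)%N ->
    measurable_fun setT (gamma : g_sigma_algebraType (histgen x thstar r t) -> K)) ->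
  l2ball S th1 ->
  (forall t w, (1 <= t <= T)%N ->
     argmax (X t w) (fun y => link m (dotv y (thstar t w))) (xstar t w)) ->
  with_prob_ge P (1 - delta) (fun w =>
    dyn_regret m T (thstar^~ w) (xstar^~ w) (x^~ w) <= regret_const R S g k *
    (ln (expR 1 * T%:R) + ln (expR 1 / delta) + ln (expR 1 / (1 - gamma w))) *
    ((n%:R * Num.sqrt T%:R + n%:R * T%:R * Num.sqrt (1 - gamma w)
     + path_length T (thstar^~ w) / ((1 - gamma w) * Num.sqrt (1 - gamma w)))
     / Num.sqrt cmu)).
Proof.
move=> n0 T2 R0 S0 g0 k0 cmu0 delta01 hm bandit gamma01 alg gad th1S xstarP.
have [E PE EP] := wealth_whp n0 T2 R0 S0 g0 k0 cmu0 delta01 hm bandit gamma01 alg gad.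
exists E => // w Ew; apply: (regret_le_of_wealth n0 T2 R0 S0 g0 k0 cmu0 delta01
  (gamma01 w) hm th1S _ _ _ (alg w)) => [t t1|t tT|t tT|t tT].
- exact: (bandit_thstar_bounded bandit).
- exact: (bandit_X_bounded bandit).
- exact: xstarP.
- exact: EP.
Qed.

Lemma gamma_opt_adapted (K : realType) n (T : nat) (k : K) d (Omega : measurableType d)
    (x thstar : nat -> Omega -> 'cV[K]_n) (r : nat -> Omega -> K) t :
  measurable_fun setT ((fun w => gamma_opt n T k (path_length T (thstar^~ w)))
    : g_sigma_algebraType (histgen x thstar r t) -> K).
Proof.
have mPT : measurable_fun setT ((fun w => path_length T (thstar^~ w))
    : g_sigma_algebraType (histgen x thstar r t) -> K).
  (* Index 0 of [thstar] is junk without measurability; the guard makes every summand measurable, as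
     [measurable_bigsum] demands. *)
  pose f s w := if (1 <= s)%N then l2norm (thstar s.+1 w - thstar s w) else 0.
  rewrite (_ : (fun w => _) = fun w => \sum_(1 <= s < T) f s w); last first.
    by apply/funext => w; apply: eq_big_nat => s /andP[s1 _]; rewrite /f s1.
  apply: measurable_bigsum => s; rewrite /f.
  have [s1|s1] := ltnP 0 s; last exact: measurable_cst.
  rewrite (_ : (fun w => _) = fun w =>
    Num.sqrt (dotv (thstar s.+1 w - thstar s w) (thstar s.+1 w - thstar s w))).
    apply: measurable_sqrt; apply: measurable_dotv;
      apply: mx_measurableB; exact: adapted_thstar.
  by apply/funext => w; rewrite l2normE.
apply: measurable_funB => //; apply: measurable_minr => //; apply: measurable_maxr => //.
apply: measurable_sqrt; apply: measurable_funM => //.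
exact: measurable_funM.
Qed.

Theorem theorem2 (K : realType) :
  exists L : mpoly.mpoly 3 K,
  forall R S g kmu : K, 0 < R -> 0 < S -> 0 < g -> 0 < kmu ->
  exists C : K,
  forall (d T : nat) (delta cmu : K),
    (1 <= d)%N -> (2 <= T)%N -> 0 < delta < 1 -> 0 < cmu ->
  forall (m h : K -> K) (nu : {measure set (measurableTypeR K) -> \bar K}),
    glm_model R S g cmu kmu m h nu ->
  forall (disp : measure_display) (Omega : measurableType disp)
    (P : probability Omega K)
    (thstar : nat -> Omega -> 'cV[K]_d) (X : nat -> Omega -> set 'cV[K]_d)
    (x : nat -> Omega -> 'cV[K]_d) (r : nat -> Omega -> K)
    (xstar : nat -> Omega -> 'cV[K]_d),
    glm_bandit R S g m h nu T P thstar X x r ->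
    (forall t w, (1 <= t <= T)%N ->
       argmax (X t w) (fun y => link m (dotv y (thstar t w))) (xstar t w)) ->
  forall (th1 : 'cV[K]_d) (th : nat -> Omega -> 'cV[K]_d)
    (H : nat -> Omega -> 'M[K]_d),
    l2ball S th1 ->
  let eta := 1 + R * S in
  let alpha := 3 * eta / 2 in
  let lambda := lambda_glb d R S g cmu kmu eta alpha in
  let PT := fun w => path_length T (thstar^~ w) in
  let Reg := fun w => dyn_regret m T (thstar^~ w) (xstar^~ w) (x^~ w) in
  let runs := fun (gamma : K) (w : Omega) =>
    domd_glb m R S g kmu gamma lambda delta eta T th1
      (X^~ w) (x^~ w) (r^~ w) (th^~ w) (H^~ w) in
  (forall gamma : K, T%:R^-1 <= gamma < 1 ->
     (forall w, runs gamma w) ->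
     with_prob_ge P (1 - delta) (fun w =>
       soft_le L C T delta gamma (Reg w)
         (kmu / Num.sqrt cmu * d%:R * Num.sqrt T%:R
          + kmu / Num.sqrt cmu * d%:R * T%:R * Num.sqrt (1 - gamma)
          + kmu `^ (3 / 2) / Num.sqrt cmu
              * (PT w / (1 - gamma) `^ (3 / 2)))))
  /\
  (let gamma := fun w => gamma_opt d T kmu (PT w) in
   let p0 := d%:R / (Num.sqrt kmu * T%:R) in
   let p1 := d%:R * T%:R / Num.sqrt kmu * (1 - T%:R^-1) ^+ 2 in
   (forall w, runs (gamma w) w) ->
   with_prob_ge P (1 - delta) (fun w =>
     [/\ 0 <= PT w < p0 ->
           soft_le L C T delta (gamma w) (Reg w)
             (kmu / Num.sqrt cmu * d%:R * Num.sqrt T%:R),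
         p0 <= PT w <= p1 ->
           soft_le L C T delta (gamma w) (Reg w)
             (kmu `^ (9 / 8) / Num.sqrt cmu * d%:R `^ (3 / 4)
                * PT w `^ (1 / 4) * T%:R `^ (3 / 4))
       & p1 < PT w ->
           soft_le L C T delta (gamma w) (Reg w)
             (kmu `^ (3 / 2) / Num.sqrt cmu * PT w)])).
Proof.
exists (log_poly K) => R S g k R0 S0 g0 k0.
pose rc := regret_const R S g k; pose sk := Num.sqrt k.
have rc0 : 0 <= rc := regret_const_ge0 R0 S0 g0 k0.
have sk0 : 0 < sk by rewrite sqrtr_gt0.
have skk : sk ^+ 2 = k by rewrite sqr_sqrtr// ltW.
(* The constant may depend on [k], which allows the powers of [k] in the claims to be restored. [C1]
   serves the general bound, [C2] the first two regimes and [C3] the trivial bound of the last. *)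
pose C1 := rc / k + rc / (k * sk); pose C2 := rc * (2 + sk^-1) / k; pose C3 := 8 * S * sk.
have C10 : 0 <= C1 by rewrite addr_ge0 ?divr_ge0 ?mulr_ge0// ltW.
have i0 : 0 <= 2 + sk^-1 by rewrite addr_ge0// invr_ge0 ltW.
have C20 : 0 <= C2 by rewrite divr_ge0 ?(ltW k0)// mulr_ge0.
have C30 : 0 <= C3 by rewrite !mulr_ge0// ltW.
exists (C1 + C2 + C3) => d T delta cmu d1 T2 delta01 cmu0 m h nu hm disp Omega P thstar X
  x r xstar bandit xstarP th1 th H th1S eta alpha lambda PT Reg runs.
have sc0 : 0 < Num.sqrt cmu by rewrite sqrtr_gt0.
have T1 : (1 <= T)%N := ltnW T2.
have T0 : 0 < T%:R :> K by rewrite ltr0n.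
have PT0 w : 0 <= PT w by rewrite sumr_ge0// => t _; exact: l2norm_ge0.
have weaken (c l y : K) : 0 <= l -> 0 <= y -> c <= C1 + C2 + C3 ->
    c * l * y <= (C1 + C2 + C3) * l * y.
  by move=> l0 y0 hc; rewrite ler_wpM2r// ler_wpM2r.
split=> [gamma /andP[gT g1] hruns|gamma p0 p1 hruns].
  have g0' : 0 < gamma by apply: lt_le_trans gT; rewrite invr_gt0.
  have h1g : 0 < 1 - gamma by rewrite subr_gt0.
  have gamma01 : 0 < gamma < 1 by rewrite g0'.
  have [E PE EP] := @regret_whp K d m h nu R S g cmu k delta T disp Omega P (fun=> gamma)
    th1 thstar xstar X x r th H d1 T2 R0 S0 g0 k0 cmu0 delta01 hm bandit (fun=> gamma01)
    hruns (fun _ _ => measurable_cst _) th1S xstarP.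
  exists E => // w Ew; rewrite /soft_le meval_log_poly.
  have ell1 := log_sum_ge1 T1 delta01 gamma01.
  have := EP w Ew; rewrite -/rc.
  move: ell1; set ell := _ + _ + _ => ell1; have ell0 := le_trans ler01 ell1.
  move=> h1; apply: (le_trans h1).
  rewrite !powR32 ?(ltW k0) ?(ltW h1g)// -/sk.
  set b1 := d%:R * Num.sqrt T%:R; set b2 := d%:R * T%:R * Num.sqrt (1 - gamma).
  rewrite -/(PT w); set b3 := PT w / _.
  have b10 : 0 <= b1 by rewrite mulr_ge0 ?sqrtr_ge0.
  have b20 : 0 <= b2 by rewrite !mulr_ge0 ?sqrtr_ge0// ltW.
  have b30 : 0 <= b3 by rewrite divr_ge0 ?PT0// mulr_ge0 ?sqrtr_ge0// ltW.
  have -> : k / Num.sqrt cmu * d%:R * Num.sqrt T%:R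
      + k / Num.sqrt cmu * d%:R * T%:R * Num.sqrt (1 - gamma)
      + k * sk / Num.sqrt cmu * b3 = k / Num.sqrt cmu * (b1 + b2 + sk * b3).
    by rewrite /b1 /b2; ring.
  have y0 : 0 <= k / Num.sqrt cmu * (b1 + b2 + sk * b3).
    apply: mulr_ge0; first by rewrite divr_ge0// ltW.
    by apply: addr_ge0; [exact: addr_ge0|rewrite mulr_ge0// ltW].
  apply: le_trans (weaken C1 _ _ ell0 y0 _); last by rewrite -addrA lerDl addr_ge0.
  rewrite -subr_ge0.
  have -> : C1 * ell * (k / Num.sqrt cmu * (b1 + b2 + sk * b3))
      - rc * ell * ((b1 + b2 + b3) / Num.sqrt cmu) =
      ell * (rc * sk * b3 + rc / sk * (b1 + b2)) / Num.sqrt cmu.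
    by rewrite /C1; field; rewrite !gt_eqF.
  have u1 : 0 <= rc * sk * b3 by rewrite mulr_ge0// mulr_ge0// ltW.
  have u2 : 0 <= rc / sk * (b1 + b2).
    by rewrite mulr_ge0 ?addr_ge0// divr_ge0// ltW.
  by apply: divr_ge0 (ltW sc0); apply: mulr_ge0 => //; exact: addr_ge0.
have gamma01 w : 0 < gamma w < 1 := gamma_opt01 d k (PT w) T2.
have [E PE EP] := @regret_whp K d m h nu R S g cmu k delta T disp Omega P gamma
  th1 thstar xstar X x r th H d1 T2 R0 S0 g0 k0 cmu0 delta01 hm bandit gamma01
  hruns (fun t _ => @gamma_opt_adapted K d T k _ Omega x thstar r t) th1S xstarP.
exists E => // w Ew; rewrite /soft_le meval_log_poly.
have ell1 := log_sum_ge1 T1 delta01 (gamma01 w).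
have := EP w Ew; rewrite -/rc -/(PT w) -/(Reg w).
move: ell1; set ell := _ + _ + _ => ell1; have ell0 := le_trans ler01 ell1.
have kc0 : 0 <= k / Num.sqrt cmu by rewrite divr_ge0// ltW.
have C2le (B y : K) : 0 <= y -> B <= (2 + sk^-1) * y ->
    rc * ell * (B / Num.sqrt cmu) <= (C1 + C2 + C3) * ell * (k / Num.sqrt cmu * y).
  move=> y0 By; apply: le_trans (weaken C2 _ _ ell0 (mulr_ge0 kc0 y0) _); last first.
    by rewrite addrAC lerDr addr_ge0.
  have -> : C2 * ell * (k / Num.sqrt cmu * y) =
      rc * ell * ((2 + sk^-1) * y / Num.sqrt cmu).
    by rewrite /C2; field; rewrite !gt_eqF.
  by rewrite ler_wpM2l ?mulr_ge0// ler_pM2r ?invr_gt0.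
move=> hReg; split=> [/andP[_ hP]|/andP[hP1 hP2]|hP].
- apply: (le_trans hReg); rewrite -[_ / _ * d%:R * _]mulrA.
  by apply: C2le; [rewrite mulr_ge0 ?sqrtr_ge0|exact: bound_low].
- apply: (le_trans hReg).
  have -> : k `^ (9 / 8) / Num.sqrt cmu * d%:R `^ (3 / 4) * PT w `^ (1 / 4) * T%:R `^ (3 / 4)
      = k / Num.sqrt cmu * (k `^ (1 / 8) * d%:R `^ (3 / 4) * PT w `^ (1 / 4) * T%:R `^ (3 / 4)).
    have -> : 9 / 8 = 1 + 1 / 8 :> K by field.
    by rewrite powRD ?gt_eqF ?implybT// powRr1 ?(ltW k0)//; ring.
  apply: C2le; first by rewrite !mulr_ge0 ?powR_ge0.
  exact: bound_mid.
- have cmuk : cmu <= k.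
    have z0 : - S <= 0 <= S by rewrite oppr_le0 ltW.
    by have /andP[q1 q2] := glm_bounded_link hm z0; exact: le_trans q1 q2.
  have triv : Reg w <= 2 * S * k * T%:R.
    apply: (dyn_regret_trivial R0 S0 k0 hm) => t tT; have /andP[t1 _] := tT.
    have XB : X t w `<=` l2ball 1 by exact: (bandit_X_bounded bandit).
    have [xsX _] := xstarP t w tT.
    split; first exact: (bandit_thstar_bounded bandit).
      exact: XB.
    by apply: XB; exact: (bandit_x_in bandit).
  have hT : T%:R <= 4 * sk * PT w by exact: path_high hP.
  rewrite powR32 ?(ltW k0)// -/sk.
  have y0 : 0 <= k * sk / Num.sqrt cmu * PT w.
    by rewrite mulr_ge0// divr_ge0 ?mulr_ge0// ltW.
  apply: le_trans (weaken C3 _ _ ell0 y0 _); last by rewrite lerDr addr_ge0.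
  apply: (le_trans triv).
  have Sk0 : 0 <= 2 * S * k by rewrite !mulr_ge0// ltW.
  apply: (le_trans (ler_wpM2l Sk0 hT)).
  (* The claimed bound exceeds the trivial one by a logarithm and by [sqrt (k / cmu)], both at least
     1. *)
  have r1 : 1 <= ell * (sk / Num.sqrt cmu).
    by apply: mulr_ege1 => //; rewrite ler_pdivlMr// mul1r ler_wsqrtr.
  have -> : C3 * ell * (k * sk / Num.sqrt cmu * PT w) =
      2 * S * k * (4 * sk * PT w) * (ell * (sk / Num.sqrt cmu)).
    by rewrite /C3; ring.
  rewrite ler_peMr//; apply: mulr_ge0 => //; rewrite mulr_ge0// mulr_ge0//.
  exact: ltW.
Qed.
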